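(* Let $\mathfrak g=\mathfrak q(\infty)$. The category $\operatorname{Trep}\mathfrak g$ coincides with the category $\mathcal O'_{int}$, as full subcategories of the category of $\mathfrak g$-modules: a $\mathfrak g$-module is integrable, of finite length and satisfies the large annihilator condition if and only if it is finitely generated, $\mathfrak h_0$-semisimple, $\mathfrak n$-locally nilpotent, integrable and satisfies the large annihilator condition.
   Context: All vector spaces are over $\mathbb C$ and $\mathbb Z_2$-graded; $p(x)$ is the parity of $x$; morphisms in module categories preserve parity. The Lie superalgebra: $V=V_0\oplus V_1$ has even basis $\{e_i\}$ and odd basis $\{\bar e_i\}$, $W=W_0\oplus W_1$ has even basis $\{f_i\}$ and odd basis $\{\bar f_i\}$, $i\in\mathbb Z\setminus 0$; the even pairing $W\times V\to\mathbb C$ is given by $(f_i,e_j)=(\bar f_i,\bar e_j)=\delta_{ij}$, all other pairings of basis vectors being $0$. The odd operator $P$ is $Pe_i=\bar e_i$, $P\bar e_i=-e_i$ on $V$ and $Pf_i=\bar f_i$, $P\bar f_i=f_i$ on $W$. $\mathfrak g=\mathfrak q(\infty)$ is the Lie superalgebra of finitary operators $X$ on $V\oplus W$ preserving $V$ and $W$ with $(Xw,v)=-(-1)^{p(w)p(X)}(w,Xv)$ and $[X,P]=0$; it is spanned by $e_i\otimes f_j+\bar e_i\otimes\bar f_j$ and $e_i\otimes\bar f_j+\bar e_i\otimes f_j$, $i,j\in\mathbb Z\setminus 0$ (where $u\otimes w$ acts on $V$ by $v\mapsto (w,v)u$). For $n\ge1$ let $\mathfrak g_n\simeq\mathfrak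 q(n)$ be the span of these elements with $i,j\in I_n=\{i\ne 0:-\lfloor n/2\rfloor\le i\le\lceil n/2\rceil\}$, and let $\mathfrak c_n\simeq\mathfrak q(\infty)$ be the subalgebra (commuting with $\mathfrak g_n$) spanned by these elements with $i,j\notin I_n$. A $\mathfrak g$-module $M$ satisfies the large annihilator condition if $M=\bigcup_n M^{\mathfrak c_n}$. $M$ is integrable if for every $n>0$ its restriction to $\mathfrak g_n$ lifts to a representation of the algebraic supergroup $Q(n)$. $\operatorname{Trep}\mathfrak g$ is the full subcategory of $\mathfrak g$-modules that are integrable, have finite length and satisfy the large annihilator condition. Order $\mathbb Z\setminus0$ by $1\prec2\prec\dots\prec-2\prec-1$. Let $\mathfrak h$ be spanned by the elements $e_i\otimes f_j+\bar e_i\otimes\bar f_j$ and $e_i\otimes\bar f_j+\bar e_i\otimes f_j$ with $i=j$, let $\mathfrak h_0$ be its even part, let $\mathfrak n$ be spanned by the elements with $i\prec j$, and $\mathfrak b=\mathfrak h\oplus\mathfrak n$. $\mathcal O$ is the category of finitely generated, $\mathfrak h_0$-semisimple, $\mathfrak n$-locally nilpotent $\mathfrak g$-modules; $\mathcal O'$ is its full subcategory of modules satisfying the large annihilator condition; $\mathcal O'_{int}$ is the full subcategory of integrable modules in $\mathcal O'$. *)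

(* Defs.v *)
(* The Lie superalgebra q(oo), its modules and the supergroups Q(n), over an
   arbitrary field C. *)
From HB Require Import structures.
From mathcomp Require Import all_boot all_order all_algebra.
From mathcomp Require Import finmap monalg.
From mathcomp Require Import boolp classical_sets functions zify.

Set Implicit Arguments.
Unset Strict Implicit.
Unset Printing Implicit Defensive.

Import GRing.Theory Num.Theory.
Local Open Scope classical_set_scope.
Local Open Scope ring_scope.
Local Open Scope quotient_scope.

(* Parities are booleans: false is even, true is odd, s (+) t is their sum and
   s && t their product. *)
Record grading (C : fieldType) (M : lmodType C) (part : bool -> set M) : Prop :=
  Grading {
    grading0 : forall s, part s 0;
    gradingP : forall s (c : C) u v,
      part s u -> part s v -> part s (c *: u + v);
    grading_sum : forall v, exists v0 v1,
      [/\ part false v0, part true v1 & v = v0 + v1];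
    grading_direct : forall v, part false v -> part true v -> v = 0 }.

Record superSpace (C : fieldType) := SuperSpace {
  space :> lmodType C;
  part : bool -> set space;
  partP : grading part }.

Section Components.
Variables (C : fieldType) (M : superSpace C).
Implicit Types (u v : M) (s t : bool).

Definition component s v : M :=
  xget 0 [set u | part s u /\ part (~~ s) (v - u)].

Lemma part0 s : part s (0 : M). Proof. exact: grading0 (partP M) s. Qed.

Lemma partD s u v : part s u -> part s v -> part s (u + v).
Proof. by move=> us vs; rewrite -[u]scale1r; apply: (gradingP (partP M)). Qed.

Lemma partZ s (c : C) u : part s u -> part s (c *: u).
Proof.
by move=> us; rewrite -[_ *: _]addr0; apply: (gradingP (partP M)) => //; exact: part0.
Qed.

Lemma partN s u : part s u -> part s (- u).
Proof. by move=> us; rewrite -scaleN1r; exact: partZ. Qed.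

Lemma partB s u v : part s u -> part s v -> part s (u - v).
Proof. by move=> us vs; apply: partD => //; exact: partN. Qed.

Lemma part_direct s v : part s v -> part (~~ s) v -> v = 0.
Proof. by case: s => /= *; apply: (grading_direct (partP M)). Qed.

Lemma componentP s v : part s (component s v) /\ part (~~ s) (v - component s v).
Proof.
suff E : exists u, [set u | part s u /\ part (~~ s) (v - u)] u.
  exact: (xgetPex 0 E).
have [v0 [v1 [h0 h1 ->]]] := grading_sum (partP M) v.
case: s; [exists v1|exists v0]; rewrite /= ?addrK //.
by rewrite [v0 + v1]addrC addrK.
Qed.

Lemma component_part s v : part s (component s v).
Proof. by have [] := componentP s v. Qed.

Lemma component_uniq s u v : part s u -> part (~~ s) (v - u) -> component s v = u.
Proof.
move=> us vus; apply/eqP; rewrite -subr_eq0; apply/eqP.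
have [h1 h2] := componentP s v; apply: (@part_direct s); first exact: partB.
have -> : component s v - u = (v - u) - (v - component s v).
  by rewrite opprB [RHS]addrC addrA subrK.
exact: partB.
Qed.

Lemma component_id s v : part s v -> component s v = v.
Proof. by move=> vs; apply: component_uniq => //; rewrite subrr; exact: part0. Qed.

Lemma component_opp s v : part (~~ s) v -> component s v = 0.
Proof. by move=> vs; apply: component_uniq; rewrite ?subr0 //; exact: part0. Qed.

Lemma component_sum v : v = component false v + component true v.
Proof.
have [h1 h2] := componentP false v.
have -> : component true v = v - component false v.
  by apply: component_uniq => //; rewrite subKr.
by rewrite addrC subrK.
Qed.

End Components.

Definition bilin (C : fieldType) (M N U : lmodType C) (b : M -> N -> U) : Prop :=
  (forall m, linear (b m)) /\ (forall n, linear (b^~ n)).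

Definition spanned (C : fieldType) (M : lmodType C) (S : set M) : set M :=
  [set x | exists (n : nat) (c : 'I_n -> C) (v : 'I_n -> M),
     (forall i, S (v i)) /\ x = \sum_i c i *: v i].

Section LinearMaps.
Variables (C : fieldType) (U V W : lmodType C).
Implicit Types (f g : U -> V) (c : C).

Lemma linear_fun0 f : linear f -> f 0 = 0.
Proof. by move=> fl; have := fl (-1) 0 0; rewrite !scaleN1r !addNr. Qed.

Lemma linear_funD f x y : linear f -> f (x + y) = f x + f y.
Proof. by move=> fl; have := fl 1 x y; rewrite !scale1r. Qed.

Lemma linear_funZ f c x : linear f -> f (c *: x) = c *: f x.
Proof. by move=> fl; have := fl c x 0; rewrite linear_fun0 // !addr0. Qed.

Lemma linear_comb f g c : linear f -> linear g -> linear (c *: f + g).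
Proof.
move=> fl gl a x y; rewrite -[LHS]/(c *: f _ + g _) fl gl.
rewrite -[(_ + _) x]/(c *: f x + g x) -[(_ + _) y]/(c *: f y + g y).
by rewrite !scalerDr addrACA !scalerA [c * a]mulrC.
Qed.

Lemma linear_scaled (h : U -> C^o) (v : V) :
  linear h -> linear (fun x => (h x : C) *: v).
Proof. by move=> hl c x y; rewrite hl scalerDl scalerA. Qed.

Lemma linear_scaler (h : U -> C^o) c :
  linear h -> linear (fun x => c * h x : C^o).
Proof. by move=> hl a x y; rewrite hl mulrDr; congr (_ + _); apply: mulrCA. Qed.

Lemma linear_comp f (h : V -> W) : linear f -> linear h -> linear (h \o f).
Proof. by move=> fl hl a x y; rewrite /= fl hl. Qed.

Lemma linear_0 : linear (0 : U -> V).
Proof. by move=> a x y; rewrite -[LHS]/0 -[RHS]/(a *: 0 + 0) scaler0 addr0. Qed.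

End LinearMaps.

Section Intertwiners.
Variables (C : fieldType) (U : lmodType C).
Implicit Types (p q r : U -> U) (c d : C).

Lemma scalerD_acomm c (x y z t : U) :
  c *: (x + y) + (z + t) = (c *: x + z) + (c *: y + t).
Proof. by rewrite scalerDr addrACA. Qed.

Lemma intertwine_comb p q r c d : linear r ->
  (forall v, p (r v) = d *: r (p v)) -> (forall v, q (r v) = d *: r (q v)) ->
  forall v, (c *: p + q) (r v) = d *: r ((c *: p + q) v).
Proof.
move=> rl pr qr v; rewrite -[LHS]/(c *: p (r v) + q (r v)) pr qr.
rewrite -[(_ + _) v]/(c *: p v + q v) rl scalerDr !scalerA.
by rewrite [c * d]mulrC.
Qed.

Lemma intertwine_comp p q r c d : linear p ->
  (forall v, p (r v) = c *: r (p v)) -> (forall v, q (r v) = d *: r (q v)) ->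
  forall v, (p \o q) (r v) = (c * d) *: r ((p \o q) v).
Proof.
by move=> pl pr qr v; rewrite /= qr linear_funZ // pr scalerA mulrC.
Qed.

End Intertwiners.

(* M (x) N is the quotient of the formal sums of pairs (m, n) by the relation of
   having the same image under every bilinear map. *)
Section Tensor.
Variables (C : fieldType) (M N : lmodType C).
Implicit Types x y z : seq (M * N).

Definition formal_sum (U : lmodType C) (b : M -> N -> U) x : U :=
  \sum_(p <- x) b p.1 p.2.

Definition tensor_eq x y : bool :=
  `[< forall (U : lmodType C) (b : M -> N -> U),
        bilin b -> formal_sum b x = formal_sum b y >].

Lemma tensor_eqP x y :
  reflect (forall (U : lmodType C) (b : M -> N -> U),
             bilin b -> formal_sum b x = formal_sum b y) (tensor_eq x y).
Proof. exact: asboolP. Qed.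

Lemma tensor_eq_refl : reflexive tensor_eq.
Proof. by move=> x; apply/tensor_eqP. Qed.

Lemma tensor_eq_sym : symmetric tensor_eq.
Proof.
by move=> x y; apply/tensor_eqP/tensor_eqP => h U b bb; rewrite h.
Qed.

Lemma tensor_eq_trans : transitive tensor_eq.
Proof.
move=> y x z /tensor_eqP h1 /tensor_eqP h2.
by apply/tensor_eqP => U b bb; rewrite h1 ?h2.
Qed.

Canonical tensor_equiv :=
  EquivRel tensor_eq tensor_eq_refl tensor_eq_sym tensor_eq_trans.

Definition tensor := {eq_quot tensor_eq}.
HB.instance Definition _ := Choice.on tensor.

Definition tensor_class x : tensor := \pi_({eq_quot tensor_eq}) x.
Definition tensor_repr (t : tensor) : seq (M * N) := repr t.

Lemma tensor_reprK t : tensor_class (tensor_repr t) = t.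
Proof. exact: reprK. Qed.

Lemma tensor_classP x y :
  (forall (U : lmodType C) (b : M -> N -> U),
     bilin b -> formal_sum b x = formal_sum b y) <->
  tensor_class x = tensor_class y.
Proof.
split=> [h|/eqmodP /tensor_eqP //].
by apply/eqmodP/tensor_eqP.
Qed.

Lemma tensor_repr_class (U : lmodType C) (b : M -> N -> U) x :
  bilin b -> formal_sum b (tensor_repr (tensor_class x)) = formal_sum b x.
Proof. exact: (tensor_classP _ _).2 (tensor_reprK _) U b. Qed.

Definition scale_seq (c : C) x : seq (M * N) := [seq (c *: p.1, p.2) | p <- x].

Lemma formal_sum_cat (U : lmodType C) (b : M -> N -> U) x y :
  formal_sum b (x ++ y) = formal_sum b x + formal_sum b y.
Proof. exact: big_cat. Qed.

Lemma formal_sum_scale (U : lmodType C) (b : M -> N -> U) c x :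
  bilin b -> formal_sum b (scale_seq c x) = c *: formal_sum b x.
Proof.
move=> [_ bl]; rewrite /formal_sum big_map scaler_sumr.
apply: eq_bigr => p _ /=.
have b0 : b 0 p.2 = 0.
  have /= h := bl p.2 (-1) 0 0.
  by move: h; rewrite scaleN1r oppr0 addr0 scaleN1r addNr.
by have /= := bl p.2 c p.1 0; rewrite b0 !addr0.
Qed.

Definition tensor_zero : tensor := tensor_class [::].
Definition tensor_add (t u : tensor) : tensor :=
  tensor_class (tensor_repr t ++ tensor_repr u).
Definition tensor_scale (c : C) (t : tensor) : tensor :=
  tensor_class (scale_seq c (tensor_repr t)).

Let simp := (formal_sum_cat, formal_sum_scale, tensor_repr_class).
Let fs0 (U : lmodType C) (b : M -> N -> U) : formal_sum b [::] = 0.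
Proof. exact: big_nil. Qed.

Lemma tensor_addA : associative tensor_add.
Proof. by move=> x y z; apply/tensor_classP => U b bb; rewrite !simp // addrA. Qed.

Lemma tensor_addC : commutative tensor_add.
Proof. by move=> x y; apply/tensor_classP => U b bb; rewrite !simp // addrC. Qed.

Lemma tensor_add0 : left_id tensor_zero tensor_add.
Proof.
move=> x; rewrite -[RHS]tensor_reprK; apply/tensor_classP => U b bb.
by rewrite !simp // fs0 add0r.
Qed.

Lemma tensor_addN : left_inverse tensor_zero (tensor_scale (-1)) tensor_add.
Proof.
by move=> x; apply/tensor_classP => U b bb; rewrite !simp // fs0 scaleN1r addNr.
Qed.

HB.instance Definition _ :=
  GRing.isZmodule.Build tensor tensor_addA tensor_addC tensor_add0 tensor_addN.

Lemma tensor_scaleA a b (x : tensor) :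
  tensor_scale a (tensor_scale b x) = tensor_scale (a * b) x.
Proof. by apply/tensor_classP => U f ff; rewrite !simp // scalerA. Qed.

Lemma tensor_scale1 : left_id 1 tensor_scale.
Proof.
move=> x; rewrite -[RHS]tensor_reprK; apply/tensor_classP => U b bb.
by rewrite !simp // scale1r.
Qed.

Lemma tensor_scaleDr : right_distributive tensor_scale +%R.
Proof.
by move=> c x y; apply/tensor_classP => U f ff; rewrite !simp // scalerDr.
Qed.

Lemma tensor_scaleDl (x : tensor) : {morph tensor_scale^~ x : a b / a + b}.
Proof.
by move=> a b; apply/tensor_classP => U f ff; rewrite !simp // scalerDl.
Qed.

HB.instance Definition _ := GRing.Zmodule_isLmodule.Build C tensor
  tensor_scaleA tensor_scale1 tensor_scaleDr tensor_scaleDl.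

Definition tens (m : M) (n : N) : tensor := tensor_class [:: (m, n)].

(* The linear map M (x) N -> U induced by a bilinear b : M -> N -> U. *)
Definition tensor_lift (U : lmodType C) (b : M -> N -> U) (t : tensor) : U :=
  formal_sum b (tensor_repr t).

Lemma tensor_lift_tens (U : lmodType C) (b : M -> N -> U) m n :
  bilin b -> tensor_lift b (tens m n) = b m n.
Proof.
by move=> bb; rewrite /tensor_lift tensor_repr_class // /formal_sum big_seq1.
Qed.

Lemma tensor_lift_linear (U : lmodType C) (b : M -> N -> U) :
  bilin b -> linear (tensor_lift b).
Proof. by move=> bb c x y; rewrite /tensor_lift !simp. Qed.

Lemma tens_bilin : bilin tens.
Proof.
split=> [m c x y|n c x y]; apply/tensor_classP => U b bb; rewrite !simp //;
  by rewrite /formal_sum !big_seq1 /=; case: bb => [b1 b2]; rewrite ?b1 // b2.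
Qed.

Lemma tensor_sumE t : t = \sum_(p <- tensor_repr t) tens p.1 p.2.
Proof.
rewrite -[LHS]tensor_reprK; elim: (tensor_repr t) => [|[m n] s IH].
  by rewrite big_nil.
rewrite big_cons -IH /=; apply/tensor_classP => U b bb.
by rewrite !simp // /formal_sum big_cons big_seq1.
Qed.

End Tensor.

Definition tensor_part (C : fieldType) (M N : superSpace C) (s : bool) :
    set (tensor M N) :=
  spanned [set x | exists t m n, [/\ part t m, part (s (+) t) n & x = tens m n]].

(* For a set I of indices, both V and W are spaces with basis I * bool:
   (i, false) stands for e_i (resp. f_i) and (i, true) for its odd partner. *)
HB.lock Definition pairing (C : fieldType) (I : choiceType)
    (w v : {malg C[(I * bool)%type]}) : C :=
  \sum_(k <- msupp w) w@_k * v@_k.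

HB.lock Definition opP_V (C : fieldType) (I : choiceType)
    (v : {malg C[(I * bool)%type]}) : {malg C[(I * bool)%type]} :=
  \sum_(k <- msupp v) << (-1) ^+ k.2 * v@_k *g (k.1, ~~ k.2) >>.

HB.lock Definition opP_W (C : fieldType) (I : choiceType)
    (w : {malg C[(I * bool)%type]}) : {malg C[(I * bool)%type]} :=
  \sum_(k <- msupp w) << w@_k *g (k.1, ~~ k.2) >>.

Section Queer.
Variables (C : fieldType) (I : choiceType).
Local Notation bidx := (I * bool)%type.
Local Notation vecV := {malg C[bidx]}.
Local Notation vecW := {malg C[bidx]}.

Definition basis_part (s : bool) : set {malg C[bidx]} :=
  [set v | forall k, v@_k != 0 -> k.2 = s].


Definition finite_rank (M : lmodType C) (f : M -> M) : Prop :=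
  exists (n : nat) (v : 'I_n -> M),
    forall x, exists c : 'I_n -> C, f x = \sum_i c i *: v i.

(* Maps preserving V and W, given by their restrictions to V and W. *)
Definition operator := ((vecV -> vecV) * (vecW -> vecW))%type.
HB.instance Definition _ := GRing.Lmodule.on operator.

(* [X, P] is a supercommutator and P is odd, whence the sign in the last two
   conditions. *)
Record queer_part (s : bool) (X : operator) : Prop := QueerPart {
  queer_linV : linear X.1;
  queer_linW : linear X.2;
  queer_rankV : finite_rank X.1;
  queer_rankW : finite_rank X.2;
  queer_parV : forall t v, basis_part t v -> basis_part (s (+) t) (X.1 v);
  queer_parW : forall t w, basis_part t w -> basis_part (s (+) t) (X.2 w);
  queer_pairing : forall t w v, basis_part t w ->
    pairing (X.2 w) v = - (-1) ^+ (t && s) * pairing w (X.1 v);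
  queer_P_V : forall v, X.1 (opP_V v) = (-1) ^+ s *: opP_V (X.1 v);
  queer_P_W : forall w, X.2 (opP_W w) = (-1) ^+ s *: opP_W (X.2 w) }.

Definition is_queer : {pred operator} := fun X =>
  `[< exists X0 X1, [/\ queer_part false X0, queer_part true X1 & X = X0 + X1] >].

Lemma pairingEw (D : {fset bidx}) (w : vecW) (v : vecV) :
  fsubset (msupp w) D -> pairing w v = \sum_(k <- D) w@_k * v@_k.
Proof.
move=> wD; rewrite pairing.unlock; apply: big_fset_incl => // k _ /mcoeff_outdom ->.
by rewrite mul0r.
Qed.

Lemma pairing_linl (v : vecV) (c : C) (w1 w2 : vecW) :
  pairing (c *: w1 + w2) v = c * pairing w1 v + pairing w2 v.
Proof.
pose D := fsetU (msupp (c *: w1 + w2)) (fsetU (msupp w1) (msupp w2)).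
rewrite !(@pairingEw D) /D.
- rewrite mulr_sumr -big_split; apply: eq_bigr => k _.
  by rewrite mcoeffD mcoeffZ mulrDl mulrA.
- by apply/fsubsetP => k; rewrite !in_fsetU => ->; rewrite !orbT.
- by apply/fsubsetP => k; rewrite !in_fsetU => ->; rewrite !orbT.
- by apply/fsubsetP => k; rewrite !in_fsetU => ->.
Qed.

Lemma pairing_linr (w : vecW) (c : C) (v1 v2 : vecV) :
  pairing w (c *: v1 + v2) = c * pairing w v1 + pairing w v2.
Proof.
rewrite pairing.unlock mulr_sumr -big_split; apply: eq_bigr => k _.
by rewrite mcoeffD mcoeffZ mulrDr !mulrA [w@_k * c]mulrC.
Qed.

Lemma pairing_linearl (v : vecV) : linear (fun w : vecW => pairing w v : C^o).
Proof. by move=> c x y; apply: pairing_linl. Qed.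

Lemma pairing_linearr (w : vecW) : linear (fun v : vecV => pairing w v : C^o).
Proof. by move=> c x y; apply: pairing_linr. Qed.

Lemma pairing_basisl (k : bidx) (v : vecV) : pairing << k >> v = v@_k.
Proof. by rewrite pairing.unlock msuppU oner_eq0 big_seq_fset1 mcoeffUU mul1r. Qed.

Lemma pairing_basisr (k : bidx) (w : vecW) : pairing w << k >> = w@_k.
Proof.
rewrite (@pairingEw (fsetU (msupp w) [fset k]%fset)); last exact: fsubsetUl.
rewrite (big_fsetD1 k) /=; last by rewrite !inE eqxx orbT.
rewrite mcoeffUU mulr1 big1_fset ?addr0 // => l; rewrite !inE => /andP[lk _] _.
by rewrite mcoeffU eq_sym (negbTE lk) mulr0.
Qed.

Let eqNb (a b : bool) : (~~ a == b) = (a == ~~ b).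
Proof. by case: a b => [] []. Qed.

Lemma mcoeff_opP_V (v : vecV) i s :
  (opP_V v)@_(i, s) = (-1) ^+ (~~ s) * v@_(i, ~~ s).
Proof.
rewrite opP_V.unlock raddf_sum /=.
under eq_bigr do rewrite mcoeffU xpair_eqE.
have [h|h] := boolP ((i, ~~ s) \in msupp v).
  rewrite (big_fsetD1 (i, ~~ s)) //= negbK !eqxx mulr1n big1_fset ?addr0 //.
  move=> [j t]; rewrite !inE xpair_eqE => /andP[h1 _] _ /=.
  by rewrite eqNb (negbTE h1).
rewrite (mcoeff_outdom h) mulr0 big1_fset // => -[j t] jt _ /=.
case: eqP => //= ji; case: eqP => //= ts; move: h.
by rewrite -ts -ji negbK jt.
Qed.

Lemma mcoeff_opP_W (w : vecW) i s : (opP_W w)@_(i, s) = w@_(i, ~~ s).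
Proof.
rewrite opP_W.unlock raddf_sum /=.
under eq_bigr do rewrite mcoeffU xpair_eqE.
have [h|h] := boolP ((i, ~~ s) \in msupp w).
  rewrite (big_fsetD1 (i, ~~ s)) //= negbK !eqxx mulr1n big1_fset ?addr0 //.
  move=> [j t]; rewrite !inE xpair_eqE => /andP[h1 _] _ /=.
  by rewrite eqNb (negbTE h1).
rewrite (mcoeff_outdom h) big1_fset // => -[j t] jt _ /=.
case: eqP => //= ji; case: eqP => //= ts; move: h.
by rewrite -ts -ji negbK jt.
Qed.

Let mcoeff_lin (c : C) (x y : {malg C[bidx]}) k :
  (c *: x + y)@_k = c * x@_k + y@_k.
Proof. by rewrite mcoeffD mcoeffZ. Qed.

Lemma opP_V_linear : linear (@opP_V C I).
Proof.
move=> c x y; apply/malgP => -[i s].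
rewrite [RHS]mcoeff_lin !mcoeff_opP_V [in LHS]mcoeff_lin mulrDr !mulrA.
by rewrite [c * _]mulrC.
Qed.

Lemma opP_W_linear : linear (@opP_W C I).
Proof.
move=> c x y; apply/malgP => -[i s].
by rewrite [RHS]mcoeff_lin !mcoeff_opP_W [in LHS]mcoeff_lin.
Qed.

Lemma basis_partP s c x y :
  basis_part s x -> basis_part s y -> basis_part s (c *: x + y).
Proof.
move=> hx hy k; rewrite mcoeffD mcoeffZ.
have [/hx //|/negbNE/eqP x0] := boolP (x@_k != 0).
have [/hy //|/negbNE/eqP y0] := boolP (y@_k != 0).
by rewrite x0 y0 mulr0 addr0 eqxx.
Qed.

Lemma basis_part_basis (k : bidx) : basis_part k.2 << k >>.
Proof. by move=> l; rewrite mcoeffU; have [->|] //= := eqVneq k l; rewrite eqxx. Qed.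

Lemma basis_part_direct v : basis_part false v -> basis_part true v -> v = 0.
Proof.
move=> h0 h1; apply/malgP => k; rewrite mcoeff0.
by have [//|/[dup] /h0 E /h1] := eqVneq (v@_k) 0; rewrite E.
Qed.

Lemma finite_rankP (M : lmodType C) (c : C) (f g : M -> M) :
  finite_rank f -> finite_rank g -> finite_rank (c *: f + g).
Proof.
move=> [m [u hu]] [n [v hv]]; exists (m + n)%N.
exists (fun i => match fintype.split i with inl a => u a | inr b => v b end) => x.
have [a ha] := hu x; have [b hb] := hv x.
exists (fun i => match fintype.split i with inl k => c * a k | inr k => b k end).
rewrite big_split_ord /=; congr (_ + _).
- rewrite -[LHS]/(c *: f x) ha scaler_sumr; apply: eq_bigr => i _.
  by rewrite (unsplitK (inl _ i)) scalerA.
- by rewrite hb; apply: eq_bigr => i _; rewrite (unsplitK (inr _ i)).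
Qed.

Lemma finite_rank_compl (M : lmodType C) (f g : M -> M) :
  finite_rank f -> finite_rank (f \o g).
Proof. by move=> [n [v h]]; exists n, v => x; apply: h. Qed.

Lemma queer_partP s c X Y :
  queer_part s X -> queer_part s Y -> queer_part s (c *: X + Y).
Proof.
move=> [X1 X2 X3 X4 X5 X6 X7 X8 X9] [Y1 Y2 Y3 Y4 Y5 Y6 Y7 Y8 Y9].
split.
- exact: linear_comb X1 Y1.
- exact: linear_comb X2 Y2.
- exact: finite_rankP.
- exact: finite_rankP.
- by move=> t v vt; apply: basis_partP; [apply: X5|apply: Y5].
- by move=> t v vt; apply: basis_partP; [apply: X6|apply: Y6].
- move=> t w v wt; rewrite -[(_ + _).2 w]/(c *: X.2 w + Y.2 w).
  rewrite -[(_ + _).1 v]/(c *: X.1 v + Y.1 v) pairing_linl pairing_linr.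
  by rewrite (X7 t) // (Y7 t) // mulrDr mulrCA.
- exact: intertwine_comb opP_V_linear X8 Y8.
- exact: intertwine_comb opP_W_linear X9 Y9.
Qed.

Lemma queer_part0 s : queer_part s 0.
Proof.
have z : finite_rank (0 : vecV -> vecV).
  exists 0%N, (fun=> 0) => x; exists (fun=> 0); by rewrite big_ord0.
split=> //; try exact: linear_0.
- by move=> t v _ k; rewrite mcoeff0 eqxx.
- by move=> t v _ k; rewrite mcoeff0 eqxx.
- move=> t w v _; rewrite -[(0 : operator).2 w]/0 -[(0 : operator).1 v]/0.
  by rewrite (linear_fun0 (pairing_linearl v) : pairing 0 v = 0) (linear_fun0 (pairing_linearr w) : pairing w 0 = 0) mulr0.
- move=> v; rewrite -[(0 : operator).1 _]/0 -[(0 : operator).1 v]/0.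
  by rewrite (linear_fun0 opP_V_linear) scaler0.
- move=> v; rewrite -[(0 : operator).2 _]/0 -[(0 : operator).2 v]/0.
  by rewrite (linear_fun0 opP_W_linear) scaler0.
Qed.

Let lin_eq0 (f : {malg C[bidx]} -> {malg C[bidx]}) :
  linear f -> (forall k, f << k >> = 0) -> f = 0.
Proof.
move=> fl fb; apply/funext => v; rewrite (monalgE v) -[RHS]/0.
elim: (msupp v : seq bidx) => [|k l IH]; first by rewrite big_nil linear_fun0.
rewrite big_cons linear_funD // IH addr0.
have -> : << v@_k *g k >> = v@_k *: << k >> :> {malg C[bidx]}.
  apply/malgP => j; rewrite [LHS]mcoeffU [RHS]mcoeffZ [in RHS]mcoeffU.
  by case: eqP; rewrite /= ?mulr1 ?mulr0.
by rewrite linear_funZ // fb scaler0.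
Qed.

Lemma queer_part_direct X : queer_part false X -> queer_part true X -> X = 0.
Proof.
move=> [l1 l2 _ _ p1 p2 _ _ _] [_ _ _ _ q1 q2 _ _ _].
rewrite [X]surjective_pairing; congr pair; apply: lin_eq0 => // k.
- have := p1 _ _ (@basis_part_basis k); have := q1 _ _ (@basis_part_basis k).
  by case: k.2 => /= *; apply: basis_part_direct.
- have := p2 _ _ (@basis_part_basis k); have := q2 _ _ (@basis_part_basis k).
  by case: k.2 => /= *; apply: basis_part_direct.
Qed.

Lemma is_queerP X : reflect
  (exists X0 X1, [/\ queer_part false X0, queer_part true X1 & X = X0 + X1])
  (X \in is_queer).
Proof. exact: asboolP. Qed.

Lemma is_queer_submod : submod_closed is_queer.
Proof.
split=> [|c X Y /is_queerP[X0 [X1 [h0 h1 ->]]] /is_queerP[Y0 [Y1 [k0 k1 ->]]]].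
  by apply/is_queerP; exists 0, 0; split; rewrite ?addr0 //; exact: queer_part0.
apply/is_queerP; exists (c *: X0 + Y0), (c *: X1 + Y1).
by split; [exact: queer_partP|exact: queer_partP|exact: scalerD_acomm].
Qed.

HB.instance Definition _ :=
  GRing.isSubmodClosed.Build C operator is_queer is_queer_submod.

Record queer := Queer { queer_op :> operator; queerP : queer_op \in is_queer }.
HB.instance Definition _ := [isSub for queer_op].
HB.instance Definition _ := [Choice of queer by <:].
HB.instance Definition _ := [SubChoice_isSubLmodule of queer by <:].

Lemma queer_grading :
  grading (fun s => [set X : queer | queer_part s (queer_op X)]).
Proof.
split=> /=.
- exact: queer_part0.
- by move=> s c u v; apply: queer_partP.
- case=> X hX; have /is_queerP[X0 [X1 [h0 h1 E]]] := hX.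
  have q0 : X0 \in is_queer.
    by apply/is_queerP; exists X0, 0; split; rewrite ?addr0 //; exact: queer_part0.
  have q1 : X1 \in is_queer.
    by apply/is_queerP; exists 0, X1; split; rewrite ?add0r //; exact: queer_part0.
  by exists (Queer q0), (Queer q1); split=> //; apply: val_inj.
- by move=> v h0 h1; apply: val_inj; apply: queer_part_direct.
Qed.

Definition queer_space : superSpace C := SuperSpace queer_grading.

Definition op_mul (X Y : operator) : operator := (X.1 \o Y.1, X.2 \o Y.2).

(* The supercommutator of operators of parities s and t. *)
Definition super_comm (s t : bool) (X Y : operator) : operator :=
  op_mul X Y - (-1) ^+ (s && t) *: op_mul Y X.

Lemma queer_super_comm s t X Y :
  queer_part s X -> queer_part t Y -> queer_part (s (+) t) (super_comm s t X Y).
Proof.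
move=> [X1 X2 X3 X4 X5 X6 X7 X8 X9] [Y1 Y2 Y3 Y4 Y5 Y6 Y7 Y8 Y9].
have F1 : (super_comm s t X Y).1 = - (-1) ^+ (s && t) *: (Y.1 \o X.1) + (X.1 \o Y.1).
  by rewrite addrC scaleNr.
have F2 : (super_comm s t X Y).2 = - (-1) ^+ (s && t) *: (Y.2 \o X.2) + (X.2 \o Y.2).
  by rewrite addrC scaleNr.
have E1 v : (super_comm s t X Y).1 v =
    - (-1) ^+ (s && t) *: Y.1 (X.1 v) + X.1 (Y.1 v) by rewrite F1.
have E2 v : (super_comm s t X Y).2 v =
    - (-1) ^+ (s && t) *: Y.2 (X.2 v) + X.2 (Y.2 v) by rewrite F2.
have S : (-1) ^+ (s (+) t) = (-1) ^+ s * (-1) ^+ t :> C by rewrite signr_addb.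
have S' : (-1) ^+ s * (-1) ^+ t = (-1) ^+ t * (-1) ^+ s :> C by rewrite mulrC.
split.
- by rewrite F1; apply: linear_comb; apply: linear_comp.
- by rewrite F2; apply: linear_comb; apply: linear_comp.
- by rewrite F1; apply: finite_rankP; apply: finite_rank_compl.
- by rewrite F2; apply: finite_rankP; apply: finite_rank_compl.
- move=> r v vr; rewrite E1; apply: basis_partP.
    by rewrite [s (+) t]addbC -addbA; apply/Y5/X5.
  by rewrite -addbA; apply/X5/Y5.
- move=> r v vr; rewrite E2; apply: basis_partP.
    by rewrite [s (+) t]addbC -addbA; apply/Y6/X6.
  by rewrite -addbA; apply/X6/Y6.
- move=> r w v wr; rewrite E1 E2 pairing_linl pairing_linr.
  rewrite (Y7 _ _ _ (X6 _ _ wr)) (X7 _ _ _ wr) (X7 _ _ _ (Y6 _ _ wr)) (Y7 _ _ _ wr).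
  case: s t r {X5 X6 X7 X8 X9 Y5 Y6 Y7 Y8 Y9 E1 E2 F1 F2 S S' wr} => [] [] [] /=;
    rewrite ?expr1 ?expr0 ?opprK ?mul1r ?mulN1r ?opprK ?opprD ?opprK //;
    by rewrite addrC.
- rewrite F1 S; apply: intertwine_comb; first exact: opP_V_linear.
    by move=> v; rewrite S'; apply: (intertwine_comp Y1 Y8 X8).
  exact: intertwine_comp X1 X8 Y8.
- rewrite F2 S; apply: intertwine_comb; first exact: opP_W_linear.
    by move=> v; rewrite S'; apply: (intertwine_comp Y2 Y9 X9).
  exact: intertwine_comp X2 X9 Y9.
Qed.

Let sum_bool2 (V : zmodType) (F : bool -> bool -> V) s t :
  F (~~ s) t = 0 -> F s (~~ t) = 0 -> F (~~ s) (~~ t) = 0 ->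
  \sum_(a : bool) \sum_(b : bool) F a b = F s t.
Proof.
by rewrite !big_bool /=; case: s t => [] [] /= -> -> ->; rewrite ?addr0 ?add0r.
Qed.

Lemma bracket_subproof (X Y : queer_space) :
  \sum_(s : bool) \sum_(t : bool)
     super_comm s t (val (component s X)) (val (component t Y)) \in is_queer.
Proof.
apply: rpred_sum => s _; apply: rpred_sum => t _; apply/is_queerP.
have := queer_super_comm (component_part s X) (component_part t Y).
have z := queer_part0.
case: (s (+) t) => h; [exists 0|]; eexists; [|exists 0].
  by split; [exact: z|exact: h|rewrite add0r].
by split; [exact: h|exact: z|rewrite addr0].
Qed.

(* Defined on all of g by bilinearity; see bracket_part for the values on
   homogeneous elements. *)
Definition bracket (X Y : queer_space) : queer_space :=
  Queer (bracket_subproof X Y).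

Lemma bracket_part s t (X Y : queer_space) : part s X -> part t Y ->
  val (bracket X Y) = super_comm s t (val X) (val Y).
Proof.
move=> Xs Yt.
have ql (Z : queer_space) : linear (val Z).1 /\ linear (val Z).2.
  have [Z0 [Z1 [[l1 l2 _ _ _ _ _ _ _] [m1 m2 _ _ _ _ _ _ _] E]]] := is_queerP _ (queerP Z).
  have -> : val Z = 1 *: Z0 + Z1 by rewrite scale1r.
  by split; apply: linear_comb.
have sc0 a b (Z : queer_space) :
    super_comm a b 0 (val Z) = 0 /\ super_comm a b (val Z) 0 = 0.
  have E1 : op_mul 0 (val Z) = 0 by [].
  have E2 : op_mul (val Z) 0 = 0.
    by congr pair; apply/funext => v; rewrite /comp /=; apply: linear_fun0;
      case: (ql Z).
  by rewrite /super_comm E1 E2 scaler0 subr0.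
have v0 : val (0 : queer_space) = 0 by [].
have K1 b (Z : queer_space) : super_comm (~~ s) b (val (component (~~ s) X)) (val Z) = 0.
  by rewrite component_opp ?negbK // v0 (sc0 _ _ Z).1.
have K2 a (Z : queer_space) : super_comm a (~~ t) (val Z) (val (component (~~ t) Y)) = 0.
  by rewrite component_opp ?negbK // v0 (sc0 _ _ Z).2.
rewrite -[in RHS](component_id Xs) -[in RHS](component_id Yt).
by apply: sum_bool2; [exact: K1|exact: K2|exact: K1].
Qed.

(* The operator u (x) w for basis vectors u of V and w of W.  On V it is
   v |-> (w, v) u; on W it is determined by the pairing condition. *)
Definition tensor_op (u w : bidx) : operator :=
  (fun x => pairing << w >> x *: << u >>,
   fun y => (- (-1) ^+ (u.2 && (u.2 (+) w.2)) * pairing y << u >>) *: << w >>).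

(* gen_op false i j is e_i (x) f_j plus the product of the odd partners, and
   gen_op true i j is e_i (x) fbar_j + ebar_i (x) f_j. *)
Definition gen_op (r : bool) (i j : I) : operator :=
  tensor_op (i, false) (j, r) + tensor_op (i, true) (j, ~~ r).

Let gen_coef_V r i j (v : vecV) a u :
  ((gen_op r i j).1 v)@_(a, u) = (i == a)%:R * v@_(j, r (+) u).
Proof.
rewrite -[(gen_op r i j).1 v]/(pairing << (j, r) >> v *: << (i, false) >> +
  pairing << (j, ~~ r) >> v *: << (i, true) >>).
rewrite mcoeff_lin mcoeffZ !mcoeffU !xpair_eqE !pairing_basisl.
by case: (i == a); case: u; case: r;
  rewrite /= ?mulr1 ?mulr0 ?mul1r ?mul0r ?add0r ?addr0.
Qed.

Let gen_coef_W r i j (w : vecW) a u :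
  ((gen_op r i j).2 w)@_(a, u) =
  (j == a)%:R * (- (-1) ^+ (r && ~~ u) * w@_(i, u (+) r)).
Proof.
rewrite -[(gen_op r i j).2 w]/((- (-1) ^+ (false && (false (+) r)) *
    pairing w << (i, false) >>) *: << (j, r) >> +
  (- (-1) ^+ (true && (true (+) ~~ r)) *
    pairing w << (i, true) >>) *: << (j, ~~ r) >>).
rewrite mcoeff_lin mcoeffZ !mcoeffU !xpair_eqE !pairing_basisr.
by case: (j == a); case: u; case: r;
  rewrite /= ?mulr1 ?mulr0 ?mul1r ?mul0r ?add0r ?addr0.
Qed.

Lemma tensor_op_linV u w : linear (tensor_op u w).1.
Proof. exact: linear_scaled (pairing_linearr _). Qed.

Lemma tensor_op_linW u w : linear (tensor_op u w).2.
Proof.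
exact: linear_scaled (linear_scaler _ (pairing_linearl << u >>)).
Qed.

Lemma tensor_op_rankV u w : finite_rank (tensor_op u w).1.
Proof.
exists 1%N, (fun=> << u >>) => x; exists (fun=> pairing << w >> x).
by rewrite big_ord1.
Qed.

Lemma tensor_op_rankW u w : finite_rank (tensor_op u w).2.
Proof.
exists 1%N, (fun=> << w >>) => y.
exists (fun=> - (-1) ^+ (u.2 && (u.2 (+) w.2)) * pairing y << u >>).
by rewrite big_ord1.
Qed.

Let scaled_basis_part (c : C) (k : bidx) t :
  (c != 0 -> k.2 = t) -> basis_part t (c *: << k >>).
Proof.
move=> ct l; rewrite mcoeffZ mcoeffU mulf_eq0 negb_or => /andP[/ct <-].
by have [->|] := eqVneq k l; rewrite ?eqxx.
Qed.

Lemma tensor_op_parV u w t v :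
  basis_part t v -> basis_part (u.2 (+) w.2 (+) t) ((tensor_op u w).1 v).
Proof.
move=> vt; apply: scaled_basis_part; rewrite pairing_basisl => /vt <-.
by rewrite addbK.
Qed.

Lemma tensor_op_parW u w t y :
  basis_part t y -> basis_part (u.2 (+) w.2 (+) t) ((tensor_op u w).2 y).
Proof.
move=> yt; apply: scaled_basis_part; rewrite mulf_eq0 negb_or pairing_basisr.
by case/andP=> _ /yt <-; rewrite [u.2 (+) w.2]addbC addbK.
Qed.

Lemma tensor_op_pairing u w t y v : basis_part t y ->
  pairing ((tensor_op u w).2 y) v =
  - (-1) ^+ (t && (u.2 (+) w.2)) * pairing y ((tensor_op u w).1 v).
Proof.
move=> yt; rewrite /tensor_op /=.
rewrite (linear_funZ _ _ (pairing_linearl v) : pairing (_ *: _) v = _ * pairing _ v).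
rewrite (linear_funZ _ _ (pairing_linearr y) : pairing y (_ *: _) = _ * pairing y _).
rewrite !pairing_basisl pairing_basisr.
have [->|/yt ->] := eqVneq (y@_u) 0; first by rewrite !(mulr0, mul0r).
by rewrite -!mulrA; congr (_ * _); rewrite mulrC.
Qed.

Let addb_gen r : true (+) ~~ r = r. Proof. by case: r. Qed.

Lemma gen_subproof_part r i j : queer_part r (gen_op r i j).
Proof.
have E : gen_op r i j = 1 *: tensor_op (i, false) (j, r) +
    tensor_op (i, true) (j, ~~ r) by rewrite scale1r.
split.
- by rewrite E; apply: linear_comb; apply: tensor_op_linV.
- by rewrite E; apply: linear_comb; apply: tensor_op_linW.
- by rewrite E; apply: finite_rankP; apply: tensor_op_rankV.
- by rewrite E; apply: finite_rankP; apply: tensor_op_rankW.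
- move=> t v vt; rewrite E; apply: basis_partP; first exact: tensor_op_parV vt.
  by have := @tensor_op_parV (i, true) (j, ~~ r) _ _ vt; rewrite /= negbK.
- move=> t v vt; rewrite E; apply: basis_partP; first exact: tensor_op_parW vt.
  by have := @tensor_op_parW (i, true) (j, ~~ r) _ _ vt; rewrite /= negbK.
- move=> t w v wt; rewrite E.
  rewrite -[(_ + _).2 w]/(1 *: (tensor_op (i, false) (j, r)).2 w +
    (tensor_op (i, true) (j, ~~ r)).2 w).
  rewrite -[(_ + _).1 v]/(1 *: (tensor_op (i, false) (j, r)).1 v +
    (tensor_op (i, true) (j, ~~ r)).1 v).
  rewrite pairing_linl pairing_linr !mul1r mulrDr.
  rewrite !(tensor_op_pairing _ _ _ wt).
  by rewrite -[(i, true).2 (+) _]/(true (+) ~~ r) addb_gen.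
- move=> v; apply/malgP => -[a u].
  rewrite [LHS]gen_coef_V [RHS]mcoeffZ !mcoeff_opP_V [in RHS]gen_coef_V.
  by case: r E u => _ []; rewrite /= ?expr0 ?expr1 ?mul1r ?mulN1r ?mulrN ?opprK.
- move=> v; apply/malgP => -[a u].
  rewrite [LHS]gen_coef_W [RHS]mcoeffZ !mcoeff_opP_W [in RHS]gen_coef_W.
  rewrite [RHS]mulrCA; congr (_ * _); case: r E u => _ [];
  by rewrite /= ?expr0 ?expr1 ?mul1r ?mulN1r ?mulNr ?mulrN ?mul1r ?opprK.
Qed.

Lemma gen_subproof r i j : gen_op r i j \in is_queer.
Proof.
apply/is_queerP; have := gen_subproof_part r i j; have z := queer_part0.
case: r => h; [exists 0, (gen_op true i j)|exists (gen_op false i j), 0].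
  by split=> //; rewrite add0r.
by split=> //; rewrite addr0.
Qed.

Definition gen (r : bool) (i j : I) : queer_space :=
  Queer (gen_subproof r i j).

End Queer.

Section QueerInfinity.
Variable C : fieldType.

Definition zidx : choiceType := {i : int | i != 0}.

Definition q_infty : superSpace C := queer_space C zidx.

(* The index set I_n of g_n, which is isomorphic to q(n). *)
Definition truncation (n : nat) : set zidx :=
  [set i | - (n./2)%:Z <= val i <= (uphalf n)%:Z].

(* The increasing order is 1, 2, ..., -2, -1. *)
Definition prec (i j : zidx) : bool :=
  if (0 < val i) == (0 < val j) then val i < val j else 0 < val i.

Definition gen_span (S : zidx -> zidx -> Prop) : set q_infty :=
  spanned [set X | exists r i j, S i j /\ X = gen C r i j].

(* c_n *)
Definition q_centralizer (n : nat) : set q_infty :=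
  gen_span (fun i j => ~ truncation n i /\ ~ truncation n j).

Definition q_cartan : set q_infty := gen_span (fun i j => i = j).

Definition q_cartan_even : set q_infty := q_cartan `&` part false.

Definition q_nil : set q_infty := gen_span prec.

(* The enumeration 1, -1, 2, -2, ... of the nonzero integers; its first n values
   are the elements of I_n (truncationP below). *)
Definition zenum_val (k : nat) : int :=
  if odd k then - (k./2.+1)%:Z else (k./2.+1)%:Z.

Lemma zenum_neq0 k : zenum_val k != 0.
Proof. by rewrite /zenum_val; case: (odd k); rewrite ?oppr_eq0. Qed.

Definition zenum (k : nat) : zidx := exist _ (zenum_val k) (zenum_neq0 k).

Lemma truncationP n (i : zidx) :
  truncation n i <-> exists k, (k < n)%N /\ i = zenum k.
Proof.
split=> [|[k [kn ->]]]; last first.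
  by rewrite /truncation /= /zenum_val; case: ifP => ok; lia.
case: i => -[k|k] k0; rewrite /truncation /= => /andP[h1 h2].
  exists (k.-1.*2); split; first by move: h2 k0; rewrite uphalf_half; lia.
  apply: val_inj; rewrite /= /zenum_val odd_double doubleK; congr Posz.
  by case: k k0 {h1 h2}.
exists (k.*2.+1); split; first by move: h1; rewrite NegzE; lia.
by apply: val_inj; rewrite /= /zenum_val /= odd_double /= uphalf_double NegzE.
Qed.

Record qModule := QModule {
  qm_space :> superSpace C;
  act : q_infty -> qm_space -> qm_space;
  act_linearl : forall m, linear (act^~ m);
  act_linearr : forall X, linear (act X);
  act_part : forall s t X m, part s X -> part t m -> part (s (+) t) (act X m);
  act_bracket : forall s t (X Y : q_infty) m, part s X -> part t Y ->
    act (bracket X Y) m =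
    act X (act Y m) - (-1) ^+ (s && t) *: act Y (act X m) }.

Record is_submodule (M : qModule) (N : set M) : Prop := IsSubmodule {
  submodule0 : N 0;
  submoduleP : forall (c : C) u v, N u -> N v -> N (c *: u + v);
  submodule_component : forall s v, N v -> N (component s v);
  submodule_act : forall X v, N v -> N (act X v) }.

Definition finitely_generated (M : qModule) : Prop :=
  exists s : seq M,
    forall N : set M, is_submodule N -> (forall v, v \in s -> N v) -> N = setT.

(* The subquotient N' / N is a simple module. *)
Definition simple_subquotient (M : qModule) (N N' : set M) : Prop :=
  N `<` N' /\
  forall L : set M, is_submodule L -> N `<=` L -> L `<=` N' -> L = N \/ L = N'.

Definition finite_length (M : qModule) : Prop :=
  exists (l : nat) (N : nat -> set M),
    [/\ N 0%N = [set 0], N l = setT,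
        forall i, (i <= l)%N -> is_submodule (N i) &
        forall i, (i < l)%N -> simple_subquotient (N i) (N i.+1)].

Definition invariants (M : qModule) (S : set q_infty) : set M :=
  [set m | forall X, S X -> act X m = 0].

Definition large_annihilator (M : qModule) : Prop :=
  forall m : M, exists n, (0 < n)%N /\ invariants (q_centralizer n) m.

Definition weight_vector (M : qModule) (m : M) : Prop :=
  exists lambda : q_infty -> C,
    forall H, q_cartan_even H -> act H m = lambda H *: m.

Definition cartan_semisimple (M : qModule) : Prop :=
  forall m : M, spanned (@weight_vector M) m.

Definition locally_nilpotent (M : qModule) (S : set q_infty) : Prop :=
  forall X (m : M), S X -> exists k, iter k (act X) m = 0.

End QueerInfinity.

Record scAlgebra (C : fieldType) := ScAlgebra {
  sc_alg :> algType C;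
  sc_part : bool -> set sc_alg;
  sc_grading : grading sc_part;
  sc_one : sc_part false 1;
  sc_mul : forall s t a b, sc_part s a -> sc_part t b -> sc_part (s (+) t) (a * b);
  sc_comm : forall s t a b,
    sc_part s a -> sc_part t b -> a * b = (-1) ^+ (s && t) * (b * a) }.

Definition sc_space (C : fieldType) (A : scAlgebra C) : superSpace C :=
  SuperSpace (sc_grading A).

Section Supergroup.
Variables (C : fieldType) (n : nat).
Implicit Types A B : scAlgebra C.

Definition P_mx A : 'M[A]_(n + n) := block_mx 0 (- 1%:M) 1%:M 0.

(* The A-points of Q(n) are the even automorphisms of the free right A-module
   with basis e_1, ..., e_n, ebar_1, ..., ebar_n that commute with P. *)
Record Q_point A (g : 'M[A]_(n + n)) : Prop := QPoint {
  Q_point_ul : forall i j, sc_part false (ulsubmx g i j);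
  Q_point_ur : forall i j, sc_part true (ursubmx g i j);
  Q_point_dl : forall i j, sc_part true (dlsubmx g i j);
  Q_point_dr : forall i j, sc_part false (drsubmx g i j);
  Q_point_P : g *m P_mx A = P_mx A *m g;
  Q_point_inv : exists h, g *m h = 1%:M /\ h *m g = 1%:M }.

(* The matrix of gen r i j (x) a, where (X (x) a) v = (-1)^(p(a) p(v)) (X v) a. *)
Definition gen_mx A (r : bool) (i j : 'I_n) (a : A) : 'M[A]_(n + n) :=
  let E := a *: delta_mx i j in
  if r then block_mx 0 (- E) E 0 else block_mx E 0 0 E.

(* The right action of a on M (x) A. *)
Definition tensor_mulr (M : lmodType C) A (x : tensor M A) (a : A) : tensor M A :=
  tensor_lift (fun m (b : A) => tens m (b * a)) x.

Definition tensor_map (M : lmodType C) A B (f : A -> B) (x : tensor M A) :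
    tensor M B :=
  tensor_lift (fun m (a : A) => tens m (f a)) x.

(* rho is a representation of Q(n) on M: an action of the group Q(n)(A) by even
   automorphisms of the A-module M (x) A, natural in A. *)
Record Q_representation (M : superSpace C)
    (rho : forall A, 'M[A]_(n + n) -> tensor M A -> tensor M A) : Prop :=
  QRepresentation {
    Q_rep_add : forall A g, Q_point g -> {morph rho A g : x y / x + y};
    Q_rep_mulr : forall A g x a, Q_point g ->
      rho A g (tensor_mulr x a) = tensor_mulr (rho A g x) a;
    Q_rep_even : forall A g s x, Q_point g ->
      tensor_part (N := sc_space A) s x ->
      tensor_part (N := sc_space A) s (rho A g x);
    Q_rep_1 : forall A x, rho A 1%:M x = x;
    Q_rep_mul : forall A g h x, Q_point g -> Q_point h ->
      rho A (g *m h) x = rho A g (rho A h x);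
    Q_rep_natural : forall A B (f : {lrmorphism A -> B}) g x,
      (forall s a, sc_part s a -> sc_part s (f a)) -> Q_point g ->
      tensor_map f (rho A g x) = rho B (map_mx f g) (tensor_map f x) }.

(* The differential of rho at 1 is the action of g_n on M.  It is enough to say
   so for the generators X of g_n: for a of the parity of X with a^2 = 0, the
   point 1 + X (x) a comes from the dual numbers C[a] and acts as 1 + X (x) a on
   M (x) A, where (X (x) a) (m (x) 1) = (-1)^(p(a) p(m)) X m (x) a. *)
Definition Q_lifts (M : qModule C)
    (rho : forall A, 'M[A]_(n + n) -> tensor M A -> tensor M A) : Prop :=
  forall A r (i j : 'I_n) (a : A) t (m : M),
    sc_part r a -> a * a = 0 -> part t m ->
    rho A (1%:M + gen_mx r i j a) (tens m 1) =
    tens m 1 + (-1) ^+ (r && t) *: tens (act (gen C r (zenum i) (zenum j)) m) a.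

End Supergroup.

Definition integrable (C : fieldType) (M : qModule C) : Prop :=
  forall n, (0 < n)%N -> exists rho : forall A : scAlgebra C,
    'M[A]_(n + n) -> tensor M A -> tensor M A,
    Q_representation rho /\ Q_lifts rho.

Definition Trep (C : fieldType) (M : qModule C) : Prop :=
  [/\ integrable M, finite_length M & large_annihilator M].

Definition cat_O (C : fieldType) (M : qModule C) : Prop :=
  [/\ finitely_generated M, cartan_semisimple M & locally_nilpotent M (@q_nil C)].

Definition cat_O' (C : fieldType) (M : qModule C) : Prop :=
  cat_O M /\ large_annihilator M.

Definition cat_O'_int (C : fieldType) (M : qModule C) : Prop :=
  cat_O' M /\ integrable M.

(* Main.v *)
Require Import Defs.
From HB Require Import structures.
From mathcomp Require Import all_boot all_order all_algebra.
From mathcomp Require Import finmap monalg.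
From mathcomp Require Import boolp classical_sets functions.
From mathcomp Require Import zify ring.
From mathcomp Require Import reals complex.

(** The category Trep g consists of the integrable modules of finite length with large
    annihilators, and O'_int of the integrable modules of O with large annihilators.
    Two conditions are thus to be compared: finite length, and finite generation
    together with semisimplicity under the even Cartan subalgebra and local nilpotency
    under the nilradical of the Borel subalgebra.

    Integrability is exploited through one-parameter subgroups only.  The point of
    Q(n) over the Laurent polynomials given by a torus, or by a root subgroup, turns a
    vector m into a Laurent polynomial with coefficients in M, and evaluation in dual
    numbers yields a differential equation for it ([one_parameter_curve]).  For the
    torus of e_i its coefficients are eigenvectors with sum m
    ([integrable_eigenvectors]), and for a root subgroup the equation shows that the
    even root vector is nilpotent on m ([integrable_nilpotent]).

    From Trep to O: a module of finite length is finitely generated.  Since m is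
    killed by some c_n, only the finitely many torus elements of g_n have to be
    diagonalized ([integrable_semisimple]).  An element of the nilradical involves
    finitely many root vectors, each of them acts nilpotently, and brackets add heights; sorting
    words shows that all words of large height kill a given vector ([words_vanish]),
    which gives [integrable_locally_nilpotent].

    From O to Trep: choose generators m that are homogeneous weight vectors killed by
    c_n.  Words in the generators of g commute up to sign modulo shorter words.  The
    letters fall into finitely many types, according to their parity and their indices
    in g_n, an index outside g_n being left unspecified.  For each type, products of
    many letters of this type applied to m are combinations of shorter words
    ([type_bound]); when an index outside g_n varies, this follows by polarization
    ([polarize]), that is by applying elements of c_n to the power of a single
    root vector.  Hence words of bounded length span M.  As m is killed by c_n, the
    words of a given shape are the image of a space of mixed tensors over the even part
    of c_n, a copy of gl(oo), so M is a sum of finitely many such images.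

    It remains to bound the lengths of chains of gl(oo)-stable spaces of mixed tensors
    ([mixed_tensors_bounded]).  Contractions reduce this to traceless tensors.  A
    traceless tensor v with p covariant indices below r satisfies
    sum_(a < r) E_ab E_ba v = p v for every index b >= r that does not occur in v, so it
    can be recovered from tensors in which all indices have been moved to a window
    of values whose size is the number of slots ([window_determines]).  A stable
    space of traceless tensors is therefore determined by a part of bounded dimension.
    The bound passes to M ([bounded_sum_images]), and a strict chain of submodules of
    maximal length is a composition series ([bounded_finite_length]). *)

Set Implicit Arguments.
Unset Strict Implicit.
Unset Printing Implicit Defensive.

Import GRing.Theory Num.Theory.
Local Open Scope classical_set_scope.
Local Open Scope ring_scope.

(** * Subspaces and the Lie superalgebra *)

Section Subspaces.
Variables (C : fieldType) (M : lmodType C).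
Implicit Types (N S : set M) (u v : M) (c : C).

Definition subspace N : Prop :=
  N 0 /\ forall c u v, N u -> N v -> N (c *: u + v).

Lemma subspaceD N u v : subspace N -> N u -> N v -> N (u + v).
Proof. by move=> [_ h] Nu Nv; rewrite -[u]scale1r; apply: h. Qed.

Lemma subspaceZ N c u : subspace N -> N u -> N (c *: u).
Proof. by move=> [h0 h] Nu; rewrite -[_ *: _]addr0; apply: h. Qed.

Lemma subspaceN N u : subspace N -> N u -> N (- u).
Proof. by move=> h Nu; rewrite -scaleN1r; apply: subspaceZ. Qed.

Lemma subspaceB N u v : subspace N -> N u -> N v -> N (u - v).
Proof. by move=> h Nu Nv; apply: subspaceD => //; apply: subspaceN. Qed.

Lemma subspace_sum N (J : Type) (r : seq J) (P : pred J) (F : J -> M) :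
  subspace N -> (forall j, P j -> N (F j)) -> N (\sum_(j <- r | P j) F j).
Proof.
move=> h hF; elim/big_ind: _ => //; first by case: h.
by move=> x y; apply: subspaceD.
Qed.

Lemma subspace_sum_seq N (J : eqType) (r : seq J) (F : J -> M) :
  subspace N -> (forall j, j \in r -> N (F j)) -> N (\sum_(j <- r) F j).
Proof. by move=> h hF; rewrite big_seq; apply: subspace_sum. Qed.

Lemma subspaceI N N' : subspace N -> subspace N' -> subspace (N `&` N').
Proof.
move=> [a b] [a' b']; split=> // c u v [? ?] [? ?].
by split; [apply: b|apply: b'].
Qed.

Lemma spanned_sub S N : subspace N -> S `<=` N -> spanned S `<=` N.
Proof.
move=> hN SN x [n [c [v [Sv ->]]]]; apply: subspace_sum => // i _.
by apply: subspaceZ => //; apply: SN.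
Qed.

Lemma sub_spanned S : S `<=` spanned S.
Proof.
move=> x Sx; exists 1%N, (fun=> 1), (fun=> x); split=> //.
by rewrite big_ord1 scale1r.
Qed.

Lemma spanned_subspace S : subspace (spanned S).
Proof.
split=> [|c x y [m [a [u [Su ->]]]] [n [b [v [Sv ->]]]]].
  by exists 0%N, (fun=> 0), (fun=> 0); rewrite big_ord0; split=> // -[].
exists (m + n)%N.
exists (fun i => match fintype.split i with inl k => c * a k | inr k => b k end).
exists (fun i => match fintype.split i with inl k => u k | inr k => v k end).
split=> [i|]; first by case: fintype.split.
rewrite big_split_ord /= scaler_sumr; congr (_ + _); apply: eq_bigr => i _.
  by rewrite (unsplitK (inl _ i)) scalerA.
by rewrite (unsplitK (inr _ i)).
Qed.

Lemma spannedW S S' : S `<=` spanned S' -> spanned S `<=` spanned S'.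
Proof. by move=> h; apply: spanned_sub => //; apply: spanned_subspace. Qed.

End Subspaces.

Lemma part_subspace (C : fieldType) (M : superSpace C) s : subspace (@part C M s).
Proof. exact: conj (grading0 (partP M) s) (@gradingP _ _ _ (partP M) s). Qed.

Lemma linear_fun_sum (C : fieldType) (U V : lmodType C) (f : U -> V) J (r : seq J)
  (P : pred J) (F : J -> U) : linear f ->
  f (\sum_(j <- r | P j) F j) = \sum_(j <- r | P j) f (F j).
Proof.
move=> fl; elim/big_rec2: _ => [|j x y _ <-]; first exact: linear_fun0.
exact: linear_funD.
Qed.

Lemma linear_funN (C : fieldType) (U V : lmodType C) (f : U -> V) x :
  linear f -> f (- x) = - f x.
Proof. by move=> fl; rewrite -scaleN1r linear_funZ // scaleN1r. Qed.

Lemma linear_funB (C : fieldType) (U V : lmodType C) (f : U -> V) x y :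
  linear f -> f (x - y) = f x - f y.
Proof. by move=> fl; rewrite linear_funD // linear_funN. Qed.

Lemma preimage_subspace (C : fieldType) (U V : lmodType C) (f : U -> V) (N : set V) :
  linear f -> subspace N -> subspace [set x | N (f x)].
Proof.
move=> fl [h0 h]; split=> /=; first by rewrite linear_fun0.
by move=> c u v /= Nu Nv; rewrite fl; apply: h.
Qed.

Section FreeExtension.
Variables (C : fieldType) (K : choiceType).
Local Notation T := {malg C[K]}.

Lemma mcoeff_lin (c : C) (x y : T) k : (c *: x + y)@_k = c * x@_k + y@_k.
Proof. by rewrite mcoeffD mcoeffZ. Qed.

Lemma malg_basis (v : T) : v = \sum_(k <- msupp v) v@_k *: << k >>.
Proof.
rewrite [LHS]monalgE; apply: eq_bigr => k _; apply/malgP => j.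
by rewrite [LHS]mcoeffU [RHS]mcoeffZ [in RHS]mcoeffU mulr_natr.
Qed.

(** The basis elements are linearly independent and span, so a linear map is
    determined by its values on them. *)
Lemma malg_linear_ext (U : lmodType C) (f g : T -> U) : linear f -> linear g ->
  (forall k, f << k >> = g << k >>) -> f = g.
Proof.
move=> fl gl fg; apply/funext => v; rewrite (malg_basis v) !linear_fun_sum //.
by apply: eq_bigr => k _; rewrite !linear_funZ // fg.
Qed.

End FreeExtension.

Section QueerGenerators.
Variables (C : fieldType) (I : choiceType).
Local Notation vec := {malg C[(I * bool)%type]}.
Local Notation gen := (@gen C I).

Lemma gen_coef_V r i j (v : vec) a u :
  ((gen_op C r i j).1 v)@_(a, u) = (i == a)%:R * v@_(j, r (+) u).
Proof.
rewrite -[(gen_op C r i j).1 v]/(pairing << (j, r) >> v *: << (i, false) >> +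
  pairing << (j, ~~ r) >> v *: << (i, true) >>).
rewrite mcoeffD !mcoeffZ !mcoeffU !xpair_eqE !pairing_basisl.
by case: (i == a); case: u; case: r;
  rewrite /= ?mulr1 ?mulr0 ?mul1r ?mul0r ?add0r ?addr0.
Qed.

Lemma gen_coef_W r i j (w : vec) a u :
  ((gen_op C r i j).2 w)@_(a, u) =
  (j == a)%:R * (- (-1) ^+ (r && ~~ u) * w@_(i, u (+) r)).
Proof.
rewrite -[(gen_op C r i j).2 w]/((- (-1) ^+ (false && (false (+) r)) *
    pairing w << (i, false) >>) *: << (j, r) >> +
  (- (-1) ^+ (true && (true (+) ~~ r)) *
    pairing w << (i, true) >>) *: << (j, ~~ r) >>).
rewrite mcoeffD !mcoeffZ !mcoeffU !xpair_eqE !pairing_basisr.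
by case: (j == a); case: u; case: r;
  rewrite /= ?mulr1 ?mulr0 ?mul1r ?mul0r ?add0r ?addr0.
Qed.

Lemma gen_part r i j : part r (gen r i j).
Proof. exact: gen_subproof_part. Qed.

Lemma operator_eq (X Y : operator C I) :
  (forall v k, (X.1 v)@_k = (Y.1 v)@_k) -> (forall v k, (X.2 v)@_k = (Y.2 v)@_k) ->
  X = Y.
Proof.
move=> h1 h2; rewrite [X]surjective_pairing [Y]surjective_pairing.
by congr pair; apply/funext => v; apply/malgP.
Qed.

Lemma gen_mul_V r i j s k l (v : vec) a u :
  ((gen_op C r i j).1 ((gen_op C s k l).1 v))@_(a, u) =
  (i == a)%:R * ((k == j)%:R * v@_(l, s (+) (r (+) u))).
Proof.
by apply: etrans (gen_coef_V _ _ _ _ _ _) _; congr (_ * _); exact: gen_coef_V.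
Qed.

Lemma gen_mul_W r i j s k l (v : vec) a u :
  ((gen_op C r i j).2 ((gen_op C s k l).2 v))@_(a, u) =
  (j == a)%:R * (- (-1) ^+ (r && ~~ u) * ((l == i)%:R *
    (- (-1) ^+ (s && ~~ (u (+) r)) * v@_(k, u (+) r (+) s)))).
Proof.
by apply: etrans (gen_coef_W _ _ _ _ _ _) _; do 2! congr (_ * _); exact: gen_coef_W.
Qed.

Lemma bracket_gen r i j s k l :
  bracket (gen r i j) (gen s k l) =
  (j == k)%:R *: gen (r (+) s) i l -
  ((-1) ^+ (r && s) * (i == l)%:R) *: gen (r (+) s) k j.
Proof.
apply: val_inj; rewrite (bracket_part (gen_part r i j) (gen_part s k l)).
apply: operator_eq => v [a u].
- transitivity (((gen_op C r i j).1 ((gen_op C s k l).1 v))@_(a, u) -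
    (-1) ^+ (r && s) * ((gen_op C s k l).1 ((gen_op C r i j).1 v))@_(a, u)).
    by rewrite -mcoeffZ -mcoeffB.
  transitivity ((j == k)%:R * ((gen_op C (r (+) s) i l).1 v)@_(a, u) -
    ((-1) ^+ (r && s) * (i == l)%:R) * ((gen_op C (r (+) s) k j).1 v)@_(a, u)); last first.
    by rewrite -!mcoeffZ -mcoeffB.
  apply: etrans (congr2 (fun x y => x - (-1) ^+ (r && s) * y)
    (gen_mul_V r i j s k l v a u) (gen_mul_V s k l r i j v a u)) _.
  apply/esym; apply: etrans (congr2 (fun x y => (j == k)%:R * x -
    ((-1) ^+ (r && s) * (i == l)%:R) * y)
    (gen_coef_V (r (+) s) i l v a u) (gen_coef_V (r (+) s) k j v a u)) _.
  apply/esym; rewrite [k == j]eq_sym.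
  have -> : r (+) (s (+) u) = r (+) s (+) u by rewrite addbA.
  have -> : s (+) (r (+) u) = r (+) s (+) u by rewrite addbA [s (+) r]addbC.
  move: (v@_(l, _)) (v@_(j, _)) (i == a) (j == k) (k == a) (i == l) => x y b1 b2 b3 b4.
  by case: b1 b2 b3 b4 => [] [] [] [] /=; rewrite ?(mul0r, mul1r, mulr0, mulr1, subr0).
- transitivity (((gen_op C r i j).2 ((gen_op C s k l).2 v))@_(a, u) -
    (-1) ^+ (r && s) * ((gen_op C s k l).2 ((gen_op C r i j).2 v))@_(a, u)).
    by rewrite -mcoeffZ -mcoeffB.
  transitivity ((j == k)%:R * ((gen_op C (r (+) s) i l).2 v)@_(a, u) -
    ((-1) ^+ (r && s) * (i == l)%:R) * ((gen_op C (r (+) s) k j).2 v)@_(a, u)); last first.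
    by rewrite -!mcoeffZ -mcoeffB.
  apply: etrans (congr2 (fun x y => x - (-1) ^+ (r && s) * y)
    (gen_mul_W r i j s k l v a u) (gen_mul_W s k l r i j v a u)) _.
  apply/esym; apply: etrans (congr2 (fun x y => (j == k)%:R * x -
    ((-1) ^+ (r && s) * (i == l)%:R) * y)
    (gen_coef_W (r (+) s) i l v a u) (gen_coef_W (r (+) s) k j v a u)) _.
  apply/esym; rewrite [l == i]eq_sym.
  have -> : u (+) r (+) s = u (+) (r (+) s) by rewrite addbA.
  have -> : u (+) s (+) r = u (+) (r (+) s) by rewrite -addbA [s (+) r]addbC.
  move: (v@_(k, _)) (v@_(i, _)) (j == a)%:R (j == k)%:R (l == a)%:R (i == l)%:R.
  by move=> x y b1 b2 b3 b4; case: r s u => [] [] [] /=; rewrite ?expr1 ?expr0; ring.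
Qed.

Lemma pairing_eq (v v' : vec) :
  (forall k, pairing v << k >> = pairing v' << k >>) -> v = v'.
Proof. by move=> h; apply/malgP => k; rewrite -!pairing_basisr h. Qed.

Lemma queer_part_ext s (X Y : operator C I) :
  queer_part s X -> queer_part s Y -> X.1 = Y.1 -> X = Y.
Proof.
move=> [_ l2 _ _ _ _ p _ _] [_ l2' _ _ _ _ p' _ _] E.
rewrite [X]surjective_pairing [Y]surjective_pairing E; congr pair.
apply: malg_linear_ext => // k; apply: pairing_eq => k'.
by rewrite (p _ _ _ (@basis_part_basis _ _ k)) (p' _ _ _ (@basis_part_basis _ _ k)) E.
Qed.

Lemma finite_rank_support (f : vec -> vec) : finite_rank f ->
  exists l : seq I, forall v k, (f v)@_k != 0 -> k.1 \in l.
Proof.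
move=> [n [u fu]].
exists (flatten [seq [seq k.1 | k <- msupp (u i)] | i <- enum 'I_n]) => v k.
have [c ->] := fu v; rewrite raddf_sum /= => h.
have [i hi] : exists i, (u i)@_k != 0.
  apply: contrapT => h'; case/negP: h; apply/eqP; apply: big1 => i _.
  rewrite mcoeffZ; have [->|/negP hi] := eqVneq (u i)@_k 0; first by rewrite mulr0.
  by case: h'; exists i; apply/negP.
apply/flattenP; exists [seq k.1 | k <- msupp (u i)]; first by apply/mapP; exists i; rewrite ?mem_enum.
by apply/mapP; exists k => //; rewrite -mcoeff_neq0.
Qed.


Lemma queer_op_sum1 (J : Type) (l : seq J) (F : J -> queer_space C I) v :
  (queer_op (\sum_(x <- l) F x)).1 v = \sum_(x <- l) (queer_op (F x)).1 v.
Proof. by elim/big_rec2: _ => // x y z _ <-. Qed.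

Lemma sum_delta (l : seq I) (x : I -> C) b : uniq l ->
  \sum_(a <- l) x a * (a == b)%:R = if b \in l then x b else 0.
Proof.
move=> ul; case: ifP => bl.
  rewrite (bigD1_seq b) //= eqxx mulr1 big1 ?addr0 // => a /negPf ->.
  by rewrite mulr0.
rewrite big_seq big1 // => a al; case: eqP => [E|]; last by rewrite mulr0.
by rewrite -E al in bl.
Qed.

(** An operator of finite rank on both V and W has finitely many nonzero rows and
    columns, and commuting with P leaves one free entry for each pair of indices. *)
Lemma queer_part_spanned s (X : queer_space C I) : part s X ->
  spanned [set Y | exists r i j, Y = gen r i j] X.
Proof.
move=> hX; have [l1 l2 f1 f2 p1 p2 pp c1 c2] : queer_part s X by exact: hX.
have [R hR] := finite_rank_support f1; have [L hL] := finite_rank_support f2.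
pose x a j := ((queer_op X).1 << (j, false) >>)@_(a, s).
pose Y : queer_space C I :=
  \sum_(a <- undup R) \sum_(j <- undup L) x a j *: gen s a j.
suff -> : X = Y.
  have ss := spanned_subspace [set Y | exists r i j, Y = gen r i j].
  apply: subspace_sum => // a _; apply: subspace_sum => // j _.
  by apply: subspaceZ => //; apply: sub_spanned; exists s, a, j.
have hY : queer_part s (queer_op Y).
  rewrite -[queer_part _ _]/(part s Y) /Y.
  elim/big_ind: _ => [|u v|a _]; [exact: part0|exact: partD|].
  elim/big_ind: _ => [|u v|j _]; [exact: part0|exact: partD|].
  by apply: partZ; exact: gen_part.
have [m1 _ _ _ q1 _ _ d1 _] := hY.
apply: val_inj; apply: (queer_part_ext hX hY).
have YE v b u : ((queer_op Y).1 v)@_(b, u) =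
    \sum_(a <- undup R) \sum_(j <- undup L) x a j * ((a == b)%:R * v@_(j, s (+) u)).
  rewrite /Y queer_op_sum1 raddf_sum /=; apply: eq_bigr => a _.
  rewrite queer_op_sum1 raddf_sum /=; apply: eq_bigr => j _.
  transitivity ((x a j *: (gen_op C s a j).1 v)@_(b, u)); first by [].
  by rewrite mcoeffZ; congr (_ * _); exact: gen_coef_V.
have base j : (queer_op X).1 << (j, false) >> = (queer_op Y).1 << (j, false) >>.
  apply/malgP => -[b u].
  have [->|us] := eqVneq u s; last first.
    have z (Z : operator C I) : queer_part s Z -> (Z.1 << (j, false) >>)@_(b, u) = 0.
      case=> _ _ _ _ q _ _ _ _; apply/eqP; apply: contraTT us => h.
      have := q _ _ (@basis_part_basis _ _ (j, false)) _ h.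
      by rewrite /= addbF => ->; rewrite eqxx.
    by rewrite (z _ hX) (z _ hY).
  rewrite YE addbb.
  under eq_bigr do under eq_bigr do rewrite mcoeffU xpair_eqE eqxx andbT mulrCA.
  under eq_bigr do rewrite -mulr_sumr mulrC.
  rewrite sum_delta ?undup_uniq // mem_undup.
  under eq_bigr do rewrite eq_sym.
  rewrite sum_delta ?undup_uniq // mem_undup.
  have [jL|jL] := boolP (j \in L); last first.
    rewrite if_same -pairing_basisl.
    have h := pp _ _ << (j, false) >> (@basis_part_basis _ _ (b, s)).
    have z : pairing ((queer_op X).2 << (b, s) >>) << (j, false) >> = 0.
      rewrite pairing_basisr; apply/eqP; apply: contraNT jL => /hL; exact.
    move: h; rewrite z => /esym/eqP; rewrite mulf_eq0 oppr_eq0 signr_eq0 /=.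
    by move/eqP.
  case: ifP => // /negP bR; apply/eqP; apply: contraT => /hR /= h; case: (bR h).
have PV j : opP_V << (j, false) >> = << (j, true) >> :> vec.
  apply/malgP => -[a u]; rewrite mcoeff_opP_V !mcoeffU !xpair_eqE.
  by case: u; rewrite /= ?expr0 ?mul1r ?andbF ?mulr0.
apply: malg_linear_ext => // -[j []]; last exact: base.
by rewrite -PV c1 d1 base.
Qed.

Lemma queer_spanned (X : queer_space C I) :
  spanned [set Y | exists r i j, Y = gen r i j] X.
Proof.
rewrite (component_sum X); apply: subspaceD; first exact: spanned_subspace.
  exact: queer_part_spanned (component_part _ _).
exact: queer_part_spanned (component_part _ _).
Qed.

End QueerGenerators.

Section GeneratorAction.
Variables (C : fieldType) (M : qModule C).
Implicit Types (m v : M) (i j k l : zidx) (r s t : bool).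

(** All the later arguments are about words in these operators. *)
Definition E r i j m : M := act (gen C r i j) m.

Lemma E_linear r i j : linear (E r i j).
Proof. exact: act_linearr. Qed.

Lemma E_part r i j t m : part t m -> part (r (+) t) (E r i j m).
Proof. by apply: act_part; apply: gen_part. Qed.

Lemma E_comm r i j s k l m :
  E r i j (E s k l m) = (-1) ^+ (r && s) *: E s k l (E r i j m) +
   ((j == k)%:R *: E (r (+) s) i l m -
    ((-1) ^+ (r && s) * (i == l)%:R) *: E (r (+) s) k j m).
Proof.
have h := act_bracket m (gen_part C r i j) (gen_part C s k l).
have al (c d : C) (X Y : q_infty C) : act (c *: X - d *: Y) m = c *: act X m - d *: act Y m.
  have L := act_linearl (q := M) m.
  by rewrite (linear_funB _ _ L) !(linear_funZ _ _ L).
rewrite bracket_gen al in h; rewrite /E h addrCA subrr.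
by rewrite addr0.
Qed.

Lemma act_stable (N : set M) : subspace N ->
  (forall r i j v, N v -> N (E r i j v)) -> forall X v, N v -> N (act X v).
Proof.
move=> hN h X v Nv; have := queer_spanned X.
have L := act_linearl (q := M) v.
have ss := preimage_subspace L hN.
by move/(spanned_sub ss); apply => Y [r [i [j ->]]] /=; exact: h.
Qed.

End GeneratorAction.

(** * Dual numbers and Laurent polynomial functions *)

(** A pair (a, b) stands for a + b eps with eps ^ 2 = 0. *)
Definition dual (C : fieldType) : Type := (C * C)%type.

Section Dual.
Variable C : fieldType.
Local Notation D := (dual C).
HB.instance Definition _ := GRing.Lmodule.copy D (C^o * C^o)%type.

Definition dual_one : D := (1, 0).
Definition dual_mul (x y : D) : D := (x.1 * y.1, x.1 * y.2 + x.2 * y.1).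

Lemma dual_mulA : associative dual_mul.
Proof. by move=> [a b] [c d] [e f]; congr pair => /=; ring. Qed.
Lemma dual_mulC : commutative dual_mul.
Proof. by move=> [a b] [c d]; congr pair => /=; ring. Qed.
Lemma dual_mul1 : left_id dual_one dual_mul.
Proof. by move=> [a b]; congr pair => /=; ring. Qed.
Lemma dual_mulDl : left_distributive dual_mul +%R.
Proof. by move=> [a b] [c d] [e f]; congr pair => /=; ring. Qed.
Lemma dual_one_neq0 : dual_one != 0.
Proof. by rewrite xpair_eqE oner_eq0. Qed.
HB.instance Definition _ := GRing.Zmodule_isComNzRing.Build D
  dual_mulA dual_mulC dual_mul1 dual_mulDl dual_one_neq0.
Lemma dual_scalerAl (c : C) (x y : D) : c *: (x * y) = (c *: x) * y.
Proof.
by case: x y => a b [d e]; congr pair; rewrite /= /GRing.scale /=; ring.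
Qed.
HB.instance Definition _ := GRing.Lmodule_isLalgebra.Build C D dual_scalerAl.
HB.instance Definition _ := GRing.Lalgebra_isComAlgebra.Build C D.

End Dual.

Definition dual_fun (C : fieldType) : Type := C -> dual C.

Section DualFun.
Variable C : fieldType.
Local Notation F := (dual_fun C).
HB.instance Definition _ := GRing.Lmodule.copy F (C -> dual C).

Definition dual_fun_mul (f g : F) : F := fun c => f c * g c.
Lemma dual_fun_mulA : associative dual_fun_mul.
Proof. by move=> f g h; apply/funext => c; apply: mulrA. Qed.
Lemma dual_fun_mulC : commutative dual_fun_mul.
Proof. by move=> f g; apply/funext => c; apply: mulrC. Qed.
Lemma dual_fun_mul1 : left_id (fun=> 1) dual_fun_mul.
Proof. by move=> f; apply/funext => c; apply: mul1r. Qed.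
Lemma dual_fun_mulDl : left_distributive dual_fun_mul +%R.
Proof. by move=> f g h; apply/funext => c; apply: mulrDl. Qed.
Lemma dual_fun_one_neq0 : (fun=> 1) != 0 :> F.
Proof. by apply/eqP => /(congr1 (fun f : F => f 0)) /eqP; rewrite oner_eq0. Qed.
HB.instance Definition _ := GRing.Zmodule_isComNzRing.Build F
  dual_fun_mulA dual_fun_mulC dual_fun_mul1 dual_fun_mulDl dual_fun_one_neq0.
Lemma dual_fun_scalerAl (c : C) (f g : F) : c *: (f * g) = (c *: f) * g.
Proof. by apply/funext => x; apply: scalerAl. Qed.
HB.instance Definition _ := GRing.Lmodule_isLalgebra.Build C F dual_fun_scalerAl.
HB.instance Definition _ := GRing.Lalgebra_isComAlgebra.Build C F.

(** The first component is a Laurent polynomial function f = c ^- k p(c) and the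
    second one is c f'(c), so that F c is the value of f at c (1 + eps).  The
    value at 0 is arbitrary. *)
Definition laurent_at (p : {poly C}) (k : nat) (f : F) : Prop :=
  forall c, c != 0 -> c ^+ k * (f c).1 = p.[c] /\
    c ^+ k * (f c).2 = c * p^`().[c] - k%:R * p.[c].

Lemma laurent_at_shift p k j f :
  laurent_at p k f -> laurent_at ('X^j * p) (j + k) f.
Proof.
move=> h c c0; have [h1 h2] := h c c0; split.
  by rewrite exprD -mulrA h1 hornerM hornerXn.
rewrite exprD -mulrA h2 derivM derivXn !hornerE hornerMn !hornerXn natrD.
case: j => [|j] /=; first by rewrite mulr0n !expr0; ring.
by rewrite -mulr_natr exprS /=; ring.
Qed.

Definition laurent_pred : {pred F} :=
  [pred f | `[< exists p k, laurent_at p k f >]].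

Lemma laurent_closed : GRing.subalg_closed laurent_pred.
Proof.
split.
- apply/asboolP; exists 1, 0%N => c _.
  split; first by rewrite -[LHS]/(1 * 1) mulr1 hornerC.
  by rewrite -[LHS]/(1 * 0) mulr0 derivC horner0 mulr0 mul0r subr0.
- move=> a f g /asboolP[p [k hp]] /asboolP[q [l hq]].
  apply/asboolP; exists (a *: ('X^l * p) + 'X^k * q), (l + k)%N => c c0.
  have [p1 p2] := laurent_at_shift l hp c0.
  have [q1 q2] := laurent_at_shift k hq c0; rewrite [(k + l)%N]addnC in q1 q2.
  rewrite derivD derivZ !hornerD !hornerZ -p1 -q1.
  rewrite -[((a *: f + g) c).1]/(a * (f c).1 + (g c).1).
  rewrite -[((a *: f + g) c).2]/(a * (f c).2 + (g c).2).
  split; first by ring.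
  by rewrite mulrDr mulrCA p2 q2 p1 q1; ring.
- move=> f g /asboolP[p [k hp]] /asboolP[q [l hq]].
  apply/asboolP; exists (p * q), (k + l)%N => c c0.
  have [p1 p2] := hp c c0; have [q1 q2] := hq c c0.
  split.
    rewrite -[LHS]/(c ^+ (k + l) * ((f c).1 * (g c).1)) hornerM -p1 -q1 exprD.
    by ring.
  rewrite -[LHS]/(c ^+ (k + l) * ((f c).1 * (g c).2 + (f c).2 * (g c).1)).
  transitivity ((c ^+ k * (f c).1) * (c ^+ l * (g c).2) +
    (c ^+ k * (f c).2) * (c ^+ l * (g c).1)); first by rewrite exprD; ring.
  by rewrite p1 p2 q1 q2 derivM hornerD !hornerM natrD; ring.
Qed.
HB.instance Definition _ := GRing.isSubalgClosed.Build C F laurent_pred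
  (GRing.subalg_closed_semi laurent_closed).

End DualFun.

Record laurent (C : fieldType) := Laurent {
  laurent_val :> dual_fun C; laurentP : laurent_val \in @laurent_pred C }.

Section LaurentAlgebra.
Variable C : fieldType.
HB.instance Definition _ := [isSub for @laurent_val C].
HB.instance Definition _ := [Choice of laurent C by <:].
HB.instance Definition _ := [SubChoice_isSubComNzRing of laurent C by <:].
HB.instance Definition _ := [SubZmodule_isSubLmodule of laurent C by <:].
HB.instance Definition _ := [SubNzRing_SubLmodule_isSubLalgebra of laurent C by <:].
HB.instance Definition _ := [SubLalgebra_isSubAlgebra of laurent C by <:].
End LaurentAlgebra.

(** * Integrability: one-parameter subgroups *)

Section EvenAlgebra.
Variables (C : fieldType) (A : comAlgType C).

(** The odd part is zero and the even part is everything: A is regarded as a purely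
    even supercommutative algebra. *)
Definition even_part (s : bool) : set A := [set a | s -> a = 0].

Lemma even_grading : grading even_part.
Proof.
split=> [//|s c u v hu hv h|v|v _ h]; last exact: h.
  by rewrite hu // hv // scaler0 addr0.
by exists v, 0; split=> //; rewrite addr0.
Qed.

Lemma even_mul s t (a b : A) :
  even_part s a -> even_part t b -> even_part (s (+) t) (a * b).
Proof.
case: s t => [] [] //= ha hb _; first by rewrite ha // mul0r.
by rewrite hb // mulr0.
Qed.

Lemma even_comm s t (a b : A) : even_part s a -> even_part t b ->
  a * b = (-1) ^+ (s && t) * (b * a).
Proof.
case: s t => [] [] ha hb /=; rewrite ?expr0 ?mul1r 1?mulrC //.
by rewrite ha // !(mul0r, mulr0).
Qed.

Definition even_alg : scAlgebra C :=
  @ScAlgebra C A even_part even_grading (fun h : false => False_ind _ (notF h))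
    even_mul even_comm.

End EvenAlgebra.

Section Evaluation.
Variables (C : fieldType) (c : C).

(** Two families of points of the Laurent polynomials with values in the dual numbers:
    the coordinate goes to c (1 + eps), respectively to c.  Comparing the two computes
    the derivative of a one-parameter subgroup at c. *)
Definition eval_dual (f : laurent C) : dual C := laurent_val f c.
Definition eval_const (f : laurent C) : dual C := ((laurent_val f c).1, 0).

Lemma eval_dual_linear : linear eval_dual. Proof. by []. Qed.
Lemma eval_dual_monoid : monoid_morphism eval_dual. Proof. by []. Qed.
HB.instance Definition _ := GRing.isLinear.Build C (laurent C) (dual C) _ eval_dual eval_dual_linear.
HB.instance Definition _ := GRing.isMonoidMorphism.Build (laurent C) (dual C) eval_dual eval_dual_monoid.

Lemma eval_const_linear : linear eval_const.
Proof.
move=> a f g; congr pair; rewrite -[RHS]/(a * 0 + 0) ?mulr0 ?addr0 //.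
Qed.
Lemma eval_const_monoid : monoid_morphism eval_const.
Proof.
split=> // f g; congr pair.
by rewrite -[RHS]/(_ * 0 + 0 * _) mulr0 mul0r addr0.
Qed.
HB.instance Definition _ := GRing.isLinear.Build C (laurent C) (dual C) _ eval_const eval_const_linear.
HB.instance Definition _ := GRing.isMonoidMorphism.Build (laurent C) (dual C) eval_const eval_const_monoid.

End Evaluation.

Section Coordinate.
Variable C : fieldType.

(** The coordinate and its inverse; the value (1, 0) at 0 makes their product equal to 1
    there as well. *)
Definition coord_fun : dual_fun C := fun c => if c == 0 then (1, 0) else (c, c).
Definition coord_inv_fun : dual_fun C := fun c => if c == 0 then (1, 0) else (c^-1, - c^-1).

Lemma coord_laurent : coord_fun \in @laurent_pred C.
Proof.
apply/asboolP; exists 'X, 0%N => c /negPf c0; rewrite /coord_fun c0 /=.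
by rewrite derivX hornerX hornerC expr0 !mul1r mulr1 mul0r subr0.
Qed.

Lemma coord_inv_laurent : coord_inv_fun \in @laurent_pred C.
Proof.
apply/asboolP; exists 1, 1%N => c c0; rewrite /coord_inv_fun (negPf c0) /=.
by rewrite derivC horner0 hornerC expr1 mulrN mulfV // mulr0 mul1r sub0r.
Qed.

Definition coord : laurent C := Laurent coord_laurent.
Definition coord_inv : laurent C := Laurent coord_inv_laurent.

Lemma coordK : coord * coord_inv = 1.
Proof.
apply: val_inj; apply/funext => c; rewrite -[LHS]/(coord_fun c * coord_inv_fun c).
rewrite -[RHS]/(1, 0) /coord_fun /coord_inv_fun; case: eqP => [_|/eqP c0].
  by congr pair; rewrite /= ?mulr1 // mulr0 addr0.
by congr pair; rewrite /= ?mulrN mulfV // addNr.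
Qed.

End Coordinate.

Section Points.
Variables (C : fieldType) (n : nat) (i j : 'I_n).

(** For i = j these points form a torus, with parameter 1 + a, and for i different
    from j a one-parameter unipotent group; the term with i == j in the product rule
    below makes it possible to treat both at once. *)
Definition root_pt (A : comAlgType C) (a : A) : 'M[even_alg A]_(n + n) :=
  1%:M + gen_mx false i j (a : even_alg A).

Lemma gen_mx_mul (A : comAlgType C) (a b : A) :
  gen_mx false i j (a : even_alg A) *m gen_mx false i j (b : even_alg A) =
  gen_mx false i j ((i == j)%:R * (a * b) : even_alg A).
Proof.
rewrite /gen_mx mulmx_block !mulmx0 !mul0mx !addr0 !add0r.
suff -> : (a : even_alg A) *: delta_mx i j *m ((b : even_alg A) *: delta_mx i j) =
  ((i == j)%:R * (a * b) : even_alg A) *: delta_mx i j :> 'M_n by [].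
apply/matrixP => k l; rewrite !mxE (bigD1 j) //= big1 => [|t tj]; last first.
  by rewrite !mxE (negPf tj) andbF mulr0 mul0r.
rewrite !mxE eqxx andbT addr0 [j == i]eq_sym.
by case: (k == i) (i == j) (l == j) => [] [] [] /=; rewrite !(mulr0, mul0r, mulr1, mul1r).
Qed.

Lemma gen_mxD (A : comAlgType C) (a b : A) :
  gen_mx false i j (a : even_alg A) + gen_mx false i j (b : even_alg A) =
  gen_mx false i j (a + b : even_alg A).
Proof. by rewrite /gen_mx add_block_mx !addr0 scalerDl. Qed.

Lemma root_ptM (A : comAlgType C) (a b : A) :
  root_pt a *m root_pt b = root_pt (a + b + (i == j)%:R * (a * b)).
Proof.
rewrite /root_pt mulmxDl mul1mx mulmxDr mulmx1 gen_mx_mul -!gen_mxD.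
by rewrite -addrA; congr (_ + _); rewrite addrCA addrA.
Qed.

Lemma root_pt0 (A : comAlgType C) : root_pt (0 : A) = 1%:M.
Proof. by rewrite /root_pt /gen_mx scale0r block_mx0 addr0. Qed.

Lemma root_pt_map (A B : comAlgType C) (f : {lrmorphism A -> B}) (a : A) :
  map_mx (f : even_alg A -> even_alg B) (root_pt a) = root_pt (f a).
Proof.
rewrite /root_pt map_mxD map_scalar_mx rmorph1; congr (_ + _).
rewrite /gen_mx map_block_mx !map_mx0 map_mxZ.
have -> : map_mx f (delta_mx i j) = delta_mx i j :> 'M[even_alg B]_n.
  by apply/matrixP => k l; rewrite !mxE rmorph_nat.
by [].
Qed.

Lemma Q_point_root (A : comAlgType C) (a b : A) :
  a + b + (i == j)%:R * (a * b) = 0 -> Q_point (root_pt a).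
Proof.
move=> ab; rewrite /root_pt /gen_mx scalar_mx_block add_block_mx !addr0.
split=> //.
- by move=> k l _; rewrite block_mxKur mxE.
- by move=> k l _; rewrite block_mxKdl mxE.
- rewrite /P_mx !mulmx_block !mulmx0 !mul0mx !addr0 !add0r.
  by rewrite !mulmxN !mulNmx !mulmx1 !mul1mx.
- have -> : block_mx (1%:M + (a : even_alg A) *: delta_mx i j) 0 0
    (1%:M + (a : even_alg A) *: delta_mx i j) = root_pt a.
    by rewrite /root_pt /gen_mx [RHS](congr1 (+%R^~ _) (scalar_mx_block _ _ _)) add_block_mx !addr0.
  exists (root_pt b); rewrite !root_ptM [b + a]addrC [b * a]mulrC ab root_pt0.
  by [].
Qed.

End Points.

Section LaurentCurves.
Variables (C : numFieldType) (M : lmodType C).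

Definition laurent_sum (K d : nat) (u : nat -> M) (f : C -> M) : Prop :=
  forall c, c != 0 -> c ^+ K *: f c = \sum_(k < d) c ^+ k *: u k.

(** A polynomial function with values in a vector space that vanishes on all
    nonzero scalars has zero coefficients: comparing the values at c and 2 c
    eliminates the top coefficient. *)
Lemma vector_poly_eq0 d (u : nat -> M) :
  (forall c : C, c != 0 -> \sum_(k < d) c ^+ k *: u k = 0) ->
  forall k, (k < d)%N -> u k = 0.
Proof.
elim: d u => // d IH u hu.
have ud k : (k < d)%N -> u k = 0.
  move=> kd; have /(_ k kd) : forall k, (k < d)%N ->
      ((2%:R : C) ^+ k - 2%:R ^+ d) *: u k = 0.
    apply: IH => c c0.
    have c20 : (2%:R : C) * c != 0 by rewrite mulf_neq0 // pnatr_eq0.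
    transitivity (\sum_(k < d.+1) (2%:R * c) ^+ k *: u k -
        2%:R ^+ d *: \sum_(k < d.+1) c ^+ k *: u k); last first.
      by rewrite (hu _ c20) (hu _ c0) scaler0 subr0.
    rewrite !big_ord_recr /= scalerDr scalerA -exprMn opprD addrACA subrr addr0.
    rewrite scaler_sumr -sumrB; apply: eq_bigr => i _.
    by rewrite !scalerA -scalerBl exprMn; congr (_ *: _); ring.
  move/eqP; rewrite scaler_eq0 subr_eq0 -!natrX eqr_nat eqn_exp2l //.
  by rewrite (ltn_eqF kd) => /eqP.
move=> k; rewrite ltnS leq_eqVlt => /orP[/eqP ->|]; last exact: ud.
have := hu 1 (oner_neq0 _); rewrite big_ord_recr /= big1 => [|i _].
  by rewrite add0r expr1n scale1r.
by rewrite ud // scaler0.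
Qed.

Lemma laurent_common_degree (l : seq (M * laurent C)) :
  exists K, forall p, p \in l -> exists q, laurent_at q K (laurent_val p.2).
Proof.
elim: l => [|p l [K hK]]; first by exists 0%N.
have [q [k hq]] : exists q k, laurent_at q k (laurent_val p.2).
  exact/asboolP/(laurentP p.2).
exists (K + k)%N => p'; rewrite inE => /orP[/eqP ->|/hK[q' hq']].
  by exists ('X^K * q); apply: laurent_at_shift.
by exists ('X^k * q'); rewrite addnC; apply: laurent_at_shift.
Qed.

(** A tensor is a finite sum of pure ones, whose second factors have a common
    denominator c ^ K; the second components carry c d/dc, which multiplies the
    coefficient of c ^ (k - K) by k - K. *)
Lemma laurent_tensor (l : seq (M * laurent C)) : exists K d u,
  laurent_sum K d u (fun c => \sum_(p <- l) (laurent_val p.2 c).1 *: p.1) /\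
  laurent_sum K d (fun k => (k%:R - K%:R) *: u k)
    (fun c => \sum_(p <- l) (laurent_val p.2 c).2 *: p.1).
Proof.
have [K hK] := laurent_common_degree l.
have [q hq] : exists q : M * laurent C -> {poly C}, forall p, p \in l ->
    laurent_at (q p) K (laurent_val p.2).
  have ex p : exists r, p \in l -> laurent_at r K (laurent_val p.2).
    have [pl|_] := boolP (p \in l); last by exists 0.
    by have [r hr] := hK p pl; exists r.
  by exists (fun p => sval (cid (ex p))) => p; apply: svalP (cid (ex p)).
pose d := \max_(p <- l) size (q p).
have szq p : p \in l -> (size (q p) <= d)%N by move=> pl; rewrite /d; apply: leq_bigmax_seq pl _.
exists K, d, (fun k => \sum_(p <- l) (q p)`_k *: p.1).
have swap (x : nat -> C) (y : nat -> M * laurent C -> C) :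
    \sum_(k < d) x k *: (\sum_(p <- l) y k p *: p.1) =
    \sum_(p <- l) (\sum_(k < d) y k p * x k) *: p.1.
  under eq_bigr do rewrite scaler_sumr.
  rewrite exchange_big /=; apply: eq_bigr => p _; rewrite scaler_suml.
  by apply: eq_bigr => k _; rewrite scalerA mulrC.
split=> c c0.
  rewrite /= (swap (fun k => c ^+ k) (fun k p => (q p)`_k)) scaler_sumr !big_seq.
  apply: eq_bigr => p pl; rewrite scalerA.
  by have [-> _] := hq p pl c c0; rewrite (horner_coef_wide _ (szq p pl)).
rewrite /=; under [RHS]eq_bigr do rewrite scaler_sumr.
under [RHS]eq_bigr do under eq_bigr do rewrite scalerA.
rewrite (swap (fun k => c ^+ k) (fun k p => (k%:R - K%:R) * (q p)`_k)).
rewrite scaler_sumr !big_seq; apply: eq_bigr => p pl; rewrite scalerA.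
have [_ ->] := hq p pl c c0; congr (_ *: _).
have -> : c * (q p)^`().[c] = ('X * (q p)^`()).[c] by rewrite hornerM hornerX.
have sz' : (size ('X * (q p)^`())%R <= d)%N.
  have [->|q0] := eqVneq (q p) 0; first by rewrite deriv0 mulr0 size_poly0.
  apply: leq_trans (size_polyMleq _ _) _; rewrite size_polyX /=.
  by apply: leq_trans (szq p pl); apply: lt_size_deriv.
rewrite (horner_coef_wide _ sz') (horner_coef_wide _ (szq p pl)) mulr_sumr -sumrB.
apply: eq_bigr => k _; rewrite coefXM coef_deriv.
case: (nat_of_ord k) => [|k'] /=; first by ring.
by rewrite -mulr_natr; ring.
Qed.

End LaurentCurves.

Section TensorElements.
Variables (C : fieldType) (M N : lmodType C).

Lemma tensDl (m m' : M) (a : N) : tens (m + m') a = tens m a + tens m' a.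
Proof. by have [_ h] := tens_bilin M N; rewrite (linear_funD _ _ (h a)). Qed.

Lemma tens_suml (J : Type) (l : seq J) (F : J -> M) (a : N) :
  tens (\sum_(x <- l) F x) a = \sum_(x <- l) tens (F x) a.
Proof. by have [_ h] := tens_bilin M N; rewrite (linear_fun_sum _ _ _ (h a)). Qed.

Lemma tensZ (c : C) (m : M) (a : N) : tens (c *: m) a = tens m (c *: a).
Proof.
by have [h h'] := tens_bilin M N; rewrite (linear_funZ _ _ (h m)) (linear_funZ _ _ (h' a)).
Qed.

(** The contraction of the second factor with a linear form. *)
Definition tens_coef (phi : N -> C) : tensor M N -> M :=
  tensor_lift (fun m a => phi a *: m).

Lemma coef_bilin (phi : N -> C^o) : linear phi ->
  bilin (fun (m : M) a => (phi a : C) *: m).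
Proof.
move=> hp; split=> [m c x y|a c x y]; first by rewrite hp scalerDl scalerA.
by rewrite scalerDr !scalerA mulrC.
Qed.

Lemma tens_coef_linear (phi : N -> C^o) : linear phi -> linear (tens_coef phi).
Proof. by move=> hp; apply: tensor_lift_linear (coef_bilin hp). Qed.

Lemma tens_coefE (phi : N -> C^o) m a : linear phi ->
  tens_coef phi (tens m a) = (phi a : C) *: m.
Proof. by move=> hp; apply: tensor_lift_tens (coef_bilin hp). Qed.

End TensorElements.

Lemma tensor_map_tens (C : fieldType) (M : lmodType C) (A B : scAlgebra C)
    (f : {lrmorphism A -> B}) (m : M) a : tensor_map f (tens m a) = tens m (f a).
Proof.
apply: tensor_lift_tens; have [h h'] := tens_bilin M B.
by split=> [m'|b]; [move=> c x y; rewrite linearP; apply: h|apply: h'].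
Qed.

Section OneParameter.
Variables (C : numFieldType) (M : qModule C) (n : nat).
Variable rho : forall A : scAlgebra C, 'M[A]_(n + n) -> tensor M A -> tensor M A.
Hypotheses (rhoP : Q_representation rho) (rhoX : Q_lifts rho).
Variables i j : 'I_n.
Local Notation D := (even_alg (dual C)).
Local Notation X := (@E C M false (zenum i) (zenum j)).
Local Notation delta := ((i == j)%:R).

(** The lifting condition is stated for homogeneous vectors; for an even root vector no
    sign occurs, and the formula extends to all of M. *)
Lemma rho_infinitesimal (b : C) m :
  rho (root_pt i j ((0, b) : dual C)) (tens m (1 : D)) =
  tens m 1 + tens (X m) ((0, b) : D).
Proof.
have sq (a : C) : ((0, b) : dual C) * (0, a) = 0.
  by congr pair; rewrite /= ?(mul0r, mulr0, addr0).
have pt : Q_point (root_pt i j ((0, b) : dual C)).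
  apply: (@Q_point_root C n i j (dual C) (0, b) (0, - b)); rewrite sq mulr0 addr0.
  by congr pair; rewrite /= ?addr0 ?subrr.
have hom t (m' : M) : part t m' -> rho (root_pt i j ((0, b) : dual C)) (tens m' (1 : D)) =
    tens m' 1 + tens (X m') ((0, b) : D).
  move=> mt; have /= -> := rhoX (A := D) (r := false) i j (a := (0, b)) _ _ mt.
  - by rewrite expr0 scale1r.
  - by [].
  - exact: sq.
rewrite [m in LHS]component_sum tensDl (Q_rep_add rhoP pt).
rewrite !(hom _ _ (component_part _ _)) addrACA -!tensDl.
by rewrite -(linear_funD _ _ (E_linear _ _ _)) -!component_sum.
Qed.

(** The image of m (x) 1 under the point of parameter x over the Laurent polynomials
    is a Laurent polynomial curve f with coefficients in M, by naturality its value at c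
    is the action of the point over c.  Evaluating instead at c (1 + eps) multiplies
    this point by the infinitesimal point of parameter e(c) eps, so that
    e(c) X f(c) = c f'(c).  The torus has e = 1, and the unipotent group has e(c) = c. *)
Lemma one_parameter_curve (x x' : laurent C) (e : C -> C) m :
  x + x' + delta * (x * x') = 0 ->
  (forall c, c != 0 -> (laurent_val x c).2 = c) ->
  (forall c, c != 0 -> e c + delta * (e c * (laurent_val x c).1) = c) ->
  exists K d u f, [/\ laurent_sum K d u f,
    laurent_sum K d (fun k => (k%:R - K%:R) *: u k) (fun c => e c *: X (f c)) &
    forall c, c != 0 ->
      rho (root_pt i j (((laurent_val x c).1, 0) : dual C)) (tens m (1 : D)) = tens (f c) 1].
Proof.
move=> xx' x2 ex; pose L := even_alg (laurent C).
have ptL := Q_point_root xx'.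
pose z := rho (root_pt i j x) (tens m (1 : L)).
pose l : seq (M * laurent C) := tensor_repr z.
have [K [d [u [h1 h2]]]] := laurent_tensor l.
pose f c := \sum_(p <- l) (laurent_val p.2 c).1 *: p.1.
have tens_const (m' : M) (a : C) : tens m' ((a, 0) : D) = tens (a *: m') (1 : D).
  by rewrite tensZ; congr tens; congr pair; rewrite /= /GRing.scale /= ?mulr1 ?mulr0.
have tens_eps (m' : M) (a : C) : tens m' ((0, a) : D) = tens (a *: m') ((0, 1) : D).
  by rewrite tensZ; congr tens; congr pair; rewrite /= /GRing.scale /= ?mulr1 ?mulr0.
have even_map (A B : comAlgType C) (g : {lrmorphism A -> B}) s (a : even_alg A) :
    sc_part s a -> sc_part s (g a : even_alg B).
  by move=> h /h ->; rewrite rmorph0.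
have curve c : c != 0 -> rho (root_pt i j (((laurent_val x c).1, 0) : dual C))
    (tens m (1 : D)) = tens (f c) 1.
  move=> c0; pose g : {lrmorphism laurent C -> dual C} := eval_const c.
  have := @Q_rep_natural _ _ _ _ rhoP L D g _ (tens m 1) (even_map _ _ g) ptL.
  rewrite (root_pt_map i j g) (@tensor_map_tens _ _ L D g) rmorph1 => <-.
  rewrite -/z /tensor_map /tensor_lift /formal_sum -/l.
  rewrite /f tens_suml; apply: eq_bigr => p _.
  exact: tens_const.
exists K, d, u, f; split=> // c c0; rewrite -(h2 c c0) /=; congr (_ *: _).
(* The point over c (1 + eps) is the infinitesimal point times the one over c. *)
have ptM : root_pt i j (eval_dual c x) =
    root_pt i j ((0, e c) : dual C) *m root_pt i j (((laurent_val x c).1, 0) : dual C).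
  rewrite root_ptM; congr root_pt; rewrite /eval_dual [LHS]surjective_pairing x2 //.
  case: (i == j) (ex c c0) => /= [|]; rewrite ?mul1r ?mul0r ?addr0.
    by move=> E; congr pair; [rewrite /=; ring|rewrite -[LHS]E /=; ring].
  by move=> E; congr pair; [rewrite /=; ring|rewrite -[LHS]E /=; ring].
have eps_pt (b b' : C) : b + b' = 0 -> Q_point (root_pt i j ((0, b) : dual C)).
  move=> bb; apply: (@Q_point_root C n i j (dual C) (0, b) (0, b')).
  have -> : ((0, b) : dual C) * (0, b') = 0 by congr pair; rewrite /=; ring.
  by rewrite mulr0 addr0; congr pair; rewrite /= ?addr0.
pose g : {lrmorphism laurent C -> dual C} := eval_dual c.
pose g0 : {lrmorphism laurent C -> dual C} := eval_const c.
have ptc : Q_point (root_pt i j (((laurent_val x c).1, 0) : dual C)).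
  apply: (@Q_point_root C n i j (dual C) _ ((laurent_val x' c).1, 0)).
  transitivity (g0 (x + x' + delta * (x * x'))); last by rewrite xx' rmorph0.
  by rewrite !(rmorphD, rmorphM) rmorph_nat.
have := @Q_rep_natural _ _ _ _ rhoP L D g _ (tens m 1) (even_map _ _ g) ptL.
rewrite (root_pt_map i j g) (@tensor_map_tens _ _ L D g) rmorph1 ptM.
have mul := @Q_rep_mul _ _ _ _ rhoP D _ _ (tens m (1 : D))
  (eps_pt (e c) (- e c) (subrr _)) ptc.
have mul' := etrans mul (etrans (congr1 (@rho D (root_pt i j ((0, e c) : dual C)))
  (curve c c0)) (rho_infinitesimal (e c) (f c))).
move=> h; move: (etrans h mul'); rewrite -/z /tensor_map /tensor_lift /formal_sum -/l.
pose phi : dual C -> C^o := fun a => a.2.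
have phil : linear phi by [].
move/(congr1 (tens_coef phi)).
rewrite (linear_fun_sum _ _ _ (tens_coef_linear phil)).
rewrite (linear_funD _ _ (tens_coef_linear phil)) !tens_coefE // => {}h.
by rewrite -[LHS]add0r -[X in X + _](scale0r (f c)) -h; apply: eq_bigr => p _; rewrite tens_coefE.
Qed.

End OneParameter.

(** * Integrability: eigenvectors and nilpotency *)

Section Iterates.
Variables (C : fieldType) (M : lmodType C) (X : M -> M).
Hypothesis Xl : linear X.

Lemma iter_linear k : linear (iter k X).
Proof. by elim: k => [|k IH] //; exact: (linear_comp IH Xl). Qed.

Lemma iter_eq0_leq j k m : (j <= k)%N -> iter j X m = 0 -> iter k X m = 0.
Proof.
move=> jk h; rewrite -(subnK jk) iterD h; exact: linear_fun0 (iter_linear _).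
Qed.

End Iterates.

Lemma zenum_surj (i : zidx) : exists k, i = zenum k.
Proof.
have [|k [_ ->]] := (truncationP (`|val i|%N.*2) i).1; last by exists k.
by rewrite /truncation /=; lia.
Qed.

Section Integrable.
Variables (C : numFieldType) (M : qModule C).
Hypothesis Mint : integrable M.

Lemma tens1_inj (m m' : M) :
  tens m (1 : even_alg (dual C)) = tens m' 1 -> m = m'.
Proof.
pose phi : dual C -> C^o := fun a => a.1; have phil : linear phi by [].
by move/(congr1 (tens_coef phi)); rewrite !tens_coefE // !scale1r.
Qed.

(** The torus of e_i acts on m through a Laurent polynomial c |-> sum_k c ^ (k - K) u_k;
    its value at 1 is m, and its coefficients are eigenvectors. *)
Lemma integrable_eigenvectors (i : zidx) (m : M) : exists d K (u : nat -> M),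
  m = \sum_(k < d) u k /\
  forall k, (k < d)%N -> E false i i (u k) = (k%:R - K%:R) *: u k.
Proof.
have [n0 ->] := zenum_surj i; have [rho [rhoP rhoX]] := Mint (ltn0Sn n0).
pose j : 'I_n0.+1 := ord_max.
have xx' : coord C - 1 + (coord_inv C - 1) +
    (j == j)%:R * ((coord C - 1) * (coord_inv C - 1)) = 0.
  rewrite eqxx mul1r mulrBl mul1r mulrBr mulr1 coordK.
  by rewrite [X in _ + X]addrAC -addrA; ring.
have xE (c : C) : c != 0 -> laurent_val (coord C - 1) c = (c - 1, c).
  move=> /negPf c0; rewrite -[LHS]/(coord_fun c - (1, 0)) /coord_fun c0.
  by congr pair; rewrite /= ?subr0.
have [||K [d [u [f [h1 h2 h3]]]]] := one_parameter_curve rhoP rhoX (e := fun=> 1) m xx'.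
- by move=> c /xE ->.
- by move=> c /xE -> /=; rewrite eqxx !mul1r addrCA subrr addr0.
have f1 : f 1 = m.
  have := h3 1 (oner_neq0 _); rewrite xE ?oner_eq0 //= subrr.
  by rewrite (root_pt0 j j (dual C)) (Q_rep_1 rhoP) => /tens1_inj.
exists d, K, u; split.
  have := h1 1 (oner_neq0 _); rewrite expr1n scale1r f1 => ->.
  by apply: eq_bigr => k _; rewrite expr1n scale1r.
move=> k kd; apply/eqP; rewrite -subr_eq0; apply/eqP.
apply: (vector_poly_eq0 (u := fun k => E false (zenum n0) (zenum n0) (u k) -
  (k%:R - K%:R) *: u k)) kd => c c0.
have := h2 c c0; rewrite scale1r -(linear_funZ _ _ (E_linear _ _ _)) (h1 c c0).
rewrite (linear_fun_sum _ _ _ (E_linear _ _ _)) => h.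
under eq_bigr do rewrite scalerBr; rewrite sumrB; apply/eqP; rewrite subr_eq0 -h.
by apply/eqP/eq_bigr => t _; rewrite (linear_funZ _ _ (E_linear _ _ _)).
Qed.

(** Here the curve is c |-> exp (c X) m0 with exp X m0 = m, and its coefficients
    satisfy X u_k = (k + 1 - K) u_(k + 1), so that a high power of X kills them all. *)
Lemma integrable_nilpotent (i j : zidx) (m : M) :
  i != j -> exists d, iter d (E false i j) m = 0.
Proof.
have [ni ->] := zenum_surj i; have [nj ->] := zenum_surj j => ij.
pose n := (maxn ni nj).+1; have [rho [rhoP rhoX]] := Mint (ltn0Sn (maxn ni nj)).
have hi : (ni < n)%N by rewrite ltnS leq_maxl.
have hj : (nj < n)%N by rewrite ltnS leq_maxr.
pose oi := Ordinal hi; pose oj := Ordinal hj.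
have oij : (oi == oj) = false.
  by apply/negbTE; apply: contra ij => /eqP/(congr1 (@nat_of_ord n)) /= ->.
pose X : M -> M := E false (zenum ni) (zenum nj); have Xl : linear X := E_linear _ _ _.
have xx' : coord C + (- coord C) + (oi == oj)%:R * (coord C * (- coord C)) = 0.
  by rewrite subrr oij mul0r addr0.
have xE (c : C) : c != 0 -> laurent_val (coord C) c = (c, c).
  by move=> /negPf c0; rewrite /= /coord_fun c0.
have curve m' := one_parameter_curve rhoP rhoX (e := fun c => c) m' xx'.
have x2 (c : C) : c != 0 -> (laurent_val (coord C) c).2 = c by move=> /xE ->.
have x3 (c : C) : c != 0 -> c + (oi == oj)%:R * (c * (laurent_val (coord C) c).1) = c.
  by move=> _; rewrite oij mul0r addr0.
(* The curve starts from exp (- X) m, so that it passes through m at c = 1. *)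
have [K0 [d0 [u0 [f0 [_ _ h0]]]]] := curve m x2 x3.
have [K [d [u [f [h1 h2 h3]]]]] := curve (f0 (-1)) x2 x3.
have n1 : (-1 : C) != 0 by rewrite oppr_eq0 oner_eq0.
have f1 : f 1 = m.
  have := h3 1 (oner_neq0 _); rewrite -(h0 _ n1) !xE ?oner_eq0 //=.
  have pt (b b' : C) : b + b' = 0 ->
      root_pt oi oj ((b, 0) : dual C) *m root_pt oi oj ((b', 0) : dual C) = 1%:M.
    move=> bb; rewrite root_ptM oij mul0r addr0.
    rewrite -(root_pt0 oi oj (dual C)); congr root_pt.
    by congr pair; rewrite /= ?addr0.
  have qpt (b b' : C) : b + b' = 0 -> Q_point (root_pt oi oj ((b, 0) : dual C)).
    move=> bb; apply: (@Q_point_root C n oi oj (dual C) (b, 0) (b', 0)).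
    by rewrite oij mul0r addr0; congr pair; rewrite /= ?addr0.
  have mul := @Q_rep_mul _ _ _ _ rhoP (even_alg (dual C)) _ _
    (tens m (1 : even_alg (dual C))) (qpt _ _ (subrr 1)) (qpt _ _ (addNr 1)).
  move=> h; move: (etrans (esym h) (esym mul)); rewrite (pt _ _ (subrr 1)).
  by rewrite (Q_rep_1 rhoP) => /tens1_inj.
have mE : m = \sum_(k < d) u k.
  have := h1 1 (oner_neq0 _); rewrite expr1n scale1r f1 => ->.
  by apply: eq_bigr => k _; rewrite expr1n scale1r.
(* The coefficients of c X f(c) - c f'(c). *)
pose v k := (if k is k'.+1 then X (u k') else 0) -
  (if (k < d)%N then (k%:R - K%:R) *: u k else 0).
have v0 k : (k < d.+1)%N -> v k = 0.
  apply: vector_poly_eq0 k => c c0; rewrite /v.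
  under eq_bigr do rewrite scalerBr; rewrite sumrB.
  rewrite big_ord_recl /= scaler0 add0r big_ord_recr /= ltnn scaler0 addr0.
  apply/eqP; rewrite subr_eq0; apply/eqP.
  under [RHS]eq_bigr do rewrite ltn_ord.
  rewrite -(h2 c c0) scalerA mulrC -scalerA -(linear_funZ _ _ Xl) (h1 c c0).
  rewrite (linear_fun_sum _ _ _ Xl) scaler_sumr; apply: eq_bigr => k _.
  by rewrite (linear_funZ _ _ Xl) scalerA exprS.
have step r : forall k, (k + r)%N = d -> iter r X (u k) = 0 \/ r = 0%N.
  elim: r => [|r IH] k kd; [by right|left].
  have kd' : (k.+1 < d.+1)%N by lia.
  have /eqP := v0 _ kd'; rewrite /v subr_eq0 iterSr => /eqP ->.
  case: ifP => [h|_]; last exact: linear_fun0 (iter_linear Xl _).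
  rewrite (linear_funZ _ _ (iter_linear Xl _)).
  have [|->|r0] := IH k.+1; first by lia.
    by rewrite scaler0.
  by lia.
exists d; rewrite mE (linear_fun_sum _ _ _ (iter_linear Xl d)) big1 // => k _.
have [|h|r0] := step (d - k)%N k; first by rewrite subnKC // ltnW.
  by apply: iter_eq0_leq h => //; exact: leq_subr.
by have := ltn_ord k; lia.
Qed.

End Integrable.

(** * Bounds on the length of chains *)

Section Chains.
Variable V : Type.
Implicit Types (N : nat -> set V) (St : set V -> Prop).

Definition jumps N k : nat := \sum_(i < k) `[< N i <> N i.+1 >].

(** Chains are indexed by all natural numbers and may repeat; a bound on the number
    of jumps then passes along any construction that is monotone and detects
    jumps, without having to remove repetitions. *)
Definition bounded St (b : nat) : Prop :=
  forall N, (forall i, St (N i)) -> (forall i, N i `<=` N i.+1) ->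
  forall k, (jumps N k <= b)%N.

Lemma boundedW St St' b : (forall N : set V, St' N -> St N) -> bounded St b -> bounded St' b.
Proof. by move=> h hb N sN; apply: hb => i; apply: h. Qed.

End Chains.

Lemma jumps_detect (J : finType) (V W : Type) (N : nat -> set V)
    (Phi : J -> nat -> set W) k :
  (forall i, (i < k)%N -> (forall j, Phi j i = Phi j i.+1) -> N i = N i.+1) ->
  (jumps N k <= \sum_j jumps (Phi j) k)%N.
Proof.
move=> h; rewrite /jumps exchange_big /=; apply: leq_sum => i _.
case: (asboolP (N i <> N i.+1)) => // Ni.
have [j hj] : exists j, Phi j i <> Phi j i.+1.
  apply: contrapT => H; apply: Ni; apply: h => // j.
  by apply: contrapT => H'; apply: H; exists j.
by rewrite (bigD1 j) //= (asboolT hj).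
Qed.

Lemma bounded_detect (J : finType) (V W : Type) (StV : set V -> Prop)
    (StW : J -> set W -> Prop) (Phi : J -> set V -> set W) (b : J -> nat) :
  (forall j, bounded (StW j) (b j)) ->
  (forall j N, StV N -> StW j (Phi j N)) ->
  (forall j N N', N `<=` N' -> Phi j N `<=` Phi j N') ->
  (forall N N', StV N -> StV N' -> N `<=` N' ->
     (forall j, Phi j N = Phi j N') -> N = N') ->
  bounded StV (\sum_j b j).
Proof.
move=> hb hS hm hd N sN cN k.
have h : (jumps N k <= \sum_j jumps (fun i => Phi j (N i)) k)%N.
  by apply: jumps_detect => i _; apply: hd.
apply: leq_trans h _; apply: leq_sum => j _; apply: hb => i; first exact: hS.
exact: hm.
Qed.

Section Stable.
Variables (C : fieldType) (Op : Type).

Definition stable (V : lmodType C) (op : Op -> V -> V) (N : set V) : Prop :=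
  subspace N /\ forall o v, N v -> N (op o v).

Definition stable_in (V : lmodType C) (op : Op -> V -> V) (R N : set V) : Prop :=
  stable op N /\ N `<=` R.

(** If a space is a sum of images of spaces W_j under equivariant maps f_j, filter it
    by the partial sums: a stable subspace N is determined by the preimages under
    f_j of N plus the sum of the earlier images. *)
Lemma bounded_sum_images (J : finType) (V W : lmodType C) (opV : Op -> V -> V)
    (opW : Op -> W -> W) (RV : set V) (RW : J -> set W) (f : J -> W -> V) (b : J -> nat) :
  (forall o, linear (opV o)) ->
  (forall j, linear (f j)) ->
  (forall j, stable opW (RW j)) ->
  (forall j o x, RW j x -> opV o (f j x) = f j (opW o x)) ->
  (forall v, RV v -> exists x : J -> W,
     (forall j, RW j (x j)) /\ v = \sum_j f j (x j)) ->
  (forall j, bounded (stable_in opW (RW j)) (b j)) ->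
  bounded (stable_in opV RV) (\sum_j b j).
Proof.
move=> opl fl RWs eqv gen hb.
pose part t : set V := [set v | exists y : J -> W,
  (forall i, RW i (y i)) /\ v = \sum_(i | (enum_rank i < t)%N) f i (y i)].
have partS t : subspace (part t).
  split; first exists (fun=> 0).
    split=> [i|]; first by have [[]] := RWs i.
    by rewrite big1 // => i _; apply: linear_fun0.
  move=> c u v [y [hy ->]] [z [hz ->]]; exists (fun i => c *: y i + z i); split.
    by move=> i; have [[_ h] _] := RWs i; apply: h.
  by rewrite scaler_sumr -big_split /=; apply: eq_bigr => i _; rewrite fl.
have partO t o v : part t v -> part t (opV o v).
  move=> [y [hy ->]]; exists (fun i => opW o (y i)); split.
    by move=> i; have [_ h] := RWs i; apply: h.
  by rewrite (linear_fun_sum _ _ _ (opl o)); apply: eq_bigr => i _; apply: eqv.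
pose Phi j (N : set V) : set W := [set x | RW j x /\
  exists n z, [/\ N n, part (enum_rank j) z & f j x = n + z]].
apply: (bounded_detect (StW := fun j => stable_in opW (RW j)) (Phi := Phi)) => //.
- move=> j N [[Ns No] _]; split; last by move=> x [].
  have [[R0 RP] RO] := RWs j; split; [split|].
  + split=> //; exists 0, 0; split; [by case: Ns|by case: (partS (enum_rank j))|].
    by rewrite addr0 linear_fun0.
  + move=> c u v [Ru [n [z [Nn hz E]]]] [Rv [n' [z' [Nn' hz' E']]]].
    split; first exact: RP.
    exists (c *: n + n'), (c *: z + z'); split; first by case: Ns => _; apply.
      by case: (partS (enum_rank j)) => _; apply.
    by rewrite fl E E' scalerDr addrACA.
  + move=> o v [Rv [n [z [Nn hz E]]]]; split; first exact: RO.
    exists (opV o n), (opV o z); split; [exact: No|exact: partO|].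
    by rewrite -eqv // E linear_funD.
- by move=> j N N' NN x [Rx [n [z [/NN Nn hz E]]]]; split=> //; exists n, z.
move=> N N' [[Ns No] _] [[Ns' No'] RN'] NN eqPhi.
apply/seteqP; split=> // v Nv'.
suff h t v' : N' v' -> part t v' -> N v'.
  apply: (h #|J| v) => //; have [x [hx ->]] := gen v (RN' _ Nv').
  by exists x; split=> //; apply: eq_bigl => i; rewrite ltn_ord.
elim: t v' {v Nv'} => [|t IH] v Nv' [y [hy E]].
  by rewrite E big1 //; case: Ns.
have [tJ|Jt] := ltnP t #|J|; last first.
  apply: IH Nv' _; exists y; split=> //; rewrite E; apply: eq_bigl => i.
  by rewrite ltnS ltnW ?(leq_trans (ltn_ord _)) // (leq_trans (ltn_ord _)).
pose j := enum_val (Ordinal tJ).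
have jt : nat_of_ord (enum_rank j) = t by rewrite enum_valK.
have {}E : v = f j (y j) + \sum_(i | (enum_rank i < t)%N) f i (y i).
  rewrite E (bigD1 j) /=; last by rewrite jt ltnS.
  congr (_ + _); apply: eq_bigl => i; rewrite ltnS [RHS]ltn_neqAle andbC.
  congr (_ && _); rewrite -jt; apply/idP/idP; apply: contra.
    by move/eqP/val_inj/enum_rank_inj ->.
  by move/eqP ->.
have z1 : part t (\sum_(i | (enum_rank i < t)%N) f i (y i)) by exists y.
have : Phi j N' (y j).
  split=> //; exists v, (- \sum_(i | (enum_rank i < t)%N) f i (y i)).
  by rewrite jt; split=> //; [exact: subspaceN|rewrite E addrK].
rewrite -eqPhi => -[_ [n [z [Nn hz E']]]]; rewrite jt in hz.
have -> : v = n + (v - n) by rewrite addrC subrK.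
apply: subspaceD => //; apply: IH; first by apply: subspaceB => //; apply: NN.
by rewrite E E' addrC !addrA addNr add0r; apply: subspaceD.
Qed.

(** A jump of a chain is also a jump of its intersection with the kernel of phi or of
    its image under phi. *)
Lemma bounded_kernel (V W : lmodType C) (opV : Op -> V -> V) (opW : Op -> W -> W)
    (R : set V) (R' : set W) (phi : V -> W) b b' :
  (forall o, linear (opW o)) -> linear phi ->
  (forall o v, phi (opV o v) = opW o (phi v)) ->
  (forall v, R v -> R' (phi v)) ->
  bounded (stable_in opV [set v | R v /\ phi v = 0]) b ->
  bounded (stable_in opW R') b' ->
  bounded (stable_in opV R) (b + b').
Proof.
move=> opl pl eqv RR hb hb' N sN cN k.
have h1 := hb (fun i => [set v | N i v /\ phi v = 0]).
have h2 := hb' (fun i => phi @` N i).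
suff le : (jumps N k <= jumps (fun i => [set v | N i v /\ phi v = 0%R]) k +
    jumps (fun i => phi @` N i) k)%N.
  apply: leq_trans le _; apply: leq_add; [apply: h1|apply: h2] => i; have [[Ns No] NR] := sN i.
  - split; last by move=> v [/NR Rv pv]; split.
    split; first split.
    + by split; [case: Ns|apply: linear_fun0].
    + move=> c u v [Nu pu] [Nv pv]; split; first by case: Ns => _; apply.
      by rewrite pl pu pv scaler0 addr0.
    + move=> o v [Nv pv]; split; first exact: No.
      by rewrite eqv pv (linear_fun0 (opl o)).
  - by move=> v [/(cN i) Nv pv]; split.
  - split; last by move=> _ [v /NR Rv <-]; apply: RR.
    split; first split.
    + by exists 0; [case: Ns|apply: linear_fun0].
    + move=> c _ _ [u Nu <-] [v Nv <-]; exists (c *: u + v); last by rewrite pl.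
      by case: Ns => _; apply.
    + by move=> o _ [v Nv <-]; exists (opV o v); [apply: No|apply: eqv].
  - by move=> _ [v /(cN i) Nv <-]; exists v.
rewrite /jumps -big_split; apply: leq_sum => i _ /=.
case: (asboolP (N i <> N i.+1)) => // Ni.
have [E1|E1] := asboolP ([set v | N i v /\ phi v = 0] <> [set v | N i.+1 v /\ phi v = 0]).
  by [].
have [E2|E2] := asboolP (phi @` N i <> phi @` N i.+1); first by [].
have {}E1 : [set v | N i v /\ phi v = 0] = [set v | N i.+1 v /\ phi v = 0].
  exact: contrapT.
have {}E2 : phi @` N i = phi @` N i.+1 by exact: contrapT.
case: Ni; apply/seteqP; split; first exact: cN.
move=> v Nv; have : (phi @` N i) (phi v) by rewrite E2; exists v.
move=> [u Nu pu]; have -> : v = (v - u) + u by rewrite subrK.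
have [[Ns _] _] := sN i; have [[Ns' _] _] := sN i.+1.
apply: subspaceD => //.
suff [] : [set v | N i v /\ phi v = 0] (v - u) by [].
rewrite E1; split; first by apply: subspaceB => //; apply: cN.
by rewrite (linear_funB _ _ pl) pu subrr.
Qed.

End Stable.

Section FiniteDimension.
Variable C : fieldType.

Lemma bounded_line : bounded (@subspace C C^o) 1.
Proof.
move=> N sN cN k.
have full N' : @subspace C C^o N' -> N' <> setT -> N' = [set 0].
  move=> sN' NT; apply/seteqP; split=> [x Nx /=|x ->]; last by case: sN'.
  apply: contrapT => /eqP x0; apply: NT; apply/seteqP; split=> // y _.
  have -> : y = (y / x) *: (x : C^o) by rewrite -[RHS]/(y / x * x) divfK.
  exact: subspaceZ.
suff [] : (N k <> setT -> jumps N k = 0%N) /\ (jumps N k <= 1)%N by [].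
elim: k => [|k [IH1 IH2]]; first by rewrite /jumps big_ord0.
have -> : jumps N k.+1 = (jumps N k + `[< N k <> N k.+1 >])%N.
  by rewrite /jumps big_ord_recr.
have [E|NT] := EM (N k = setT).
  have E' : N k.+1 = setT by apply/seteqP; split=> // x _; apply: cN; rewrite E.
  by rewrite E E' asboolF ?addn0; [split; [case|rewrite ?addn0]|apply].
rewrite IH1 // add0n; split; last exact: leq_b1.
move=> NT'; rewrite (full _ (sN k) NT) (full _ (sN k.+1) NT').
by rewrite asboolF //; apply.
Qed.

Lemma bounded_span (J : finType) (V : lmodType C) (w : J -> V) :
  bounded (fun N => subspace N /\ N `<=` [set v | exists x : J -> C, v = \sum_j x j *: w j])
    #|J|.
Proof.
rewrite -sum1_card.
pose noV := fun (o : void) (v : V) => v; pose noW := fun (o : void) (x : C^o) => x.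
pose R : set V := [set v | exists x : J -> C, v = \sum_j x j *: w j].
have h : bounded (stable_in noV R) (\sum_(j : J) 1).
  apply: (@bounded_sum_images C void J V C^o noV noW R (fun=> setT)
    (fun j x => (x : C) *: w j) (fun=> 1%N)) => //.
  - by move=> j a x y /=; rewrite scalerDl scalerA.
  - by move=> v [x ->]; exists x.
  - by move=> j; apply: boundedW bounded_line => N [[]].
by apply: boundedW h => N [sN NR]; split=> //; split=> // -[].
Qed.

End FiniteDimension.

Section FiniteLength.
Variables (C : fieldType) (M : qModule C).

Lemma is_submoduleT : is_submodule (setT : set M). Proof. by []. Qed.

Lemma is_submodule0 : is_submodule ([set 0] : set M).
Proof.
split=> //.
- by move=> c u v -> ->; rewrite /= scaler0 addr0.
- by move=> s v ->; rewrite /= component_id //; exact: part0.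
- by move=> X v ->; apply: linear_fun0; apply: act_linearr.
Qed.

Definition strict_chain (l : nat) (N : nat -> set M) : Prop :=
  [/\ N 0%N = [set 0], N l = setT, forall i, (i <= l)%N -> is_submodule (N i) &
      forall i, (i < l)%N -> N i `<` N i.+1].

(** A strict chain of submodules of maximal length has simple subquotients. *)
Lemma bounded_finite_length b : bounded (@is_submodule C M) b -> finite_length M.
Proof.
move=> hb; pose P l := `[< exists N, strict_chain l N >].
have Pb l : P l -> (l <= b)%N.
  move=> /asboolP[N [N0 Nl Ns Nc]].
  have -> : l = jumps (fun i => N (minn i l)) l.
    rewrite /jumps -[LHS]card_ord -sum1_card; apply: eq_bigr => i _.
    rewrite asboolT // (minn_idPl (ltnW (ltn_ord i))) (minn_idPl (ltn_ord i)) => E.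
    by have [_] := Nc i (ltn_ord i); apply; rewrite E.
  apply: hb => i; first by apply: Ns; apply: geq_minr.
  case: (ltnP i l) => il; last by rewrite (minn_idPr (leqW il)).
  have -> : minn i.+1 l = i.+1 by apply/minn_idPl.
  by case: (Nc i il).
have exP : exists l, P l.
  have [E|nE] := EM ([set 0] = setT :> set M).
    by exists 0%N; apply/asboolP; exists (fun=> setT); split.
  exists 1%N; apply/asboolP; exists (fun i => if i is 0%N then [set 0] else setT).
  split=> // [[|i] _|[|//] _]; [exact: is_submodule0|exact: is_submoduleT|].
  by split=> // h; apply: nE; apply/seteqP; split.
case: (ex_maxnP exP Pb) => l /asboolP[N [N0 Nl Ns Nc]] lmax.
exists l, N; split=> // i il; split; first exact: Nc.
move=> L sL NL LN; apply: contrapT => h.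
have h1 : L <> N i by move=> E; apply: h; left.
have h2 : L <> N i.+1 by move=> E; apply: h; right.
suff : P l.+1 by move=> /lmax; rewrite ltnn.
apply/asboolP; exists (fun j => if (j <= i)%N then N j else
  if j == i.+1 then L else N j.-1); split=> //.
- by rewrite leqNgt ltnS ltnW //= eqSS (gtn_eqF il).
- move=> j jl; case: leqP => ji; first by apply: Ns; lia.
  by case: eqP => // _; apply: Ns; lia.
- move=> j jl; have [ji|[ji|ji]] : (j < i)%N \/ j = i \/ (i < j)%N by lia.
  + by rewrite (ltnW ji) ji; apply: Nc; lia.
  + rewrite ji leqnn ltnn eqxx; split=> // h'; apply: h1.
    by apply/seteqP.
  + rewrite leqNgt ji /= (leqNgt j.+1) (ltn_trans ji (ltnSn j)) /= eqSS (gtn_eqF ji).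
    case: eqP => [->|ne] /=; last by case: j ji jl ne => // j *; apply: Nc; lia.
    by split=> // h'; apply: h2; apply/seteqP.
Qed.

End FiniteLength.

(** * Mixed tensors *)

HB.lock Definition extend (C : fieldType) (K : choiceType) (U : lmodType C)
    (phi : K -> U) (v : {malg C[K]}) : U := \sum_(k <- msupp v) v@_k *: phi k.

Section FreeMaps.
Variables (C : fieldType) (K : choiceType).
Local Notation T := {malg C[K]}.

Section Extension.
Variable U : lmodType C.

Lemma extendEw (D : {fset K}) (phi : K -> U) (v : T) :
  fsubset (msupp v) D -> extend phi v = \sum_(k <- D) v@_k *: phi k.
Proof.
move=> vD; rewrite extend.unlock; apply: big_fset_incl => // k _ /mcoeff_outdom ->.
by rewrite scale0r.
Qed.

Lemma extend_linear (phi : K -> U) : linear (extend phi).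
Proof.
move=> c x y.
pose D := fsetU (msupp (c *: x + y)) (fsetU (msupp x) (msupp y)).
rewrite !(@extendEw D) /D.
- rewrite scaler_sumr -big_split; apply: eq_bigr => k _.
  by rewrite mcoeff_lin scalerDl scalerA.
- by apply/fsubsetP => k; rewrite !in_fsetU => ->; rewrite !orbT.
- by apply/fsubsetP => k; rewrite !in_fsetU => ->; rewrite !orbT.
- by apply/fsubsetP => k; rewrite !in_fsetU => ->.
Qed.

Lemma extend_basis (phi : K -> U) k : extend phi << k >> = phi k.
Proof. by rewrite extend.unlock msuppU oner_eq0 big_seq_fset1 mcoeffUU scale1r. Qed.

End Extension.

Definition supported (Q : K -> Prop) : set T := [set v | forall k, v@_k != 0 -> Q k].

Lemma supported_subspace Q : subspace (supported Q).
Proof.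
split=> [k|c u v hu hv k]; first by rewrite mcoeff0 eqxx.
rewrite mcoeff_lin => h; have [E|] := eqVneq (u@_k) 0; last exact: hu.
by apply: hv; move: h; rewrite E mulr0 add0r.
Qed.

Lemma supported_basis (Q : K -> Prop) k : Q k -> supported Q << k >>.
Proof. by move=> Qk j; rewrite mcoeffU; have [<-|] := eqVneq k j; rewrite ?eqxx. Qed.

Lemma supported_map (U : lmodType C) (Q : K -> Prop) (f : T -> U) (N : set U) v :
  linear f -> subspace N -> (forall k, Q k -> N (f << k >>)) -> supported Q v -> N (f v).
Proof.
move=> fl sN h Qv; rewrite (malg_basis v) linear_fun_sum //.
apply: subspace_sum_seq => // k; rewrite -mcoeff_neq0 => /Qv Qk.
by rewrite linear_funZ //; apply: subspaceZ => //; apply: h.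
Qed.

Lemma supported_eq (U : lmodType C) (Q : K -> Prop) (f g : T -> U) v :
  linear f -> linear g -> (forall k, Q k -> f << k >> = g << k >>) ->
  supported Q v -> f v = g v.
Proof.
move=> fl gl h Qv; rewrite (malg_basis v) !linear_fun_sum //.
rewrite !big_seq; apply: eq_bigr => k; rewrite -mcoeff_neq0 => /Qv Qk.
by rewrite !linear_funZ // h.
Qed.

Lemma supportedW (Q Q' : K -> Prop) v :
  (forall k, Q k -> Q' k) -> supported Q v -> supported Q' v.
Proof. by move=> h hv k /hv /h. Qed.

End FreeMaps.

Lemma bool_neq (x y : bool) : x != y -> x = ~~ y.
Proof. by case: x y => [] []. Qed.

Section SumLinear.
Variables (C : fieldType) (U V : lmodType C).
Lemma linear_sum_fun (J : Type) (l : seq J) (P : pred J) (f : J -> U -> V) :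
  (forall j, linear (f j)) -> linear (fun v => \sum_(j <- l | P j) f j v).
Proof.
move=> fl c x y; rewrite scaler_sumr -big_split; apply: eq_bigr => j _.
exact: fl.
Qed.
End SumLinear.

Section MixedTensors.
Variables (C : numFieldType) (S : finType) (co : S -> bool).
Local Notation K := {ffun S -> option nat}.
Local Notation T := {malg C[K]}.
Implicit Types (k : K) (s t u : S) (v : T) (a b r : nat) (x y : option nat).

(** The basis element k of T has the vector e_x in the covariant slot s with
    k s = Some x, the covector f_x in the contravariant slot s with k s = Some x, and
    nothing in the slots with k s = None.  Contractions empty two slots, so they map
    T to itself. *)
Definition upd k s (x : option nat) : K := [ffun t => if t == s then x else k t].

Lemma updE k s x : upd k s x s = x.
Proof. by rewrite ffunE eqxx. Qed.

Lemma upd_neq k s x t : t != s -> upd k s x t = k t.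
Proof. by rewrite ffunE => /negPf ->. Qed.

Lemma updC k s t x y : s != t -> upd (upd k s x) t y = upd (upd k t y) s x.
Proof.
move=> st; have ts : (t == s) = false by rewrite eq_sym; apply/negbTE.
by apply/ffunP => u; rewrite !ffunE; have [->|_] := eqVneq u t; rewrite ?ts.
Qed.

Lemma upd_upd k s x y : upd (upd k s x) s y = upd k s y.
Proof. by apply/ffunP => u; rewrite !ffunE; case: eqP. Qed.

Lemma upd_id k s : upd k s (k s) = k.
Proof. by apply/ffunP => u; rewrite !ffunE; case: eqP => [->|]. Qed.

(** The matrix unit E_ab of gl(oo) acts as a derivation: it sends e_b to e_a in the
    covariant slots and f_a to - f_b in the contravariant ones.  [move_idx c x y] is
    the one of E_xy and E_yx that replaces x by y in the slots of variance c, and y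
    by x in the other ones. *)
Definition move_term (c : bool) (x y : nat) k s : T :=
  if co s == c then if k s == Some x then << upd k s (Some y) >> else 0
  else if k s == Some y then - << upd k s (Some x) >> else 0.

Definition move_idx (c : bool) (x y : nat) : T -> T :=
  extend (fun k => \sum_s (-1) ^+ (~~ c) *: move_term c x y k s).

Definition gl_op (o : nat * nat) : T -> T := move_idx true o.2 o.1.

Lemma gl_op_linear o : linear (gl_op o). Proof. exact: extend_linear. Qed.

Lemma move_idx_basis c (x y : nat) k :
  move_idx c x y << k >> = \sum_s (-1) ^+ (~~ c) *: move_term c x y k s.
Proof. exact: extend_basis. Qed.

Lemma move_idx_gl c (x y : nat) : move_idx c x y = gl_op (if c then (y, x) else (x, y)).
Proof.
case: c; [by []|]; apply: malg_linear_ext => [||k]; [exact: extend_linear..|].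
rewrite /gl_op /= 2!move_idx_basis; apply: eq_bigr => s _.
rewrite /move_term expr0 expr1 scaleN1r scale1r.
by case: (co s) => /=; case: ifP => _; rewrite ?opprK ?oppr0.
Qed.

(** A contraction is nonzero only on equal indices, and empties both slots. *)
Definition contract_basis s t k : T :=
  if (k s == k t) && (k s != None) then << upd (upd k s None) t None >> else 0.

Definition contract s t : T -> T := extend (contract_basis s t).

Lemma contract_linear s t : linear (contract s t). Proof. exact: extend_linear. Qed.

(** The two terms in which E_ab changes a contracted slot cancel. *)
Lemma contract_equivariant s t o v : co s -> ~~ co t ->
  contract s t (gl_op o v) = gl_op o (contract s t v).
Proof.
move=> cs ct; have st : s != t by apply: contraNneq ct => <-.
have ts : t != s by rewrite eq_sym.
apply: (supported_eq (Q := fun=> True) (f := contract s t \o gl_op o)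
  (g := gl_op o \o contract s t)) => //.
- exact: linear_comp (gl_op_linear o) (contract_linear s t).
- exact: linear_comp (contract_linear s t) (gl_op_linear o).
move=> k _; case: o => a b; rewrite /gl_op /= move_idx_basis /contract extend_basis.
rewrite (linear_fun_sum _ _ _ (extend_linear _)).
under eq_bigr do rewrite expr0 scale1r.
have ext0 (V : lmodType C) (phi : K -> V) : extend phi 0 = 0.
  exact: linear_fun0 (extend_linear phi).
pose k0 := upd (upd k s None) t None.
have other u : u != s -> u != t ->
    extend (contract_basis s t) (move_term true b a k u) =
    if (k s == k t) && (k s != None) then move_term true b a k0 u else 0.
  move=> us ut; rewrite /move_term.
  have k0u : k0 u = k u by rewrite /k0 !upd_neq.
  have cb z : contract_basis s t (upd k u z) =
      if (k s == k t) && (k s != None) then << upd k0 u z >> else 0.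
    rewrite /contract_basis !(@upd_neq k u) ?[s == u]eq_sym ?[t == u]eq_sym //.
    by rewrite /k0 (updC _ _ _ us) (updC _ _ _ ut).
  rewrite k0u; case: (co u) => /=.
    by case: ifP => _; rewrite ?ext0 ?if_same // extend_basis cb.
  case: ifP => _; rewrite ?ext0 ?if_same // (linear_funN _ (extend_linear _)).
  by rewrite extend_basis cb; case: ifP; rewrite ?oppr0.
rewrite (bigD1 s) //= (bigD1 t) //= addrA.
have -> : extend (contract_basis s t) (move_term true b a k s) +
    extend (contract_basis s t) (move_term true b a k t) = 0.
  rewrite /move_term cs (negPf ct) /=.
  have -> : extend (contract_basis s t)
      (if k s == Some b then << upd k s (Some a) >> else 0) =
      if (k s == Some b) && (k t == Some a) then << k0 >> else 0.
    case: (k s == Some b) => /=; last exact: ext0.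
    rewrite extend_basis /contract_basis updE upd_neq // eq_sym andbT upd_upd.
    by [].
  have -> : extend (contract_basis s t)
      (if k t == Some a then - << upd k t (Some b) >> else 0) =
      if (k s == Some b) && (k t == Some a) then - << k0 >> else 0.
    rewrite andbC; case: (k t == Some a) => /=; last exact: ext0.
    rewrite (linear_funN _ (extend_linear _)) extend_basis /contract_basis.
    rewrite updE upd_neq //; case: eqP => [->|_] /=; last by rewrite oppr0.
    by rewrite (updC _ _ _ ts) upd_upd /k0.
  by case: ifP => _; rewrite ?addr0 ?subrr.
rewrite add0r; under eq_bigr => u /andP[us ut] do rewrite other //.
rewrite /contract_basis; case: ifP => _; last by rewrite big1 //; apply/esym/(linear_fun0 (extend_linear _)).
rewrite move_idx_basis -/k0 [RHS](bigD1 s) //= [X in _ + X](bigD1 t) //=.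
rewrite /move_term cs (negPf ct) /= {1}/k0 (upd_neq _ _ st) updE /= scaler0 add0r.
rewrite {1}/k0 updE /= scaler0 add0r.
by apply: eq_bigr => u _; rewrite expr0 scale1r.
Qed.

Definition fresh b k : Prop := forall s, k s != Some b.
Definition low r x : bool := if x is Some z then (z < r)%N else false.
Definition low_slots c r k : {set S} := [set s | (co s == c) && low r (k s)].

(** What the contraction of the slots s and u leaves behind when the index b is
    put into both. *)
Definition pair_term c r b s u k : T :=
  if [&& co s == c, co u != c, low r (k s) & k u == k s]
  then << upd (upd k s (Some b)) u (Some b) >> else 0.

Lemma move_fresh c a b k : fresh b k ->
  move_idx c a b << k >> =
  (-1) ^+ (~~ c) *: \sum_s (if (co s == c) && (k s == Some a)
                            then << upd k s (Some b) >> else 0).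
Proof.
move=> fb; rewrite move_idx_basis scaler_sumr; apply: eq_bigr => s _.
by rewrite /move_term (negPf (fb s)); case: eqP.
Qed.

Lemma move_back c a b k s : fresh b k -> a != b -> co s == c -> k s = Some a ->
  move_idx c b a << upd k s (Some b) >> =
  (-1) ^+ (~~ c) *: (<< k >> - \sum_u (if (co u != c) && (k u == k s)
     then << upd (upd k s (Some b)) u (Some b) >> else 0)).
Proof.
move=> fb ab cs ks; rewrite move_idx_basis -scaler_sumr; congr (_ *: _).
pose F u := if (co u != c) && (k u == k s)
  then << upd (upd k s (Some b)) u (Some b) >> else 0 : T.
rewrite (bigD1 s) //=.
have -> : \sum_u (if (co u != c) && (k u == k s)
    then << upd (upd k s (Some b)) u (Some b) >> else 0) = \sum_(u | u != s) F u.
  by rewrite (bigD1 s) //= {1}cs /= add0r.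
rewrite -sumrN.
have -> : move_term c b a (upd k s (Some b)) s = << k >>.
  by rewrite /move_term cs updE eqxx upd_upd -ks upd_id.
congr (_ + _).
apply: eq_bigr => u us; rewrite /F /move_term !upd_neq // (negPf (fb u)) ks.
by case: (co u == c) => /=; [rewrite oppr0|case: ifP => _; rewrite ?oppr0].
Qed.

Lemma sum_low r x (Z : T) :
  \sum_(a < r) (if x == Some (val a) then Z else 0) = if low r x then Z else 0.
Proof.
case: x => [z|] /=; last by rewrite big1.
case: ltnP => zr; last first.
  by rewrite big1 // => a _; case: eqP => // -[E]; move: (ltn_ord a); rewrite -E ltnNge zr.
rewrite (bigD1 (Ordinal zr)) //= eqxx big1 ?addr0 // => a az.
case: eqP => // -[E]; case/negP: az; apply/eqP/val_inj; exact: esym.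
Qed.

(** Moving an index to a fresh value b and back counts the slots holding a small
    index, up to terms built from contractions. *)
Lemma move_round_trip c r b k : (r <= b)%N -> fresh b k ->
  \sum_(a < r) move_idx c b a (move_idx c a b << k >>) =
  #|low_slots c r k|%:R *: << k >> - \sum_s \sum_u pair_term c r b s u k.
Proof.
move=> rb fb; have ml c' (x y : nat) : linear (move_idx c' x y) by exact: extend_linear.
pose Z s : T := << k >> - \sum_u (if (co u != c) && (k u == k s)
     then << upd (upd k s (Some b)) u (Some b) >> else 0).
transitivity (\sum_(a < r) \sum_s if (co s == c) && (k s == Some (val a)) then Z s else 0).
  apply: eq_bigr => a _; rewrite move_fresh // (linear_funZ _ _ (ml _ _ _)).
  rewrite (linear_fun_sum _ _ _ (ml _ _ _)) scaler_sumr; apply: eq_bigr => s _.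
  case: ifP => [/andP[cs /eqP ks]|_]; last by rewrite (linear_fun0 (ml _ _ _)) scaler0.
  rewrite (move_back fb _ cs ks) ?scalerA -?signr_addb ?addbb ?expr0 ?scale1r //.
  by rewrite neq_ltn (leq_trans (ltn_ord a) rb).
rewrite exchange_big /=.
have -> : (#|low_slots c r k|%:R : C) *: (<< k >> : T) =
    \sum_s (if (co s == c) && low r (k s) then (<< k >> : T) else 0).
  rewrite -sum1_card natr_sum scaler_suml big_mkcond /=.
  apply: eq_bigr => s _; rewrite inE; case: ifP => _; rewrite ?scale1r //.
rewrite -sumrB; apply: eq_bigr => s _.
rewrite /pair_term; case: (co s == c) => /=; last by rewrite !big1 ?subr0.
rewrite sum_low; case: (low r (k s)) => /=; last first.
  by rewrite big1 ?subr0 // => u _; rewrite andbF.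
by [].
Qed.

(** If the contractions vanish, p v is recovered from vectors in which one small index
    has been replaced by b. *)
Lemma raise_lower c r b p v : (r <= b)%N ->
  supported (fun k => fresh b k /\ #|low_slots c r k| = p) v ->
  (forall s u, extend (pair_term c r b s u) v = 0) ->
  \sum_(a < r) move_idx c b a (move_idx c a b v) = p%:R *: v.
Proof.
move=> rb hv hp.
have ml c' (x y : nat) : linear (move_idx c' x y) by exact: extend_linear.
transitivity (p%:R *: v - \sum_s \sum_u extend (pair_term c r b s u) v); last first.
  by rewrite big1 ?subr0 // => s _; rewrite big1.
apply: (supported_eq (f := fun v => \sum_(a < r) move_idx c b a (move_idx c a b v))
  (g := fun v => p%:R *: v - \sum_s \sum_u extend (pair_term c r b s u) v)) hv.
- by apply: linear_sum_fun => a; apply: (linear_comp (ml _ _ _) (ml _ _ _)).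
- have L : linear (fun v => \sum_s \sum_u extend (pair_term c r b s u) v).
    by do 2! apply: linear_sum_fun => ?; apply: extend_linear.
  move=> x y z; rewrite L !scalerDr scalerN !scalerA [x * _]mulrC opprD.
  by rewrite addrACA.
move=> k [fb <-]; rewrite move_round_trip //; congr (_ - _).
by apply: eq_bigr => s _; apply: eq_bigr => u _; rewrite extend_basis.
Qed.

Definition active k : {set S} := [set s | k s != None].
Definition active_part (A : {set S}) : set T := supported (fun k => active k = A).

Lemma active_upd k s (x y : nat) : k s = Some x -> active (upd k s (Some y)) = active k.
Proof.
move=> ks; apply/setP => t; rewrite !inE ffunE.
by case: (t =P s) => [->|//]; rewrite ks.
Qed.

Lemma active_part_stable A : stable gl_op (active_part A).
Proof.
split=> [|o v]; first exact: supported_subspace.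
apply: supported_map; [exact: gl_op_linear|exact: supported_subspace|] => k kA.
rewrite /gl_op move_idx_basis; apply: subspace_sum => [|s _].
  exact: supported_subspace.
have sp := @supported_subspace C K (fun k => active k = A).
apply: (subspaceZ _ sp); rewrite /move_term.
have [h0 _] := sp; case: (_ == true); case: eqP => [ks|//].
  by apply: supported_basis; rewrite (active_upd _ ks).
by apply: (subspaceN sp); apply: supported_basis; rewrite (active_upd _ ks).
Qed.

Lemma contract_active A s t v : active_part A v ->
  active_part (A :\ s :\ t) (contract s t v).
Proof.
apply: supported_map; [exact: contract_linear|exact: supported_subspace|] => k kA.
rewrite /contract extend_basis /contract_basis; case: ifP => _; last first.
  by have [] := @supported_subspace C K (fun k => active k = A :\ s :\ t).
apply: supported_basis; apply/setP => u; rewrite !inE !ffunE -kA inE.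
by case: (u == t); case: (u == s).
Qed.

Section Window.
Variables (A : {set S}) (N N' : set T) (r : nat).
Hypotheses (Ns : stable gl_op N) (Ns' : stable gl_op N').
Hypothesis NA : N' `<=` active_part A.
Hypothesis traceless : forall v s t, N' v -> co s -> ~~ co t -> s \in A -> t \in A ->
  contract s t v = 0.
Hypothesis window : forall v, N' v ->
  supported (fun k => forall s z, k s = Some z -> (r <= z < r + #|S|)%N) v -> N v.

(** The indices in the slots of variance c are being moved one by one from [0, r[
    to fresh values: the next one is b, and p of them remain. *)
Definition moving c b p k : Prop :=
  [/\ active k = A,
      forall s z, k s = Some z -> co s = c -> (z < b)%N,
      forall s z, k s = Some z -> co s = ~~ c -> if c then (z < r)%N else (r <= z < b)%N &
      #|low_slots c r k| = p].

Lemma moving_fresh c b p k : (r <= b)%N -> moving c b p k -> fresh b k.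
Proof.
move=> rb [_ h1 h2 _] s; apply/eqP => ks; have [E|ne] := eqVneq (co s) c.
  by have := h1 s b ks E; rewrite ltnn.
have /(h2 s b ks) := bool_neq ne.
by case: c {h1 h2 ne} => [|/andP[_]]; [rewrite ltnNge rb|rewrite ltnn].
Qed.

Lemma moving_upd c b p k s (a : nat) : (r <= b)%N -> (a < r)%N -> moving c b p.+1 k ->
  co s = c -> k s = Some a -> moving c b.+1 p (upd k s (Some b)).
Proof.
move=> rb ar [hA h1 h2 hp] cs ks; split.
- by rewrite (active_upd _ ks).
- move=> u z; rewrite ffunE; case: (u =P s) => [_ [<-] //|_ ku /h1 h].
  by rewrite ltnW // ltnS; apply: h.
- move=> u z; rewrite ffunE; case: (u =P s) => [->|_ ku /h2 h].
    by rewrite cs => _; case: c {h1 h2 hp cs}.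
  have := h z ku; case: c {h1 h2 h hp cs} => // /andP[-> /= zb].
  exact: ltnW.
- have sl : s \in low_slots c r k by rewrite inE cs eqxx ks /= ar.
  have -> : low_slots c r (upd k s (Some b)) = low_slots c r k :\ s.
    apply/setP => u; rewrite !inE ffunE; case: (u =P s) => [->|_] //=.
    by rewrite ltnNge rb andbF.
  by move: hp; rewrite (cardsD1 s) sl add1n => -[].
Qed.

(** A contraction of small indices vanishes: while covariant indices are moved it is
    a contraction of v, afterwards no covariant index is small. *)
Lemma moving_traceless c b p s u v : N' v -> supported (moving c b p) v ->
  extend (pair_term c r b s u) v = 0.
Proof.
move=> Nv hv; have ins_linear := extend_linear (fun k =>
  << upd (upd k s (Some b)) u (Some b) >> : T).
have [good|bad] := boolP [&& c, co s, ~~ co u, s \in A & u \in A].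
  move: good => /and5P[c1 cs cu sA uA]; have us : u != s by apply: contraNneq cu => ->.
  have su : s != u by rewrite eq_sym.
  transitivity (extend (fun k => << upd (upd k s (Some b)) u (Some b) >> : T)
    (contract s u v)).
    apply: (supported_eq (Q := moving c b p) (f := extend (pair_term c r b s u))
      (g := extend (fun k => << upd (upd k s (Some b)) u (Some b) >> : T) \o contract s u)) hv.
    - exact: extend_linear.
    - exact: linear_comp (contract_linear s u) ins_linear.
    move=> k [_ _ h2 _]; rewrite /= /contract !extend_basis /contract_basis /pair_term.
    rewrite c1 cs (negPf cu) /= [k u == k s]eq_sym; rewrite c1 in h2.
    case: (eqVneq (k s) (k u)) => [E|]; last by rewrite andbF (linear_fun0 ins_linear).
    rewrite andbT /=; case ks : (k s) => [z|] /=; last by rewrite (linear_fun0 ins_linear).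
    rewrite (h2 u z) ?extend_basis -?E ?ks //; last exact/negbTE.
    by rewrite (updC (upd k s None) None (Some b) us) !upd_upd.
  by rewrite (traceless Nv) // (linear_fun0 ins_linear).
apply: (supported_eq (f := extend (pair_term c r b s u)) (g := fun=> 0)) hv.
- exact: extend_linear.
- exact: linear_0.
move=> k [kA _ h2 _]; rewrite extend_basis /pair_term.
case: ifP => // /and4P[/eqP cs cu lo /eqP E]; case: notF.
have ex : exists z, k s = Some z by case: (k s) lo => // z _; exists z.
have [z ks] := ex; have ku : k u = Some z by rewrite E.
have cu' := bool_neq cu.
have := h2 u z ku cu'; move: lo; rewrite ks /=.
case: c cs {cu h2} cu' bad => cs cu'; last by move=> _ zr /andP[]; rewrite leqNgt zr.
by rewrite cs cu' -!kA !inE ks ku.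
Qed.

Lemma moving_step c p b v : (r <= b)%N -> N' v -> supported (moving c b p.+1) v ->
  (forall v', N' v' -> supported (moving c b.+1 p) v' -> N v') -> N v.
Proof.
move=> rb Nv hv IH; have [sN opN] := Ns; have [sN' opN'] := Ns'.
have h : \sum_(a < r) move_idx c b a (move_idx c a b v) = p.+1%:R *: v.
  apply: raise_lower => //.
    by apply: supportedW hv => k hk; split; [exact: moving_fresh hk|case: hk].
  by move=> s u; apply: moving_traceless hv.
have -> : v = p.+1%:R^-1 *: (p.+1%:R *: v).
  by rewrite scalerA mulVf ?scale1r // pnatr_eq0.
apply: subspaceZ => //; rewrite -h; apply: subspace_sum => // a _.
rewrite move_idx_gl; apply: opN; apply: IH; first by rewrite move_idx_gl; apply: opN'.
apply: supported_map hv; [exact: extend_linear|exact: supported_subspace|] => k hk.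
rewrite (move_fresh _ _ (moving_fresh rb hk)).
have sp := @supported_subspace C K (moving c b.+1 p).
apply: (subspaceZ _ sp); apply: subspace_sum => [|s _]; first exact: sp.
have [h0 _] := sp; case: ifP => [/andP[/eqP cs /eqP ks]|//].
by apply: supported_basis; apply: moving_upd hk cs ks.
Qed.

Lemma moving_all c q :
  (forall b v, (r <= b)%N -> (b + q <= r + #|S|)%N -> N' v ->
     supported (moving c b 0) v -> N v) ->
  forall p b v, (r <= b)%N -> (b + p + q <= r + #|S|)%N -> N' v ->
    supported (moving c b p) v -> N v.
Proof.
move=> h0; elim=> [|p IH] b v rb bp Nv hv; first by apply: (h0 b) => //; lia.
by apply: (moving_step rb Nv hv) => v'; apply: IH; lia.
Qed.

(** First the covariant and then the contravariant indices are moved into the window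
    [r, r + #|S|[, where N' is contained in N. *)
Lemma window_determines v : N' v ->
  supported (fun k => forall s z, k s = Some z -> (z < r)%N) v -> N v.
Proof.
pose q := #|[set u in A | ~~ co u]|; pose p := #|[set u in A | co u]|.
have pq : (p + q <= #|S|)%N.
  rewrite -leq_subRL ?max_card // /p /q -[X in (_ <= X - _)%N](cardsC [set u in A | co u]).
  rewrite addKn; apply: subset_leq_card; apply/fintype.subsetP => u.
  by rewrite !inE => /andP[-> /negPf ->].
have second : forall p b v, (r <= b)%N -> (b + p + 0 <= r + #|S|)%N -> N' v ->
    supported (moving false b p) v -> N v.
  apply: moving_all => b w rb bS Nw hw; apply: window => //.
  apply: supportedW hw => k [_ h1 h2 /eqP]; rewrite cards_eq0 => /eqP h3 s z ks.
  have [cs|/negbTE cs] := boolP (co s).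
    by have /andP[-> /leq_trans ->] := h2 s z ks cs; rewrite // -[b]addn0.
  have := h1 s z ks cs => zb; have /setP/(_ s) := h3; rewrite !inE cs ks /= => /negbT.
  by rewrite -leqNgt => -> /=; apply: leq_trans zb _; rewrite -[b]addn0.
have first : forall p b v, (r <= b)%N -> (b + p + q <= r + #|S|)%N -> N' v ->
    supported (moving true b p) v -> N v.
  apply: moving_all => b w rb bS Nw hw; apply: (second q b) => //; first by rewrite addn0.
  apply: supportedW hw => k [kA h1 h2 /eqP]; rewrite cards_eq0 => /eqP h3; split=> //.
  - by move=> s z ks cs; apply: leq_trans rb; apply: h2 ks cs.
  - move=> s z ks cs; rewrite (h1 s z ks cs) andbT leqNgt; apply/negP => zr.
    by have /setP/(_ s) := h3; rewrite !inE cs ks /= zr.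
  - rewrite /q; congr #|pred_of_set _|; apply/setP => s; rewrite !inE -kA inE.
    case cs : (co s); rewrite ?andbF //= andbT; case ks : (k s) => [z|] //=.
    exact: h2 ks cs.
move=> Nv hv; apply: (first p r v) => //; first by rewrite -addnA leq_add2l.
move=> k kv; have kA := NA Nv kv; have kr := hv k kv; split=> //.
- by move=> s z ks _; apply: kr ks.
- by move=> s z ks _; apply: kr ks.
- rewrite /p; congr #|pred_of_set _|; apply/setP => s; rewrite !inE -kA inE eqb_id andbC.
  by case ks : (k s) => [z|] //=; rewrite (kr s z ks).
Qed.

End Window.

Lemma values_bound v : exists r, supported (fun k => forall s z, k s = Some z -> (z < r)%N) v.
Proof.
exists (\max_(k <- msupp v) \max_s (odflt 0%N (k s)).+1) => k.
rewrite mcoeff_neq0 => kv s z ks.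
pose F k := \max_s (odflt 0%N (k s)).+1.
have h1 : (F k <= \max_(k <- msupp v) F k)%N by apply: leq_bigmax_seq kv _.
apply: leq_trans h1; have := leq_bigmax (F := fun s => (odflt 0%N (k s)).+1) s.
by rewrite ks.
Qed.

Lemma values_boundW v r r' : (r <= r')%N ->
  supported (fun k => forall s z, k s = Some z -> (z < r)%N) v ->
  supported (fun k => forall s z, k s = Some z -> (z < r')%N) v.
Proof. by move=> rr; apply: supportedW => k h s z /h zr; apply: leq_trans rr. Qed.

Definition shifted r (j : {ffun S -> option 'I_#|S|}) : K :=
  [ffun s => omap (fun i : 'I_#|S| => (r + i)%N) (j s)].

Definition window_span r : set T :=
  [set v | exists x : {ffun S -> option 'I_#|S|} -> C, v = \sum_j x j *: << shifted r j >>].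

Lemma window_span_subspace r : subspace (window_span r).
Proof.
split; first by exists (fun=> 0); rewrite big1 // => j _; rewrite scale0r.
move=> c _ _ [x ->] [y ->]; exists (fun j => c * x j + y j).
rewrite scaler_sumr -big_split; apply: eq_bigr => j _.
by rewrite scalerDl scalerA.
Qed.

Lemma supported_window r v :
  supported (fun k => forall s z, k s = Some z -> (r <= z < r + #|S|)%N) v ->
  window_span r v.
Proof.
apply: (supported_map (f := id)); [by []|exact: window_span_subspace|] => k hk.
pose j : {ffun S -> option 'I_#|S|} := [ffun s => if k s is Some z then insub (z - r)%N else None].
have -> : k = shifted r j.
  apply/ffunP => s; rewrite !ffunE; case ks : (k s) => [z|] //.
  have /andP[rz zr] := hk s z ks.
  have zr' : (z - r < #|S|)%N by lia.
  by rewrite insubT /= subnKC.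
exists (fun i => (i == j)%:R); rewrite (bigD1 j) //= eqxx scale1r big1 ?addr0 //.
by move=> i /negPf ->; rewrite scale0r.
Qed.

Definition traceless_part (A : {set S}) (l : seq (S * S)) : set T :=
  [set v | active_part A v /\ forall p, p \in l -> contract p.1 p.2 v = 0].

Definition valid_pair (A : {set S}) (p : S * S) : bool :=
  [&& co p.1, ~~ co p.2, p.1 \in A & p.2 \in A].

(** A traceless stable subspace is determined by its vectors with indices in a window
    of #|S| consecutive values, a space whose dimension does not depend on the
    window; the window is placed above all indices that occur in the chain. *)
Lemma bounded_traceless A :
  bounded (stable_in gl_op (traceless_part A [seq p <- enum {: S * S} | valid_pair A p]))
    #|{ffun S -> option 'I_#|S|}|.
Proof.
move=> N sN cN n.
have [r hr] : exists r, forall i, (i < n)%N -> N i <> N i.+1 -> exists v,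
    [/\ N i.+1 v, ~ N i v & supported (fun k => forall s z, k s = Some z -> (z < r)%N) v].
  elim: n => [|n [r IH]]; first by exists 0%N.
  have [E|nE] := EM (N n = N n.+1).
    exists r => i; rewrite ltnS leq_eqVlt => /orP[/eqP ->|/IH //].
    by rewrite E.
  have [v [Nv nNv]] : exists v, N n.+1 v /\ ~ N n v.
    apply: contrapT => h; apply: nE; apply/seteqP; split; first exact: cN.
    by move=> v Nv; apply: contrapT => nNv; apply: h; exists v.
  have [r' hr'] := values_bound v; exists (maxn r r') => i.
  rewrite ltnS leq_eqVlt => /orP[/eqP ->|/IH h] Ni.
    by exists v; split=> //; apply: values_boundW hr'; apply: leq_maxr.
  have [w [h1 h2 h3]] := h Ni; exists w; split=> //.
  by apply: values_boundW h3; apply: leq_maxl.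
have h : (jumps N n <= \sum_(j : unit) jumps (fun i => N i `&` window_span r) n)%N.
  apply: jumps_detect => i ni Ei; apply: contrapT => Ni.
  have [v [Nv nNv hv]] := hr i ni Ni; apply: nNv.
  have [sNi _] := sN i; have [sNi' Ni'] := sN i.+1.
  apply: (window_determines (A := A) (N' := N i.+1) (r := r)) => //.
  - by move=> w /Ni'[].
  - move=> w s t /Ni'[_ hw] cs ct sA tA; apply: (hw (s, t)).
    by rewrite mem_filter /valid_pair /= cs ct sA tA mem_enum.
  - move=> w Nw /supported_window hw.
    by have [] : (N i `&` window_span r) w by rewrite (Ei tt); split.
apply: leq_trans h _; rewrite (bigD1 tt) //= big1 ?addn0; last by case.
apply: (bounded_span (w := fun j => << shifted r j >> : T)) => i.
  split; last by move=> v [].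
  by have [[sNi _] _] := sN i; apply: subspaceI sNi (window_span_subspace r).
by move=> v [/(cN i) Nv hv]; split.
Qed.

(** Contractions are equivariant and lower the number of active slots, which allows an
    induction on this number; their common kernel is treated by the previous lemma. *)
Theorem mixed_tensors_bounded A : exists b, bounded (stable_in gl_op (active_part A)) b.
Proof.
have [n] := ubnP #|A|; elim: n A => // n IH A An.
have step l : (forall p, p \in l -> valid_pair A p) ->
    (exists b, bounded (stable_in gl_op (traceless_part A l)) b) ->
    exists b, bounded (stable_in gl_op (active_part A)) b.
  elim: l => [|[s t] l IHl] hl [b hb].
    by exists b; apply: boundedW hb => N [sN NA]; split=> // v /NA.
  have /and4P[/= cs ct sA tA] := hl (s, t) (mem_head _ _).
  apply: IHl => [p pl|]; first by apply: hl; rewrite inE pl orbT.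
  have [b' hb'] : exists b, bounded (stable_in gl_op (active_part (A :\ s :\ t))) b.
    apply: IH; apply: leq_trans (An : (#|A| <= n)%N).
    by rewrite [X in (_ <= X)%N](cardsD1 s A) sA ltnS subset_leq_card // subD1set.
  exists (b + b')%N; apply: (bounded_kernel (phi := contract s t)) hb'.
  - exact: gl_op_linear.
  - exact: contract_linear.
  - by move=> o v; apply: contract_equivariant.
  - by move=> v [hv _]; apply: contract_active.
  - apply: boundedW hb => N [sN NA]; split=> // v /NA [[hv vl] vst]; split=> // p.
    by rewrite inE => /orP[/eqP -> //|/vl].
apply: (step [seq p <- enum {: S * S} | valid_pair A p]).
  by move=> p; rewrite mem_filter => /andP[].
by eexists; apply: bounded_traceless.
Qed.

End MixedTensors.

(** * Modules of finite length lie in category O *)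

Section FinitelyGenerated.
Variables (C : fieldType) (M : qModule C).

Lemma is_submoduleI (L N : set M) : is_submodule L -> is_submodule N ->
  is_submodule (L `&` N).
Proof.
move=> [L0 LP Lc La] [N0 NP Nc Na]; split=> //.
- by move=> c u v [? ?] [? ?]; split; [apply: LP|apply: NP].
- by move=> s v [? ?]; split; [apply: Lc|apply: Nc].
- by move=> X v [? ?]; split; [apply: La|apply: Na].
Qed.

(** One vector outside the previous submodule for each step of a composition series
    generates the module. *)
Lemma finite_length_generated : finite_length M -> finitely_generated M.
Proof.
move=> [l [N [N0 Nl Ns Nq]]].
have [v hv] : exists v : nat -> M, forall i, (i < l)%N -> N i.+1 (v i) /\ ~ N i (v i).
  have ex i : exists w, (i < l)%N -> N i.+1 w /\ ~ N i w.
    have [il|//] := ltnP i l; last by exists 0.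
    have [[_ h] _] := Nq i il.
    apply: contrapT => h'; apply: h => w Nw; apply: contrapT => nw.
    by apply: h'; exists w.
  by exists (fun i => sval (cid (ex i))) => i; apply: (svalP (cid (ex i))).
exists [seq v i | i <- iota 0 l] => L sL Lv.
suff h i : (i <= l)%N -> N i `<=` L.
  by apply/seteqP; split=> // x _; apply: (h l) => //; rewrite Nl.
elim: i => [_ x|i IH il]; first by rewrite N0 => ->; case: sL.
have [[sub _] simp] := Nq i il; have [Nv nNv] := hv i il.
have [||E|E] := simp (L `&` N i.+1) (is_submoduleI sL (Ns _ il)).
- by move=> x Nx; split; [apply: IH => //; apply: ltnW|apply: sub].
- by move=> x [].
- case: nNv; rewrite -E; split=> //; apply: Lv; apply: map_f.
  by rewrite mem_iota.
- by rewrite -E => x [].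
Qed.

End FinitelyGenerated.

Section Weights.
Variables (C : numFieldType) (M : qModule C).

(** The odd part of an even element of the Cartan subalgebra vanishes, so only the
    even generators contribute. *)
Lemma cartan_even_spanned (H : q_infty C) : q_cartan_even H ->
  spanned [set X | exists i, X = gen C false i i] H.
Proof.
pose Ev : set (q_infty C) := spanned [set X | exists i, X = gen C false i i].
have sE : subspace Ev by apply: spanned_subspace.
have Ev_even X : Ev X -> part false X.
  apply: (spanned_sub (part_subspace (q_infty C) false)) => Y [i ->].
  exact: gen_part.
pose D : set (q_infty C) := [set X | exists X0 X1, [/\ X = X0 + X1, Ev X0 & part true X1]].
have sD : subspace D.
  split; first by exists 0, 0; rewrite addr0; split; [|case: sE|exact: part0].
  move=> c _ _ [X0 [X1 [-> h0 h1]]] [Y0 [Y1 [-> k0 k1]]].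
  exists (c *: X0 + Y0), (c *: X1 + Y1); split.
  - by rewrite scalerDr addrACA.
  - by case: sE => _; apply.
  - by have [_ hP] := part_subspace (q_infty C) true; apply: hP.
move=> [Hc Hev]; have [X0 [X1 [E h0 h1]]] : D H.
  apply: (spanned_sub sD) Hc => X [[] [i [j [<- ->]]]].
    exists 0, (gen C true i i); rewrite add0r.
    by split; [|case: sE|exact: gen_part].
  exists (gen C false i i), 0; rewrite addr0; split; [by []| |exact: part0].
  by apply: sub_spanned; exists i.
have X1e : X1 = H - X0 by rewrite E addrC addKr.
suff X10 : X1 = 0 by rewrite E X10 addr0.
apply: (part_direct (s := true)); first exact: h1.
by rewrite X1e; apply: (subspaceB (part_subspace (q_infty C) false)) Hev (Ev_even _ h0).
Qed.

Lemma eigen_weight_vector (m : M) :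
  (forall i, exists a, E false i i m = a *: m) -> weight_vector m.
Proof.
move=> h; have ex H : exists a : C, q_cartan_even H -> act H m = a *: m.
  have [hH|nH] := EM (q_cartan_even H); last by exists 0.
  suff : [set X : q_infty C | exists a, act X m = a *: m] H by move=> [a ha]; exists a.
  apply: (spanned_sub _ _ (cartan_even_spanned hH)) => [|X [i ->]]; last exact: h.
  have L := act_linearl (q := M) m.
  split; first by exists 0; rewrite (linear_fun0 L) scale0r.
  move=> c X Y [a ha] [b hb]; exists (c * a + b).
  by rewrite L ha hb scalerA -scalerDl.
by exists (fun H => sval (cid (ex H))) => H; apply: (svalP (cid (ex H))).
Qed.

Lemma distinct_eigenvectors (X : M -> M) d (a : nat -> C) (w : nat -> M) :
  linear X -> (forall j k, (j < d)%N -> (k < d)%N -> a j = a k -> j = k) ->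
  (forall k, (k < d)%N -> X (w k) = a k *: w k) ->
  \sum_(k < d) w k = 0 -> forall k, (k < d)%N -> w k = 0.
Proof.
move=> Xl; elim: d w => // d IH w inj hw sw.
have wk k : (k < d)%N -> w k = 0.
  move=> kd; have : (a k - a d) *: w k = 0.
    apply: (IH (fun k => (a k - a d) *: w k)) kd.
    - by move=> i j hi hj; apply: inj; apply: ltnW.
    - move=> i hi; rewrite (linear_funZ _ _ Xl) hw 1?ltnW //.
      by rewrite !scalerA mulrC.
    transitivity (X (\sum_(k < d.+1) w k) - a d *: \sum_(k < d.+1) w k).
      rewrite (linear_fun_sum _ _ _ Xl) !big_ord_recr /= (hw d) //.
      rewrite scalerDr opprD addrACA subrr addr0 scaler_sumr -sumrB.
      by apply: eq_bigr => i _; rewrite /= (hw i (ltnW (ltn_ord i))) scalerBl.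
    by rewrite sw (linear_fun0 Xl) scaler0 subr0.
  move/eqP; rewrite scaler_eq0 subr_eq0 => /orP[/eqP h|/eqP //].
  have /eqP := inj k d (ltnW kd) (ltnSn d) h.
  by rewrite (ltn_eqF kd).
move=> k; rewrite ltnS leq_eqVlt => /orP[/eqP ->|]; last exact: wk.
by move: sw; rewrite big_ord_recr /= big1 ?add0r // => i _; apply: wk.
Qed.

Lemma E_diag_comm i j (m : M) :
  E false i i (E false j j m) = E false j j (E false i i m).
Proof.
rewrite E_comm /= expr0 scale1r mul1r; case: eqP => [->|_].
  by rewrite subrr addr0.
by rewrite !scale0r subrr addr0.
Qed.

Lemma invariants_E n (m : M) r i j : invariants (@q_centralizer C n) m ->
  ~ truncation n i -> ~ truncation n j -> E r i j m = 0.
Proof. by move=> hm hi hj; apply: hm; apply: sub_spanned; exists r, i, j. Qed.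

Hypotheses (Mint : integrable M) (Mann : large_annihilator M).

(** The torus elements outside g_n kill m, so the finitely many torus elements of g_n
    have to be diagonalized one after the other; torus elements commute, so the
    components found at each step, which belong to distinct eigenvalues, inherit the
    earlier eigenvalues. *)
Lemma integrable_semisimple : cartan_semisimple M.
Proof.
have step (l : seq zidx) (m : M) : spanned [set u : M |
    (forall i, i \in l -> exists a, E false i i u = a *: u) /\
    (forall j a, E false j j m = a *: m -> E false j j u = a *: u)] m.
  elim: l m => [|i l IH] m; first by apply: sub_spanned; split.
  have [d [K [u [mE hu]]]] := integrable_eigenvectors Mint i m.
  have keep j a k : (k < d)%N -> E false j j m = a *: m -> E false j j (u k) = a *: u k.
    move=> kd hm; have El r k1 k2 := E_linear (C := C) (M := M) r k1 k2.
    apply/eqP; rewrite -subr_eq0; apply/eqP.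
    apply: (distinct_eigenvectors (a := fun k => k%:R - K%:R)
      (w := fun k => E false j j (u k) - a *: u k) (El false i i)) kd.
    - move=> x y _ _ /(congr1 (+%R^~ K%:R)); rewrite !subrK => /eqP.
      by rewrite eqr_nat => /eqP.
    - move=> x xd; rewrite (linear_funB _ _ (El _ _ _)) E_diag_comm hu //.
      by rewrite !(linear_funZ _ _ (El _ _ _)) hu // scalerBr !scalerA [a * _]mulrC.
    by rewrite sumrB -(linear_fun_sum _ _ _ (El _ _ _)) -scaler_sumr -mE hm subrr.
  rewrite [X in spanned _ X]mE; apply: (subspace_sum _ (spanned_subspace _)) => k _.
  apply: (spanned_sub (spanned_subspace _) _ (IH (u k))) => v [v1 v2].
  apply: sub_spanned; split.
    move=> j; rewrite inE => /orP[/eqP ->|]; last exact: v1.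
    by exists (k%:R - K%:R); apply: v2; apply: hu.
  by move=> j a hm; apply: v2; apply: keep.
move=> m; have [n [_ hm]] := Mann m.
apply: (spanned_sub (spanned_subspace _) _ (step [seq zenum k | k <- iota 0 n] m)).
move=> u [u1 u2].
apply: sub_spanned; apply: eigen_weight_vector => i.
have [/truncationP[k [kn ->]]|ti] := EM (truncation n i).
  by apply: u1; apply: map_f; rewrite mem_iota.
exists 0; apply: u2; rewrite scale0r; exact: (invariants_E _ hm ti ti).
Qed.

End Weights.

Section NilpotentWords.
Variables (C : fieldType) (M : lmodType C) (L : eqType).
Variables (op : L -> M -> M) (ht : L -> nat).
Hypothesis op_linear : forall x, linear (op x).
Hypothesis ht_pos : forall x, (0 < ht x)%N.

Definition word (w : seq L) (m : M) : M := foldr op m w.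
Definition height (w : seq L) : nat := \sum_(x <- w) ht x.

Lemma word_linear w : linear (word w).
Proof. by elim: w => [|x w IH] //; exact: (linear_comp IH (op_linear x)). Qed.

Lemma height_size w : (size w <= height w)%N.
Proof.
elim: w => [|x w IH]; first by rewrite /height big_nil.
by rewrite /height big_cons -/(height w) /= -add1n leq_add.
Qed.

Variable letters : seq L.

Hypothesis letters_comm : forall x y m, x \in letters -> y \in letters ->
  exists c : C, spanned [set v | exists z,
    [/\ z \in letters, ht z = (ht x + ht y)%N & v = op z m]]
    (op x (op y m) - c *: op y (op x m)).

Hypothesis letters_nilpotent : forall x m, x \in letters ->
  exists k, iter k (op x) m = 0.

(** Brackets raise the height, so an upward closed set contains the letters that occur
    in brackets of its elements with arbitrary letters. *)
Definition upward (l : seq L) : Prop :=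
  {subset l <= letters} /\
  forall x z, x \in l -> z \in letters -> (ht x < ht z)%N -> z \in l.

Section MoveRight.
Variables (l : seq L) (x : L).
Hypotheses (ul : upward l) (xl : x \in l).
Let l' := [seq y <- l | y != x].

(** The normal form that is reached by moving all letters x to the right. *)
Definition shapes (h : nat) (m : M) : set M := [set v | exists u a,
  [/\ all (mem l') u, (height u + a * ht x)%N = h & v = word u (iter a (op x) m)]].

Lemma shapes_op y h m v : y \in l' -> spanned (shapes h m) v ->
  spanned (shapes (ht y + h) m) (op y v).
Proof.
move=> yl; have sS := spanned_subspace (shapes (ht y + h) m).
apply: (spanned_sub (preimage_subspace (op_linear y) sS)) => _ [u [a [hu <- ->]]] /=.
apply: sub_spanned; exists (y :: u), a; split=> //=; first by rewrite yl.
by rewrite /height big_cons addnA.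
Qed.

Lemma move_right u m : all (mem l') u ->
  spanned [set v | exists u' e, [/\ all (mem l') u', (height u' + e * ht x =
    height u + ht x)%N & v = word u' (iter e (op x) m)]] (op x (word u m)).
Proof.
elim: u => [_|y u IH /= /andP[yl hu]].
  by apply: sub_spanned; exists [::], 1%N; rewrite mul1n.
have [c hc] : exists c : C, spanned [set v | exists z,
    [/\ z \in letters, ht z = (ht x + ht y)%N & v = op z (word u m)]]
    (op x (op y (word u m)) - c *: op y (op x (word u m))).
  apply: letters_comm; first by case: ul => h _; apply: h.
  by case: ul => h _; apply: h; move: yl; rewrite mem_filter => /andP[].
rewrite -[X in spanned _ X](subrK (c *: op y (op x (word u m)))).
set S := [set v | _]; have sS : subspace (spanned S) by apply: spanned_subspace.
apply: subspaceD => //.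
  apply: (spanned_sub sS _ hc) => _ [z [zl hz ->]].
  apply: sub_spanned; exists (z :: u), 0%N; split=> //=.
    rewrite hu andbT mem_filter.
    have lz : (ht x < ht z)%N by rewrite hz -[X in (X < _)%N]addn0 ltn_add2l.
    have [_ h] := ul; rewrite (h x) // andbT.
    by apply: contraTneq lz => ->; rewrite ltnn.
  by rewrite /height !big_cons hz mul0n; lia.
apply: subspaceZ => //.
apply: (spanned_sub (preimage_subspace (op_linear y) sS) _ (IH hu)).
move=> _ [u' [e [hu' he ->]]] /=.
apply: sub_spanned; exists (y :: u'), e; split=> //=; first by rewrite yl.
by rewrite /height !big_cons -/(height u') -/(height u); lia.
Qed.

(** Moving the letter x to the right past the others creates only
    brackets, which are higher; the total height is preserved. *)
Lemma word_shapes w m : all (mem l) w -> spanned (shapes (height w) m) (word w m).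
Proof.
elim: w => [_|y w IH /= /andP[yl hw]].
  by apply: sub_spanned; exists [::], 0%N; rewrite /height big_nil.
rewrite /height big_cons -/(height w).
have [E|yx] := eqVneq y x; last by apply: shapes_op; [rewrite mem_filter yx|exact: IH].
rewrite {}E; set S := shapes _ _; have sS : subspace (spanned S) by apply: spanned_subspace.
apply: (spanned_sub (preimage_subspace (op_linear x) sS) _ (IH hw)).
move=> _ [u [a [hu hh ->]]] /=.
apply: (spanned_sub sS _ (move_right (iter a (op x) m) hu)) => _ [u' [e [hu' he ->]]].
apply: sub_spanned; exists u', (e + a)%N; split=> //; last by rewrite iterD.
by rewrite -hh; lia.
Qed.

Lemma words_vanish_step :
  (forall m, exists K, forall w, all (mem l') w -> (K <= height w)%N -> word w m = 0) ->
  forall m, exists K, forall w, all (mem l) w -> (K <= height w)%N -> word w m = 0.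
Proof.
move=> IH m; have [k hk] : exists k, iter k (op x) m = 0.
  by apply: letters_nilpotent; case: ul => h _; apply: h.
have [K hK] : exists K, forall a w, (a < k)%N -> all (mem l') w ->
    (K <= height w)%N -> word w (iter a (op x) m) = 0.
  elim: k {hk} => [|k [K hK]]; first by exists 0%N.
  have [K' hK'] := IH (iter k (op x) m); exists (K + K')%N => a w.
  rewrite ltnS leq_eqVlt => /orP[/eqP ->|ak] hw Kw; first by apply: hK' => //; lia.
  by apply: hK => //; lia.
exists (K + k * ht x)%N => w hw Kw.
suff : [set (0 : M)] (word w m) by [].
have s0 : subspace [set (0 : M)].
  by split=> // c y z -> ->; rewrite /= scaler0 addr0.
apply: (spanned_sub s0 _ (word_shapes m hw)) => _ [u [a [hu hh ->]]] /=.
have [ak|ka] := ltnP a k; last first.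
  by rewrite (iter_eq0_leq (op_linear x) ka hk) (linear_fun0 (word_linear u)).
apply: hK => //; have : (a * ht x <= k * ht x)%N by rewrite leq_mul2r (ltnW ak) orbT.
by move: Kw hh; lia.
Qed.

End MoveRight.

(** Letters of minimal height are split off one at a time.  Once all letters x are on
    the right, few of them can occur, since x is nilpotent on m, and what precedes
    them is a word of large height in the remaining letters. *)
Lemma words_vanish m : exists K, forall w, all (mem letters) w ->
  (K <= height w)%N -> word w m = 0.
Proof.
have ex_min (l : seq L) y : y \in l -> exists2 x, x \in l & forall z, z \in l -> (ht x <= ht z)%N.
  elim: l y => // z l IH y _; case: l IH => [|t l] IH.
    by exists z; rewrite ?mem_head // => z'; rewrite inE => /eqP ->.
  have [x xl hx] := IH t (mem_head _ _).
  have [zx|xz] := leqP (ht z) (ht x).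
    exists z; rewrite ?mem_head // => z'; rewrite inE => /orP[/eqP -> //|/hx].
    exact: leq_trans.
  exists x; first by rewrite inE xl orbT.
  by move=> z'; rewrite inE => /orP[/eqP ->|/hx //]; apply: ltnW.
suff h n l : (size l <= n)%N -> upward l -> forall m, exists K, forall w,
    all (mem l) w -> (K <= height w)%N -> word w m = 0.
  by apply: (h (size letters)) => //; split.
elim: n l => [|n IH] l sl ul {}m.
  move: sl; rewrite leqn0 size_eq0 => /eqP ->; exists 1%N => -[|//] _.
  by rewrite /height big_nil.
case El : l => [|y l0].
  by exists 1%N => -[|//] _; rewrite /height big_nil.
have yl : y \in l by rewrite El mem_head.
have [x xl xmin] := ex_min l y yl; rewrite -El.
apply: (words_vanish_step ul xl); apply: IH.
  rewrite -ltnS; apply: leq_trans sl.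
  rewrite size_filter ltn_neqAle count_size andbT -all_count.
  by apply/negP => /allP/(_ x xl); rewrite eqxx.
have [lsub lup] := ul; split=> [z|u z]; rewrite !mem_filter.
  by move=> /andP[_ /lsub].
move=> /andP[ux ul'] zl uz; rewrite (lup u) // andbT.
by apply: contraTneq uz => ->; rewrite -leqNgt xmin.
Qed.

End NilpotentWords.

Section LocalNilpotency.
Variables (C : numFieldType) (M : qModule C).
Hypothesis Mint : integrable M.

Definition letter := (bool * zidx * zidx)%type.
Definition E_letter (x : letter) : M -> M := E x.1.1 x.1.2 x.2.

Lemma E_letter_linear x : linear (E_letter x). Proof. exact: E_linear. Qed.

(** The position of an index of absolute value at most B in the order of the
    indices, which starts with 1 and ends with -1. *)
Definition position (B : nat) (i : zidx) : nat :=
  if 0 < val i then `|val i|%N else (B.*2.+1 - `|val i|)%N.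

Lemma prec_position B (i j : zidx) : (`|val i| <= B)%N -> (`|val j| <= B)%N ->
  prec i j = (position B i < position B j)%N.
Proof.
case: i j => i i0 [j j0]; rewrite /prec /position /= => iB jB.
by case: (boolP (0 < i)) => hi; case: (boolP (0 < j)) => hj /=; lia.
Qed.

Lemma odd_root_square i j (m : M) : i != j -> E true i j (E true i j m) = 0.
Proof.
move=> /negPf ij; have := E_comm true i j true i j m.
rewrite /= expr1 [j == i]eq_sym ij mulr0 !scale0r subr0 addr0 scaleN1r => /eqP.
rewrite -subr_eq0 opprK -mulr2n -scaler_nat scaler_eq0 pnatr_eq0 /=.
by move/eqP.
Qed.

(** The root vectors involved in X act nilpotently, so all long words in them vanish. *)
Lemma integrable_locally_nilpotent : locally_nilpotent M (@q_nil C).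
Proof.
move=> X m [n [c [Y [hY XE]]]].
have [x hx] : exists x : 'I_n -> letter, forall t, prec (x t).1.2 (x t).2 /\
    Y t = gen C (x t).1.1 (x t).1.2 (x t).2.
  have ex t : exists x : letter, prec x.1.2 x.2 /\ Y t = gen C x.1.1 x.1.2 x.2.
    by have [r [i [j [pij ->]]]] := hY t; exists (r, i, j).
  by exists (fun t => sval (cid (ex t))) => t; apply: (svalP (cid (ex t))).
pose B := \max_(t < n) maxn `|val (x t).1.2| `|val (x t).2|.
have xB t : (`|val (x t).1.2| <= B)%N /\ (`|val (x t).2| <= B)%N.
  have := leq_bigmax (F := fun t => maxn `|val (x t).1.2| `|val (x t).2|) t.
  by rewrite geq_max => /andP.
pose ht (y : letter) := maxn 1 (position B y.2 - position B y.1.2).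
pose idx := [seq (x t).1.2 | t <- enum 'I_n] ++ [seq (x t).2 | t <- enum 'I_n].
pose letters : seq letter :=
  [seq y <- [seq (y, k) | y <- [seq (r, i) | r <- enum {: bool}, i <- idx], k <- idx]
  | (position B y.1.2 < position B y.2)%N].
have lettersP r i j : ((r, i, j) \in letters) =
    [&& (position B i < position B j)%N, i \in idx & j \in idx].
  rewrite mem_filter /=; congr (_ && _).
  apply/idP/andP => [/allpairsP[[[s k] l] /= [/allpairsP[[s' k'] /= [_ kI [-> ->]]] lI]]|].
    by move=> [_ -> ->].
  move=> [iI jI]; apply/allpairsP; exists ((r, i), j); split=> //=.
  by apply/allpairsP; exists (r, i); split=> //=; rewrite mem_enum.
have hpos y : (0 < ht y)%N by rewrite leq_max.
have comm (y z : letter) (v : M) : y \in letters -> z \in letters ->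
  exists c : C, spanned [set v' | exists u,
    [/\ u \in letters, ht u = (ht y + ht z)%N & v' = E_letter u v]]
    (E_letter y (E_letter z v) - c *: E_letter z (E_letter y v)).
  case: y z => [[r i] j] [[s k] l]; rewrite !lettersP => /and3P[ij iI jI] /and3P[kl kI lI].
  exists ((-1) ^+ (r && s)); rewrite /E_letter /= E_comm addrC addKr.
  set S := [set _ | _]; have sS : subspace (spanned S) by apply: spanned_subspace.
  apply: subspaceB => //.
    case: eqP => [jk|_]; last by rewrite scale0r; case: sS.
    rewrite scale1r; apply: sub_spanned; exists (r (+) s, i, l); split=> //.
      by rewrite lettersP iI lI !andbT; apply: ltn_trans ij _; rewrite jk.
    by rewrite /ht /= -jk in kl *; lia.
  case: eqP => [il|_]; last by rewrite mulr0 scale0r; case: sS.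
  apply: subspaceZ => //; apply: sub_spanned; exists (r (+) s, k, j); split=> //.
    by rewrite lettersP kI jI !andbT; apply: ltn_trans kl _; rewrite -il.
  by rewrite /ht /= il in ij *; lia.
have nilp (y : letter) (v : M) : y \in letters -> exists k, iter k (E_letter y) v = 0.
  case: y => [[r i] j]; rewrite lettersP => /and3P[ij _ _].
  have ne : i != j by apply: contraTneq ij => ->; rewrite ltnn.
  case: r; last exact: integrable_nilpotent.
  by exists 2%N; apply: odd_root_square.
have [K hK] := words_vanish E_letter_linear hpos comm nilp m.
have xl t : x t \in letters.
  have [pt _] := hx t; have [x1 x2] := xB t.
  case Ex : (x t) => [[r i] j]; rewrite lettersP.
  have := prec_position x1 x2; rewrite pt Ex /= => <- /=.
  rewrite !mem_cat; apply/andP; split; apply/orP; [left|right]; apply/mapP.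
    by exists t; rewrite ?mem_enum // Ex.
  by exists t; rewrite ?mem_enum // Ex.
have hX v : act X v = \sum_t c t *: E_letter (x t) v.
  have L := act_linearl (q := M) v; rewrite XE (linear_fun_sum _ _ _ L).
  by apply: eq_bigr => t _; rewrite (linear_funZ _ _ L) (hx t).2.
suff words k : spanned [set v | exists w, [/\ all (mem letters) w, size w = k &
    v = word E_letter w m]] (iter k (act X) m).
  exists K; have s0 : subspace [set (0 : M)].
    by split=> // a y z -> ->; rewrite /= scaler0 addr0.
  apply: (spanned_sub s0 _ (words K)) => _ [w [hw sw ->]] /=.
  by apply: hK => //; rewrite -sw; apply: height_size.
elim: k => [|k IH]; first by apply: sub_spanned; exists [::].
set S := [set _ | _]; have sS : subspace (spanned S) by apply: spanned_subspace.
apply: (spanned_sub (preimage_subspace (act_linearr (q := M) X) sS) _ IH).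
move=> _ [w [hw sw ->]] /=; rewrite hX; apply: subspace_sum => // t _.
apply: subspaceZ => //; apply: sub_spanned; exists (x t :: w).
by split; rewrite /= ?xl ?sw.
Qed.

End LocalNilpotency.

Theorem Trep_cat_O'_int (C : numFieldType) (M : qModule C) : Trep M -> cat_O'_int M.
Proof.
move=> [Mint Mfl Mann]; split=> //; split=> //; split.
- exact: finite_length_generated.
- exact: integrable_semisimple.
- exact: integrable_locally_nilpotent.
Qed.

(** * Words applied to a generator *)

Section Filtration.
Variables (C : numFieldType) (M : qModule C) (m : M).
Local Notation wd := (word (@E_letter C M)).
Implicit Types (l u w : seq letter) (x y : letter).

Let wd_linear w : linear (wd w) := word_linear (@E_letter_linear C M) w.

(** The filtration of the submodule generated by m by the degree in the enveloping
    algebra. *)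
Definition filt (k : nat) : set M :=
  spanned [set v | exists2 l, (size l <= k)%N & v = wd l m].

Lemma filt_subspace k : subspace (filt k).
Proof. exact: spanned_subspace. Qed.

Lemma filt_word k l : (size l <= k)%N -> filt k (wd l m).
Proof. by move=> lk; apply: sub_spanned; exists l. Qed.

Lemma word_cat l w (v : M) : wd (l ++ w) v = wd l (wd w v).
Proof. exact: foldr_cat. Qed.

Lemma filt_word_map k w v : filt k v -> filt (size w + k) (wd w v).
Proof.
apply: (spanned_sub (preimage_subspace (wd_linear w) (filt_subspace _))).
move=> _ [l lk ->] /=; rewrite -word_cat; apply: filt_word.
by rewrite size_cat leq_add2l.
Qed.

Lemma filt_E k x v : filt k v -> filt k.+1 (E_letter x v).
Proof. exact: (@filt_word_map k [:: x]). Qed.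

(** Reordering a word changes it by a sign modulo shorter words; it only matters that
    the factor is nonzero. *)
Definition congruent l l' : Prop :=
  exists2 c : C, c != 0 & filt (size l).-1 (wd l m - c *: wd l' m).

Lemma congruent_refl l : congruent l l.
Proof.
by exists 1; rewrite ?oner_eq0 // scale1r subrr; case: (filt_subspace (size l).-1).
Qed.

Lemma congruent_sym l l' : size l = size l' -> congruent l l' -> congruent l' l.
Proof.
move=> sl [c c0 h]; exists c^-1; first by rewrite invr_eq0.
rewrite -sl; have := subspaceZ (- c^-1) (filt_subspace _) h.
by rewrite scalerBr !scaleNr scalerA mulVf // scale1r opprK addrC.
Qed.

Lemma congruent_trans l l' l'' : size l = size l' ->
  congruent l l' -> congruent l' l'' -> congruent l l''.
Proof.
move=> sl [c c0 h] [c' c'0 h']; exists (c * c'); first exact: mulf_neq0.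
rewrite -sl in h'; have := subspaceD (filt_subspace _) h (subspaceZ c (filt_subspace _) h').
by rewrite scalerBr scalerA addrA subrK.
Qed.

Lemma congruent_cons x l l' : l <> [::] -> congruent l l' -> congruent (x :: l) (x :: l').
Proof.
move=> l0 [c c0 h]; exists c => //=.
have -> : size l = (size l).-1.+1 by case: l l0 {h}.
have := filt_E x h; rewrite (linear_funB _ _ (E_letter_linear x)).
by rewrite (linear_funZ _ _ (E_letter_linear x)).
Qed.

Lemma congruent_swap x y l : congruent (x :: y :: l) (y :: x :: l).
Proof.
case: x y => [[r i] j] [[s k] t]; exists ((-1) ^+ (r && s)); first by rewrite signr_eq0.
rewrite /= /E_letter /= E_comm addrC addKr.
have short z : filt (size l).+1 (E_letter z (wd l m)).
  exact: (@filt_word (size l).+1 (z :: l)).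
apply: subspaceB (filt_subspace _) _ _; apply: subspaceZ (filt_subspace _) _.
  exact: (short (r (+) s, i, t)).
exact: (short (r (+) s, k, j)).
Qed.

Lemma congruent_move x u w : congruent (u ++ x :: w) (x :: u ++ w).
Proof.
elim: u => [|y u IH] /=; first exact: congruent_refl.
apply: congruent_trans (congruent_swap y x (u ++ w)); first by rewrite /= !size_cat /= addnS.
by apply: congruent_cons; [case: (u)|exact: IH].
Qed.

(** Commuting two generators costs a bracket, which is a shorter word. *)
Lemma perm_congruent l l' : perm_eq l l' -> congruent l l'.
Proof.
elim: l l' => [|x l IH] l' ll'.
  by move: ll'; rewrite perm_sym => /perm_nilP ->; exact: congruent_refl.
have xl' : x \in l' by rewrite -(perm_mem ll') mem_head.
case: (path.splitPr xl') ll' => u w ll'.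
have sz := perm_size ll'; rewrite size_cat /= addnS -size_cat in sz.
have pl : perm_eq l (u ++ w).
  by rewrite -(perm_cons x) (perm_trans ll') // perm_sym -cat1s perm_catCA.
apply: (@congruent_trans _ (x :: u ++ w)); first by rewrite /= sz.
  have [E|l0] := EM (l = [::]); last by apply: congruent_cons => //; exact: IH.
  by rewrite E in pl *; move: pl; rewrite perm_sym => /perm_nilP ->; exact: congruent_refl.
apply: congruent_sym; first by rewrite /= !size_cat addnS.
exact: congruent_move.
Qed.

Definition reducible l : Prop := filt (size l).-1 (wd l m).

Lemma reducible_perm l l' : perm_eq l l' -> reducible l -> reducible l'.
Proof.
move=> ll' h; have [c c0 h'] := perm_congruent ll'.
rewrite /reducible -(perm_size ll').
have -> : wd l' m = c^-1 *: (wd l m - (wd l m - c *: wd l' m)).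
  by rewrite subKr scalerA mulVf // scale1r.
by apply: subspaceZ (filt_subspace _) _; apply: subspaceB (filt_subspace _) h h'.
Qed.

Lemma reducible_cat l l' : (0 < size l')%N -> reducible l' -> reducible (l ++ l').
Proof.
move=> l'0 h; rewrite /reducible word_cat size_cat.
have -> : (size l + size l').-1 = (size l + (size l').-1)%N by lia.
exact: filt_word_map.
Qed.

Lemma reducible0 l : wd l m = 0 -> reducible l.
Proof. by rewrite /reducible => ->; case: (filt_subspace (size l).-1). Qed.

End Filtration.

Section Polarization.
Variables (C : numFieldType) (M : lmodType C) (m : M).
Variables (x : bool * nat -> M -> M) (Y : bool -> nat -> nat -> M -> M) (kappa : C).
Hypothesis kappa0 : kappa != 0.
Hypotheses (xl : forall a, linear (x a)) (Yl : forall r a b, linear (Y r a b)).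
Hypothesis xx : forall a b v, x a (x b v) = (-1) ^+ (a.1 && b.1) *: x b (x a v).
Hypothesis Yx : forall r a b v,
  Y r a b (x (false, b) v) = x (false, b) (Y r a b v) + kappa *: x (r, a) v.
Hypothesis Yx_neq : forall r a b c v, c.2 != b ->
  Y r a b (x c v) = (-1) ^+ (r && c.1) *: x c (Y r a b v).
Hypothesis Ym : forall r a b, Y r a b m = 0.
Local Notation prod_x := (foldr x).

Lemma prod_x_linear l : linear (fun v => prod_x v l).
Proof. by elim: l => [|a l IH] //; exact: (linear_comp IH (xl a)). Qed.

Lemma prod_x_move a l v : exists2 e : C, e != 0 & x a (prod_x v l) = e *: prod_x (x a v) l.
Proof.
elim: l => [|b l [e e0 h]] /=; first by exists 1; rewrite ?oner_eq0 ?scale1r.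
exists ((-1) ^+ (a.1 && b.1) * e); first by rewrite mulf_neq0 // signr_eq0.
by rewrite xx h (linear_funZ _ _ (xl b)) scalerA.
Qed.

Lemma Y_prod r a b l v : all (fun c => c.2 != b) l ->
  exists2 e : C, e != 0 & Y r a b (prod_x v l) = e *: prod_x (Y r a b v) l.
Proof.
elim: l => [|c l IH] /=; first by exists 1; rewrite ?oner_eq0 ?scale1r.
move=> /andP[cb /IH[e e0 h]].
exists ((-1) ^+ (r && c.1) * e); first by rewrite mulf_neq0 // signr_eq0.
by rewrite (Yx_neq _ _ _ cb) h (linear_funZ _ _ (xl c)) scalerA.
Qed.

Lemma Y_power r a b q :
  Y r a b (iter q.+1 (x (false, b)) m) =
  (q.+1%:R * kappa) *: x (r, a) (iter q (x (false, b)) m).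
Proof.
elim: q => [|q IH]; first by rewrite /= Yx Ym (linear_fun0 (xl _)) add0r mul1r.
rewrite iterS Yx IH (linear_funZ _ _ (xl _)) (xx (false, b) (r, a)) expr0 scale1r.
by rewrite -iterS -scalerDl -[q.+2]addn1 natrD mulrDl mul1r.
Qed.

Lemma polarize_step b p : iter p (x (false, b)) m = 0 ->
  forall l q, all (fun c => c.2 != b) l -> (size l + q)%N = p ->
  prod_x (iter q (x (false, b)) m) l = 0.
Proof.
move=> hp; elim=> [|[r a] l IH] q /=; first by rewrite add0n => _ ->.
move=> /andP[ab hl] sq.
have /(congr1 (Y r a b)) : prod_x (iter q.+1 (x (false, b)) m) l = 0.
  by apply: IH; rewrite // -sq addSnnS.
have [e e0 ->] := Y_prod r a (iter q.+1 (x (false, b)) m) hl.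
rewrite (linear_fun0 (Yl _ _ _)) Y_power (linear_funZ _ _ (prod_x_linear l)).
move/eqP; rewrite !scaler_eq0 mulf_eq0 (negPf e0) (negPf kappa0) pnatr_eq0 /= => /eqP h.
have [e' _ ->] := prod_x_move (r, a) l (iter q (x (false, b)) m).
by rewrite h scaler0.
Qed.

(** From the vanishing of one power of one even letter x_b, the operators Y that
    replace the index b by others produce the vanishing of every product of the same
    degree, odd letters included: an index is replaced at a time, starting from a b
    that does not occur in the product. *)
Lemma polarize b p : iter p (x (false, b)) m = 0 ->
  forall l, size l = p -> prod_x m l = 0.
Proof.
move=> hb; have all_b c : iter p (x (false, c)) m = 0.
  have [->//|cb] := eqVneq c b.
  have h : prod_x m (nseq p (false, c)) = 0.
    apply: (polarize_step hb (q := 0)); last by rewrite size_nseq addn0.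
    by rewrite all_nseq cb orbT.
  have <- // : prod_x m (nseq p (false, c)) = iter p (x (false, c)) m.
  by elim: (p) => // k /= ->.
move=> l sl; pose c := (\max_(a <- l) a.2).+1.
apply: (polarize_step (all_b c) (q := 0)); last by rewrite addn0.
apply/allP => a al; rewrite neq_ltn ltnS.
suff -> : (a.2 <= \max_(a <- l) a.2)%N by [].
by apply: leq_bigmax_seq al _.
Qed.

End Polarization.

(** * The letters of a long word repeat *)

Lemma zenum_inj : injective zenum.
Proof.
move=> a b /(congr1 val); rewrite /= /zenum_val.
by case: ifP; case: ifP => ob oa; lia.
Qed.

Definition zrank (i : zidx) : nat := sval (cid (zenum_surj i)).

Lemma zrankK i : zenum (zrank i) = i.
Proof. by rewrite -(svalP (cid (zenum_surj i))). Qed.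

Lemma zenumK k : zrank (zenum k) = k.
Proof. by apply: zenum_inj; rewrite zrankK. Qed.

Lemma zenum_eq a b : (zenum a == zenum b) = (a == b).
Proof. exact: (inj_eq zenum_inj). Qed.

Section LetterTypes.
Variable n : nat.

(** The index of a letter in g_n, or None if it is an index of c_n; up to the choice of
    the outer indices there are finitely many letters. *)
Definition inner (i : zidx) : option 'I_n := insub (zrank i).
Definition letter_type := (bool * option 'I_n * option 'I_n)%type.
Definition type_of (x : letter) : letter_type := (x.1.1, inner x.1.2, inner x.2).

Definition outer (a : nat) : zidx := zenum (n + a).

Lemma inner_some i a : inner i = Some a -> i = zenum a.
Proof. by rewrite /inner; case: insubP => // u _ hu [<-]; rewrite hu zrankK. Qed.

Lemma inner_none i : inner i = None -> i = outer (zrank i - n).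
Proof.
rewrite /inner; case: insubP => // ni _; rewrite -leqNgt in ni.
by rewrite /outer subnKC // zrankK.
Qed.

Lemma outer_eq a b : (outer a == outer b) = (a == b).
Proof. by rewrite zenum_eq eqn_add2l. Qed.

Lemma outer_inner a (i : 'I_n) : (outer a == zenum i) = false.
Proof.
rewrite zenum_eq; apply/negbTE; rewrite neq_ltn.
by rewrite (leq_trans (ltn_ord i) (leq_addr a n)) orbT.
Qed.

Variables (C : numFieldType) (M : qModule C) (m : M).
Hypotheses (Mint : integrable M) (m_weight : weight_vector m).
Hypothesis m_ann : forall r a b, E r (outer a) (outer b) m = 0.
Local Notation wd := (word (@E_letter C M)).

Lemma word_rcons l x (v : M) : wd (rcons l x) v = wd l (E_letter x v).
Proof. by rewrite -cats1 word_cat. Qed.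

(** The outer index may vary within the product, so the nilpotency of one root vector
    does not suffice; polarization by the operators of c_n, which kill m, yields the
    other products from the power of one root vector. *)
Lemma outer_left_products j : exists d, forall l,
  all (fun x : letter => (inner x.1.2 == None) && (x.2 == zenum j)) l ->
  size l = d -> (j < n)%N -> wd l m = 0.
Proof.
have [jn|jn] := ltnP j n; last by exists 0%N.
have oj a : (outer a == zenum j) = false by exact: (outer_inner a (Ordinal jn)).
have jo a : (zenum j == outer a) = false by rewrite eq_sym.
have [|d hd] := integrable_nilpotent (i := outer 0) (j := zenum j) Mint m.
  by rewrite oj.
exists d => l hl sl _.
pose x (a : bool * nat) : M -> M := E a.1 (outer a.2) (zenum j).
pose Y r a b : M -> M := E r (outer a) (outer b).
have := polarize (x := x) (Y := Y) (oner_neq0 C) _ _ _ _ _ m_ann hd.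
have El a : linear (x a) by exact: E_linear.
have Yl r a b : linear (Y r a b) by exact: E_linear.
have xx a b v : x a (x b v) = (-1) ^+ (a.1 && b.1) *: x b (x a v).
  by rewrite /x E_comm jo oj mulr0 !scale0r subr0 addr0.
have Yx r a b v : Y r a b (x (false, b) v) = x (false, b) (Y r a b v) + 1 *: x (r, a) v.
  rewrite /x /Y E_comm /= eqxx oj mulr0 scale0r subr0 !scale1r andbF expr0 scale1r.
  by rewrite addbF.
have Yxn r a b c v : c.2 != b -> Y r a b (x c v) = (-1) ^+ (r && c.1) *: x c (Y r a b v).
  move=> cb; rewrite /x /Y E_comm outer_eq oj [b == _]eq_sym (negPf cb).
  by rewrite mulr0 !scale0r subr0 addr0.
move=> /(_ El Yl xx Yx Yxn [seq (y.1.1, zrank y.1.2 - n)%N | y <- l]).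
rewrite size_map => /(_ sl) h; rewrite -[RHS]h foldr_map.
elim: l hl {sl h} => //= y l IH /andP[/andP[/eqP hy /eqP hj] /IH <-].
by rewrite /E_letter {1}(inner_none hy) hj.
Qed.

Lemma outer_right_products i : exists d, forall l,
  all (fun x : letter => (x.1.2 == zenum i) && (inner x.2 == None)) l ->
  size l = d -> (i < n)%N -> wd l m = 0.
Proof.
have [jn|jn] := ltnP i n; last by exists 0%N.
have oj a : (outer a == zenum i) = false by exact: (outer_inner a (Ordinal jn)).
have jo a : (zenum i == outer a) = false by rewrite eq_sym.
have [|d hd] := integrable_nilpotent (i := zenum i) (j := outer 0) Mint m.
  by rewrite jo.
exists d => l hl sl _.
pose x (a : bool * nat) : M -> M := E a.1 (zenum i) (outer a.2).
pose Y r a b : M -> M := E r (outer b) (outer a).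
have n1 : (-1 : C) != 0 by rewrite oppr_eq0 oner_eq0.
have Ym r a b : Y r a b m = 0 by exact: m_ann.
have := polarize (x := x) (Y := Y) n1 _ _ _ _ _ Ym hd.
have El a : linear (x a) by exact: E_linear.
have Yl r a b : linear (Y r a b) by exact: E_linear.
have xx a b v : x a (x b v) = (-1) ^+ (a.1 && b.1) *: x b (x a v).
  by rewrite /x E_comm jo oj mulr0 !scale0r subr0 addr0.
have Yx r a b v : Y r a b (x (false, b) v) = x (false, b) (Y r a b v) + (-1) *: x (r, a) v.
  rewrite /x /Y E_comm /= eqxx oj scale0r sub0r andbF expr0 !scale1r mul1r.
  by rewrite addbF scale1r scaleN1r.
have Yxn r a b c v : c.2 != b -> Y r a b (x c v) = (-1) ^+ (r && c.1) *: x c (Y r a b v).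
  move=> cb; rewrite /x /Y E_comm outer_eq oj [b == _]eq_sym (negPf cb).
  by rewrite mulr0 !scale0r subr0 addr0.
move=> /(_ El Yl xx Yx Yxn [seq (y.1.1, zrank y.2 - n)%N | y <- l]).
rewrite size_map => /(_ sl) h; rewrite -[RHS]h foldr_map.
elim: l hl {sl h} => //= y l IH /andP[/andP[/eqP hj /eqP hy] /IH <-].
by rewrite /E_letter {1}(inner_none hy) hj.
Qed.

(** The letters of c_n kill m, even torus letters of g_n multiply it by its weight, the
    square of an odd letter of g_n is half a bracket, and the other even letters are
    nilpotent on m; letters with one outer index are handled by polarization. *)
Lemma type_bound tau : exists2 p, (0 < p)%N & forall l,
  all (fun x => type_of x == tau) l -> size l = p -> reducible m l.
Proof.
have last_letter (l : seq letter) p : size l = p.+1 -> exists l' x, l = rcons l' x /\ size l' = p.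
  case/lastP: l => // l' x; rewrite size_rcons => -[sl].
  by exists l', x.
case: tau => [[r [i|]] [j|]].
- have xE x : type_of x == (r, Some i, Some j) -> x = (r, zenum i, zenum j).
    case: x => [[s a] b] /eqP[-> /inner_some -> /inner_some ->] //.
  case: r xE => xE.
    exists 2%N => // l hl sl; have [l' [x [lE sl']]] := last_letter l _ sl.
    have [l2 [y [E' /size0nil E2]]] := last_letter l' _ sl'.
    move: hl; rewrite lE E' E2 /= => /and3P[/xE -> /xE -> _].
    rewrite /reducible /=; set z := (true, zenum i, zenum j).
    have := E_comm true (zenum i) (zenum j) true (zenum i) (zenum j) m.
    set B := (X in _ = _ + X) => h.
    have -> : E_letter z (E_letter z m) = 2%:R^-1 *: B.
      move: h; rewrite /= expr1 scaleN1r => /eqP; rewrite addrC -subr_eq opprK => /eqP <-.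
      by rewrite -mulr2n -scaler_nat scalerA mulVf ?scale1r // pnatr_eq0.
    have short s a b : filt m 1 (E s a b m) by exact: (@filt_word _ _ m 1 [:: (s, a, b)]).
    apply: subspaceZ (filt_subspace m 1) _.
    by apply: subspaceB (filt_subspace m 1) _ _; apply: subspaceZ (filt_subspace m 1) _.
  have [ij|ij] := eqVneq i j.
    exists 1%N => // l hl sl; have [l' [x [lE sl']]] := last_letter l _ sl.
    move: hl; rewrite lE (size0nil sl') /= => /andP[/xE -> _].
    have [lam hlam] := m_weight.
    have hH : q_cartan_even (gen C false (zenum i) (zenum i)).
      split; last exact: gen_part.
      by apply: sub_spanned; exists false, (zenum i), (zenum i).
    rewrite /reducible /= /E_letter /= -ij -[E _ _ _ m]/(act _ m) hlam //.
    apply: subspaceZ (filt_subspace m 0) _; exact: (@filt_word _ _ m 0 [::]).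
  have [|d hd] := integrable_nilpotent (i := zenum i) (j := zenum j) Mint m.
    by rewrite zenum_eq.
  exists d.+1 => // l hl sl; apply: reducible0.
  have -> : wd l m = iter (size l) (E false (zenum i) (zenum j)) m.
    by elim: l hl {sl} => //= x l IH /andP[/xE -> /IH <-].
  by rewrite sl iterS hd (linear_fun0 (E_linear _ _ _)).
- have [d hd] := outer_right_products i; exists d.+1 => // l hl sl; apply: reducible0.
  case: l hl sl => // x l /= /andP[_ hl] [sl]; rewrite hd //.
    exact: linear_fun0 (E_letter_linear x).
  apply: sub_all hl => y /eqP[_ /inner_some -> /eqP ->]; by rewrite eqxx.
- have [d hd] := outer_left_products j; exists d.+1 => // l hl sl; apply: reducible0.
  case: l hl sl => // x l /= /andP[_ hl] [sl]; rewrite hd //.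
    exact: linear_fun0 (E_letter_linear x).
  apply: sub_all hl => y /eqP[_ /eqP -> /inner_some ->]; by rewrite eqxx.
- exists 1%N => // l hl sl; have [l' [x [lE _]]] := last_letter l _ sl.
  apply: reducible0; rewrite lE word_rcons.
  have /eqP[_ /inner_none hi /inner_none hj] : type_of x == (r, None, None).
    by move: hl; rewrite lE all_rcons => /andP[].
  rewrite /E_letter hi hj m_ann; exact: linear_fun0 (word_linear (@E_letter_linear C M) l').
Qed.

(** By the pigeonhole principle a long word contains many letters of the same type. *)
Lemma long_words_reducible : exists D, forall l, (D < size l)%N -> reducible m l.
Proof.
have [p hp] : exists p : letter_type -> nat, forall tau, (0 < p tau)%N /\ forall l,
    all (fun x => type_of x == tau) l -> size l = p tau -> reducible m l.
  have ex tau : exists p, (0 < p)%N /\ forall l,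
      all (fun x => type_of x == tau) l -> size l = p -> reducible m l.
    by have [p p0 hp] := type_bound tau; exists p.
  by exists (fun tau => sval (cid (ex tau))) => tau; apply: (svalP (cid (ex tau))).
exists (\sum_tau p tau) => l hl.
have [tau htau] : exists tau, (p tau <= count (fun x => type_of x == tau) l)%N.
  apply: contrapT => h; move: hl; rewrite ltnNge => /negP; apply.
  have -> : size l = \sum_tau count (fun x => type_of x == tau) l.
    elim: (l) => [|x l' IH] /=; first by rewrite big1.
    rewrite big_split /= -IH (bigD1 (type_of x)) //= eqxx big1 ?addn0 // => tau.
    by rewrite eq_sym => /negPf ->.
  apply: leq_sum => tau _; rewrite leqNgt; apply/negP => lt; apply: h.
  by exists tau; apply: ltnW.
have [p0 hptau] := hp tau.
set q := fun x => type_of x == tau in htau hptau.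
have perm : perm_eq (filter (predC q) l ++ filter q l) l.
  by rewrite perm_catC perm_filterC.
apply: reducible_perm perm _.
have sz : (p tau <= size (filter q l))%N by rewrite size_filter.
rewrite -(cat_take_drop (size (filter q l) - p tau) (filter q l)).
have sd : size (drop (size (filter q l) - p tau) (filter q l)) = p tau.
  by rewrite size_drop subKn.
do 2! (apply: reducible_cat; first by rewrite ?size_cat ?sd ?addn_gt0 ?p0 ?orbT).
apply: hptau => //; apply/allP => x /mem_drop.
by rewrite mem_filter => /andP[].
Qed.

End LetterTypes.

(** * Words as images of mixed tensors *)

Section Patterns.
Variables (n D : nat) (C : numFieldType) (M : qModule C).
Local Notation slot := ('I_D * bool)%type.
Local Notation K := {ffun slot -> option nat}.
Local Notation T := {malg C[K]}.
Local Notation wd := (word (@E_letter C M)).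
Implicit Types (k : K) (s : 'I_D) (p : slot).

(** The letter in position s has a slot for its first index, where gl(oo) acts
    covariantly, and one for its second index, where it acts contravariantly. *)
Definition covariant p : bool := ~~ p.2.

Definition pattern := {ffun 'I_D -> letter_type n}.

Definition index_of (o : option 'I_n) (z : option nat) : zidx :=
  if o is Some i then zenum i else outer n (odflt 0%N z).

Definition letter_at (t : pattern) k s : letter :=
  ((t s).1.1, index_of (t s).1.2 (k (s, false)), index_of (t s).2 (k (s, true))).

Definition slot_outer (t : pattern) p : bool :=
  (if p.2 then (t p.1).2 else (t p.1).1.2) == None.

Definition positions (l : nat) : seq 'I_D := take l (enum 'I_D).

(** The slots of outer indices; the other ones are left empty. *)
Definition required (t : pattern) (l : nat) : {set slot} :=
  [set p | (p.1 \in positions l) && slot_outer t p].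

Lemma positions_uniq l : uniq (positions l).
Proof. by rewrite take_uniq // enum_uniq. Qed.

Lemma letter_at_upd t k p x s : s != p.1 -> letter_at t (upd k p x) s = letter_at t k s.
Proof.
move=> sp; rewrite /letter_at !upd_neq //.
  by apply: contra sp => /eqP <-.
by apply: contra sp => /eqP <-.
Qed.

Variable m : M.
Hypothesis m_ann : forall r a b, E r (outer n a) (outer n b) m = 0.

Definition pattern_word t k (L : seq 'I_D) : M := wd [seq letter_at t k s | s <- L] m.

Lemma pattern_word_cons t k s L :
  pattern_word t k (s :: L) = E_letter (letter_at t k s) (pattern_word t k L).
Proof. by []. Qed.

Lemma pattern_word_upd t k p x L : p.1 \notin L ->
  pattern_word t (upd k p x) L = pattern_word t k L.
Proof.
move=> pL; rewrite /pattern_word; congr (word _ _ m); apply/eq_in_map => s sL.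
by rewrite letter_at_upd //; apply: contraNneq pL => <-.
Qed.

Definition derived_term t (L : seq 'I_D) a b k p : M :=
  if p.2 then (if k p == Some a then - pattern_word t (upd k p (Some b)) L else 0)
  else (if k p == Some b then pattern_word t (upd k p (Some a)) L else 0).

(** The generator m is killed by c_n, so a root vector of c_n acts on a word as a
    derivation, one outer index at a time. *)
Lemma pattern_word_equivariant t k L a b : uniq L ->
  (forall p, p.1 \in L -> (k p != None) = slot_outer t p) ->
  E false (outer n a) (outer n b) (pattern_word t k L) =
  \sum_(s <- L) (derived_term t L a b k (s, false) + derived_term t L a b k (s, true)).
Proof.
elim: L => [|s L IH] /=; first by rewrite big_nil m_ann.
move=> /andP[sL uL] kL.
have El x := E_letter_linear (C := C) (M := M) x.
have later p : p.1 \in L -> E_letter (letter_at t k s) (derived_term t L a b k p) =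
    derived_term t (s :: L) a b k p.
  move=> pL; have sp : s != p.1 by apply: contraNneq sL => ->.
  rewrite /derived_term /pattern_word /= !letter_at_upd //.
  by case: p.2; case: ifP => _; rewrite ?(linear_fun0 (El _)) ?(linear_funN _ (El _)).
rewrite big_cons pattern_word_cons.
rewrite /E_letter E_comm -/(E_letter _ _) IH //; last first.
  by move=> p pL; apply: kL; rewrite inE pL orbT.
rewrite (linear_fun_sum _ _ _ (El _)) /= expr0 scale1r mul1r addrC; congr (_ + _); last first.
  rewrite !big_seq; apply: eq_bigr => s' s'L.
  by rewrite (linear_funD _ _ (El _)) !later.
have outs (be : bool) : (k (s, be) != None) = slot_outer t (s, be).
  by apply: kL; rewrite mem_head.
congr (_ + _).
- rewrite /derived_term /=; have := outs false; rewrite /slot_outer /=.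
  case ts : (t s).1.2 => [i0|] /=.
    by case: (k (s, false)) => // _; rewrite outer_inner scale0r.
  case ks : (k (s, false)) => [z|] // _ /=; rewrite outer_eq.
  rewrite [in RHS]/eq_op /= [z == b]eq_sym; case: eqP => _; last by rewrite scale0r.
  rewrite scale1r pattern_word_cons pattern_word_upd //.
  by rewrite /E_letter /letter_at /= updE ts upd_neq // xpair_eqE eqxx.
- rewrite /derived_term /=; have := outs true; rewrite /slot_outer /=.
  case ts : (t s).2 => [i0|] /=.
    by case: (k (s, true)) => // _; rewrite outer_inner scale0r oppr0.
  case ks : (k (s, true)) => [z|] // _ /=; rewrite outer_eq.
  rewrite [in RHS]/eq_op /= [z == a]eq_sym; case: eqP => _; last by rewrite scale0r oppr0.
  rewrite scale1r pattern_word_cons pattern_word_upd //.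
  by rewrite /E_letter /letter_at /= updE ts upd_neq // xpair_eqE eqxx.
Qed.

Definition pattern_map (t : pattern) (l : nat) : T -> M :=
  extend (fun k => pattern_word t k (positions l)).

Lemma pattern_map_linear t l : linear (pattern_map t l).
Proof. exact: extend_linear. Qed.

Definition outer_op (o : nat * nat) : M -> M := E false (outer n o.1) (outer n o.2).

Lemma outer_op_linear o : linear (outer_op o). Proof. exact: E_linear. Qed.

Lemma pattern_map_equivariant t l o x : @active_part C _ (required t l) x ->
  outer_op o (pattern_map t l x) = pattern_map t l (gl_op covariant o x).
Proof.
apply: (supported_eq (f := outer_op o \o pattern_map t l)
  (g := pattern_map t l \o gl_op covariant o)).
- exact: linear_comp (pattern_map_linear t l) (outer_op_linear o).
- exact: linear_comp (@gl_op_linear _ _ covariant o) (pattern_map_linear t l).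
move=> k kA; case: o => a b; rewrite /= /gl_op move_idx_basis.
rewrite (linear_fun_sum _ _ _ (pattern_map_linear t l)) /pattern_map extend_basis.
have kL p : p.1 \in positions l -> (k p != None) = slot_outer t p.
  by move=> pl; have /setP/(_ p) := kA; rewrite !inE pl.
rewrite /outer_op /= pattern_word_equivariant ?positions_uniq //.
have term p : extend (fun k => pattern_word t k (positions l))
    ((-1) ^+ (~~ true) *: @move_term C _ covariant true b a k p) =
    derived_term t (positions l) a b k p.
  rewrite expr0 scale1r /move_term /derived_term /covariant.
  case: p.2 => /=; case: ifP => _; rewrite ?(linear_fun0 (extend_linear _)) //.
    by rewrite (linear_funN _ (extend_linear _)) extend_basis.
  by rewrite extend_basis.
under [RHS]eq_bigr do rewrite term.
have -> : \sum_p derived_term t (positions l) a b k p =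
    \sum_s \sum_(be : bool) derived_term t (positions l) a b k (s, be).
  by rewrite pair_bigA; apply: eq_bigr => -[s be].
rewrite [RHS](bigID (mem (positions l))) /=.
rewrite [X in _ = _ + X]big1 ?addr0.
  by rewrite big_uniq ?positions_uniq //; apply: eq_bigr => s _; rewrite big_bool addrC.
move=> s sl; rewrite big1 // => be _.
have kN : k (s, be) = None.
  by apply/eqP; have /setP/(_ (s, be)) := kA; rewrite !inE (negPf sl) /= => /negbFE.
by rewrite /derived_term kN; case: be {kN}.
Qed.

(** The outer indices of the word, counted from n on, fill the slots of its pattern. *)
Lemma word_pattern (w : seq letter) : (size w <= D)%N -> exists (t : pattern) (k : K),
  active k = required t (size w) /\ pattern_word t k (positions (size w)) = wd w m.
Proof.
move=> wD; pose x0 : letter := (false, outer n 0, outer n 0).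
pose t : pattern := [ffun s => type_of n (nth x0 w (val s))].
pose idx p := if p.2 then (nth x0 w (val p.1)).2 else (nth x0 w (val p.1)).1.2.
pose k : K := [ffun p => if (p.1 \in positions (size w)) && slot_outer t p
  then Some (zrank (idx p) - n)%N else None].
exists t, k; split.
  by apply/setP => p; rewrite !inE ffunE; case: ifP.
rewrite /pattern_word; congr (word _ _ m).
have letterE s : s \in positions (size w) -> letter_at t k s = nth x0 w (val s).
  move=> sw; rewrite /letter_at !ffunE /= sw /slot_outer /= ffunE /idx /=.
  case: (nth x0 w s) => [[r i] j] /=; congr (_, _, _).
    by case E : (inner n i) => [i0|] /=; [rewrite (inner_some E)|rewrite [RHS](inner_none E)].
  by case E : (inner n j) => [i0|] /=; [rewrite (inner_some E)|rewrite [RHS](inner_none E)].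
have -> : [seq letter_at t k s | s <- positions (size w)] =
    [seq nth x0 w (val s) | s <- positions (size w)] by apply/eq_in_map.
rewrite /positions map_take.
have -> : [seq nth x0 w (val s) | s <- enum 'I_D] = [seq nth x0 w j | j <- iota 0 D].
  by rewrite -val_enum_ord -map_comp.
by rewrite -map_take take_iota (minn_idPl wD) map_nth_iota0 // take_size.
Qed.

End Patterns.

(** * Modules of category O with large annihilators have finite length *)

Section Components.
Variables (C : numFieldType) (M : qModule C).
Implicit Types (u v m : M) (t : bool).

Lemma component_comb t (c : C) u v :
  component t (c *: u + v) = c *: component t u + component t v.
Proof.
have [hu hu'] := componentP t u; have [hv hv'] := componentP t v.
apply: component_uniq.
  by have [_ h] := part_subspace M t; apply: h.
rewrite opprD addrACA -scalerBr.
by have [_ h] := part_subspace M (~~ t); apply: h.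
Qed.

Lemma component_act t (H : q_infty C) m : part false H ->
  component t (act H m) = act H (component t m).
Proof.
move=> hH; have [h h'] := componentP t m; have L := act_linearr (q := M) H.
apply: component_uniq; first exact: (act_part hH h).
by rewrite -(linear_funB _ _ L); apply: (act_part hH h').
Qed.

Lemma weight_component t m : weight_vector m -> weight_vector (component t m).
Proof.
move=> [lam h]; exists lam => H hH.
have c0 : component t 0 = 0 :> M by rewrite component_id //; exact: part0.
have [_ hev] := hH; rewrite -component_act // h // -[lam H *: m]addr0 component_comb.
by rewrite c0 addr0.
Qed.

Lemma word_part (w : seq letter) t m : part t m ->
  exists t', part t' (word (@E_letter C M) w m).
Proof.
move=> hm; elim: w => [|x w [t' IH]] /=; first by exists t.
by exists (x.1.1 (+) t'); apply: E_part.
Qed.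

(** The parity components of a weight vector are weight vectors again, and finitely
    many vectors are killed by a common c_n. *)
Lemma good_generators : finitely_generated M -> cartan_semisimple M ->
  large_annihilator M -> exists n (s : seq M),
  (forall m, m \in s -> [/\ exists t, part t m, weight_vector m &
     forall r a b, E r (outer n a) (outer n b) m = 0]) /\
  (forall N : set M, is_submodule N -> (forall m, m \in s -> N m) -> N = setT).
Proof.
move=> [s0 gen0] ss ann.
have [s [hs hgen]] : exists s : seq M,
    (forall m, m \in s -> (exists t, part t m) /\ weight_vector m) /\
    forall N, subspace N -> (forall m, m \in s -> N m) -> forall v, v \in s0 -> N v.
  elim: s0 {gen0} => [|v s0 [s [hs hN]]]; first by exists [::]; split.
  have [k [c [u [hu E]]]] := ss v.
  exists ([seq component false (u i) | i <- enum 'I_k] ++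
          [seq component true (u i) | i <- enum 'I_k] ++ s); split.
    move=> m; rewrite !mem_cat => /or3P[/mapP[i _ ->]|/mapP[i _ ->]|/hs //];
      by split; [eexists; exact: component_part|exact: weight_component].
  move=> N sN Nm w; rewrite inE => /orP[/eqP ->|]; last first.
    by apply: hN => // m ms; apply: Nm; rewrite !mem_cat ms !orbT.
  rewrite E; apply: subspace_sum => // i _; apply: subspaceZ => //.
  rewrite (component_sum (u i)); apply: subspaceD => //; apply: Nm; rewrite !mem_cat.
    by rewrite (map_f (fun i => component false (u i))) // mem_enum.
  by rewrite (map_f (fun i => component true (u i))) ?orbT // mem_enum.
have [n hn] : exists n, forall m, m \in s -> forall r i j,
    (n <= zrank i)%N -> (n <= zrank j)%N -> E r i j m = 0.
  elim: s {hs hgen} => [|m s [n hn]]; first by exists 0%N.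
  have [n' [_ hn']] := ann m; exists (n + n')%N => m'.
  rewrite inE => /orP[/eqP ->|ms] r i j hi hj; last by apply: hn => //; lia.
  apply: (invariants_E _ hn') => /truncationP[k [kn E]].
    by move: hi; rewrite E zenumK; lia.
  by move: hj; rewrite E zenumK; lia.
exists n, s; split.
  move=> m ms; have [h1 h2] := hs m ms; split=> // r a b.
  by apply: hn; rewrite // /outer zenumK leq_addr.
move=> N sN Nm; apply: gen0 => // v; apply: hgen => //.
by case: sN.
Qed.

Section Generated.
Variables (n D : nat) (s : seq M).
Hypothesis s_part : forall m, m \in s -> exists t, part t m.
Hypothesis s_ann : forall m, m \in s -> forall r a b, E r (outer n a) (outer n b) m = 0.
Hypothesis s_gen : forall N : set M, is_submodule N -> (forall m, m \in s -> N m) ->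
  N = setT.
Hypothesis s_long : forall m, m \in s -> forall l, (D < size l)%N -> reducible m l.

Definition short_words : set M := [set v | exists m w,
  [/\ m \in s, (size w <= D)%N & v = word (@E_letter C M) w m]].

(** A word of length D + 1 is a combination of shorter ones, so the span of the short
    words is a submodule; it contains the generators. *)
Lemma short_words_span v : spanned short_words v.
Proof.
have sN := spanned_subspace short_words.
suff -> : spanned short_words = setT by [].
apply: s_gen => [|m ms]; last by apply: sub_spanned; exists m, [::].
split.
- by case: sN.
- by case: sN.
- move=> t {}v; apply: (spanned_sub (N := [set v | spanned short_words (component t v)])).
    split=> /=; first by rewrite component_id; [case: sN|exact: part0].
    by move=> c u w hu hw; rewrite component_comb; case: sN => _; apply.
  move=> _ [m [w [ms wD ->]]] /=; have [t' hm] := s_part ms.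
  have [t'' hw] := word_part w hm.
  have [<-|/bool_neq E] := eqVneq t'' t.
    by rewrite component_id //; apply: sub_spanned; exists m, w.
  by rewrite component_opp; [case: sN|rewrite -E].
- apply: act_stable => // r i j {}v.
  apply: (spanned_sub (preimage_subspace (@E_linear C M r i j) sN)).
  move=> _ [m [w [ms wD ->]]] /=.
  rewrite -[E r i j _]/(word (@E_letter C M) ((r, i, j) :: w) m).
  have [sw|sw] := ltnP (size w) D; first by apply: sub_spanned; exists m, ((r, i, j) :: w).
  have long : (D < size ((r, i, j) :: w))%N by [].
  have := s_long ms long; rewrite /reducible /=; apply: spannedW => _ [l lw ->].
  by apply: sub_spanned; exists m, l; split=> //; apply: leq_trans wD.
Qed.

(** The module is the sum of the images of finitely many spaces of mixed tensors,
    equivariantly for the copy of gl(oo) in the even part of c_n. *)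
Lemma generated_finite_length : finite_length M.
Proof.
pose J : finType := ('I_(size s) * 'I_D.+1 * pattern n D)%type.
pose f (j : J) := pattern_map (nth 0 s j.1.1) j.2 j.1.2.
pose R (j : J) := @active_part C _ (required j.2 j.1.2).
have [b hb] : exists b : J -> nat, forall j,
    bounded (stable_in (gl_op (@covariant D)) (R j)) (b j).
  have ex j : exists b, bounded (stable_in (gl_op (@covariant D)) (R j)) b.
    exact: mixed_tensors_bounded.
  by exists (fun j => sval (cid (ex j))) => j; apply: (svalP (cid (ex j))).
have nth_s (i : 'I_(size s)) : nth 0 s i \in s by rewrite mem_nth.
apply: (@bounded_finite_length _ _ (\sum_j b j)).
suff h : bounded (stable_in (@outer_op n C M) setT) (\sum_j b j).
  apply: boundedW h => N [N0 NP Nc Na]; split=> //; split=> // o v; exact: Na.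
apply: (bounded_sum_images (f := f) (opW := gl_op (@covariant D)) (RW := R)) => //.
- exact: outer_op_linear.
- by move=> j; apply: pattern_map_linear.
- by move=> j; apply: active_part_stable.
- by move=> j o x; apply: pattern_map_equivariant; apply: s_ann.
move=> v _; have := short_words_span v.
apply: (spanned_sub (N := [set v | exists x, (forall j, R j (x j)) /\ v = \sum_j f j (x j)])).
  have fl j : linear (f j) by apply: pattern_map_linear.
  split.
    exists (fun=> 0); split=> [j|]; last by rewrite big1 // => j _; exact: (linear_fun0 (fl j)).
    by have [[]] := @active_part_stable C _ (@covariant D) (required j.2 j.1.2).
  move=> c _ _ [x [hx ->]] [y [hy ->]]; exists (fun j => c *: x j + y j); split.
    move=> j; have [[_ h] _] := @active_part_stable C _ (@covariant D) (required j.2 j.1.2).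
    exact: (h c _ _ (hx j) (hy j)).
  by rewrite scaler_sumr -big_split; apply: eq_bigr => j _; rewrite fl.
move=> _ [m [w [ms wD ->]]] /=.
have [t [k [kA <-]]] := word_pattern n m wD.
have im : (index m s < size s)%N by rewrite index_mem.
have wD' : (size w < D.+1)%N by [].
pose j : J := (Ordinal im, Ordinal wD', t).
exists (fun i => if i == j then << k >> else 0); split.
  move=> i; case: eqP => [->|_]; first by apply: supported_basis.
  by have [[]] := @active_part_stable C _ (@covariant D) (required i.2 i.1.2).
rewrite (bigD1 j) //= eqxx big1 ?addr0.
  by rewrite /f /= nth_index // /pattern_map extend_basis.
move=> i /negPf ->; apply: linear_fun0; exact: pattern_map_linear.
Qed.

End Generated.

Theorem cat_O'_int_Trep : cat_O'_int M -> Trep M.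
Proof.
move=> [[[fg ss _] ann] Mint]; split=> //.
have [n [s [hs gen]]] := good_generators fg ss ann.
have [D hD] : exists D, forall m, m \in s -> forall l, (D < size l)%N -> reducible m l.
  elim: s hs {gen} => [|m s IH] hs; first by exists 0%N.
  have [|D hD] := IH; first by move=> m' m's; apply: hs; rewrite inE m's orbT.
  have [_ m_weight m_ann] := hs m (mem_head _ _).
  have [D' hD'] := long_words_reducible Mint m_weight m_ann.
  exists (D + D')%N => m'; rewrite inE => /orP[/eqP ->|m's] l hl.
    by apply: hD'; lia.
  by apply: (hD m') => //; lia.
apply: (generated_finite_length (n := n) _ _ gen hD) => m /hs[] //.
Qed.

End Components.

Theorem theorem3p11 (R : realType) (M : qModule R[i]) : Trep M <-> cat_O'_int M.
Proof. by split; [exact: Trep_cat_O'_int|exact: cat_O'_int_Trep]. Qed.
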